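(* Let $\Omega\subset\mathbb{R}^3$ be open, bounded and convex with $\mathcal{L}^3(\Omega)=1$, and fix $N\in\mathbb{N}$ with $N\geq 2$. For any $T\in(0,\infty)$ and any well-prepared discrete probability measure $\overline{\alpha}\in\mathcal{Q}^N(\mathbb{R}^3)$, there exists a unique continuously differentiable discrete geostrophic solution $\alpha\in C([0,T];\mathcal{P}_c(\mathbb{R}^3))$ with initial measure $\overline{\alpha}$. Moreover, this solution is energy-conserving.
   Context: $\mathcal{L}^3$ is Lebesgue measure, $\mathcal{L}^3\llcorner\Omega$ its restriction to $\Omega$. $\mathcal{P}_c(\mathbb{R}^3)$ is the set of compactly supported Borel probability measures on $\mathbb{R}^3$, equipped with the Wasserstein 2-distance $W_2$; $C([0,T];\mathcal{P}_c(\mathbb{R}^3))$ denotes continuous maps $t\mapsto\alpha_t$ w.r.t. $W_2$. For a probability measure $\nu$ with finite second moment, $\mathcal{B}[\nu]$ denotes the unique mean-zero convex function in $H^1(\Omega)$ whose gradient is the optimal transport map from $\mathcal{L}^3\llcorner\Omega$ to $\nu$ for the cost $|x-y|^2$. $J$ is the $3\times 3$ matrix with rows $(0,-1,0),(1,0,0),(0,0,0)$; $e_3=(0,0,1)$. $\mathcal{Q}^N(\mathbb{R}^3)$ is the set of measures $\sum_{i=1}^N m_i\delta_{z_i}$ with $m_i>0$, $\sum_i m_i=1$, and $z_i\neq z_j$ for $i\neq j$. Such a measure is well-prepared if there is $r>0$ with $|(z_i-z_j)\cdot e_3|\geq r$ for all $i\neq j$. A map $\alpha\in C([0,T];\mathcal{P}_c(\mathbb{R}^3))$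 is a geostrophic solution on $[0,T]$ with initial measure $\overline{\alpha}\in\mathcal{P}_c(\mathbb{R}^3)$ if for all $\varphi\in C_c^\infty(\mathbb{R}^3\times\mathbb{R})$, $$\int_0^T\!\!\int_{\mathbb{R}^3}\big(\partial_t\varphi(z,t)+Jz\cdot\nabla\varphi(z,t)\big)\,d\alpha_t(z)\,dt-\int_0^T\!\!\int_\Omega Jx\cdot\nabla\varphi\big(\nabla\mathcal{B}[\alpha_t](x),t\big)\,dx\,dt=\int_{\mathbb{R}^3}\varphi(z,T)\,d\alpha_T(z)-\int_{\mathbb{R}^3}\varphi(z,0)\,d\overline{\alpha}(z),$$ where $\nabla\varphi$ is the gradient in the spatial variable. It is a continuously differentiable discrete geostrophic solution if moreover there exist $N$, a mass vector $(m_1,\dots,m_N)$ ($m_i>0$, $\sum m_i=1$) and a continuously differentiable map $(z_1,\dots,z_N):[0,T]\to\mathbb{R}^{3N}$ with $\alpha_t=\sum_i m_i\delta_{z_i(t)}\in\mathcal{Q}^N(\mathbb{R}^3)$ for all $t\in[0,T]$. The geostrophic energy of $\nu\in\mathcal{P}_c(\mathbb{R}^3)$ is $E[\nu]=\int_\Omega\big(\tfrac12((\partial_1\mathcal{B}[\nu](x)-x_1)^2+(\partial_2\mathcal{B}[\nu](x)-x_2)^2)-x_3\partial_3\mathcal{B}[\nu](x)\big)\,dx$; a solution is energy-conserving if $t\mapsto E[\alpha_t]$ is constant. *)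

(* Defs.v *)
From HB Require Import structures.
From Stdlib Require Import ClassicalEpsilon.
From mathcomp Require Import all_boot all_order all_algebra.
From mathcomp Require Import all_classical all_reals all_analysis.
Set Implicit Arguments. Unset Strict Implicit. Unset Printing Implicit Defensive.
Import Order.TTheory GRing.Theory Num.Theory.
Import numFieldNormedType.Exports.
Local Open Scope classical_set_scope.
Local Open Scope ring_scope.

(* A point of R^3 is a triple ((x1, x2), x3); this type carries the product
   topology and the product (Borel) sigma-algebra. *)
Notation vec3 R := ((R * R) * R)%type.

Definition c1 {R : realType} (x : vec3 R) : R := x.1.1.
Definition c2 {R : realType} (x : vec3 R) : R := x.1.2.
Definition c3 {R : realType} (x : vec3 R) : R := x.2.

Definition dot3 {R : realType} (x y : vec3 R) : R :=
  c1 x * c1 y + c2 x * c2 y + c3 x * c3 y.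

Definition dist2 {R : realType} (x y : vec3 R) : R :=
  (c1 x - c1 y) ^+ 2 + (c2 x - c2 y) ^+ 2 + (c3 x - c3 y) ^+ 2.

(* J x, with J the matrix with rows (0,-1,0), (1,0,0), (0,0,0) *)
Definition Jmul {R : realType} (x : vec3 R) : vec3 R := ((- c2 x, c1 x), 0).

Definition leb3 (R : realType) : set (vec3 R) -> \bar R :=
  ((@lebesgue_measure R \x @lebesgue_measure R) \x @lebesgue_measure R)%E.

Definition bounded3 {R : realType} (O : set (vec3 R)) : Prop :=
  exists M : R, forall x, O x -> `|c1 x| <= M /\ `|c2 x| <= M /\ `|c3 x| <= M.

Definition convex3 {R : realType} (O : set (vec3 R)) : Prop :=
  forall x y (l : R), O x -> O y -> 0 <= l <= 1 ->
    O (((1 - l) * c1 x + l * c1 y, (1 - l) * c2 x + l * c2 y),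
        (1 - l) * c3 x + l * c3 y).

Definition disc {R : realType} (N : nat) (m : 'I_N -> R) (z : 'I_N -> vec3 R)
  : set (vec3 R) -> R :=
  fun A => \sum_(i < N) m i * \1_A (z i).

Definition inQN {R : realType} (N : nat) (m : 'I_N -> R) (z : 'I_N -> vec3 R)
  : Prop :=
  (forall i, 0 < m i) /\ \sum_(i < N) m i = 1 /\
  (forall i j, i != j -> z i != z j).

Definition well_prepared {R : realType} (N : nat) (z : 'I_N -> vec3 R) : Prop :=
  exists r : R, 0 < r /\ forall i j, i != j -> r <= `|c3 (z i) - c3 (z j)|.

Definition transports {R : realType} (O : set (vec3 R)) (nu : set (vec3 R) -> R)
  (T : vec3 R -> vec3 R) : Prop :=
  measurable_fun O T /\
  forall A : set (vec3 R), measurable A ->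
    @leb3 R (O `&` T @^-1` A) = (nu A)%:E.

Definition transport_cost {R : realType} (O : set (vec3 R))
  (T : vec3 R -> vec3 R) : \bar R :=
  (\int[@leb3 R]_(x in O) (dist2 x (T x))%:E)%E.

Definition optimal_map {R : realType} (O : set (vec3 R)) (nu : set (vec3 R) -> R)
  (T : vec3 R -> vec3 R) : Prop :=
  transports O nu T /\
  forall S, transports O nu S -> (transport_cost O T <= transport_cost O S)%E.

(* grad B[nu] : by definition the optimal transport map from L^3|_Omega to nu
   (it is determined L^3-a.e. on Omega, which is all that is used below). *)
Definition gradB {R : realType} (O : set (vec3 R)) (nu : set (vec3 R) -> R)
  : vec3 R -> vec3 R :=
  epsilon (inhabits (fun x => x)) (optimal_map O nu).

Definition energy {R : realType} (O : set (vec3 R)) (nu : set (vec3 R) -> R)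
  : \bar R :=
  (\int[@leb3 R]_(x in O)
     (2^-1 * ((c1 (gradB O nu x) - c1 x) ^+ 2 + (c2 (gradB O nu x) - c2 x) ^+ 2)
      - c3 x * c3 (gradB O nu x))%:E)%E.

Definition to4 {R : realType} (phi : vec3 R -> R -> R) : 'rV[R]_4 -> R :=
  fun p => phi ((p 0 (inord 0), p 0 (inord 1)), p 0 (inord 2)) (p 0 (inord 3)).

Definition upd {R : realType} (p : 'rV[R]_4) (k : 'I_4) (s : R) : 'rV[R]_4 :=
  \row_(j < 4) (if j == k then s else p 0 j).

Definition partial4 {R : realType} (k : 'I_4) (F : 'rV[R]_4 -> R)
  : 'rV[R]_4 -> R :=
  fun p => derive1 (fun s => F (upd p k s)) (p 0 k).

Definition partials4 {R : realType} (ks : seq 'I_4) (F : 'rV[R]_4 -> R) :=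
  foldr (fun k G => partial4 k G) F ks.

Definition smooth4 {R : realType} (F : 'rV[R]_4 -> R) : Prop :=
  forall ks : seq 'I_4,
    continuous (partials4 ks F) /\
    forall (k : 'I_4) (p : 'rV[R]_4),
      derivable (fun s => partials4 ks F (upd p k s)) (p 0 k) 1.

Definition test_function {R : realType} (phi : vec3 R -> R -> R) : Prop :=
  smooth4 (to4 phi) /\
  exists M : R, forall z t,
    (M < `|c1 z| \/ M < `|c2 z| \/ M < `|c3 z| \/ M < `|t|) -> phi z t = 0.

Definition dt_ {R : realType} (phi : vec3 R -> R -> R) (z : vec3 R) (t : R) : R :=
  derive1 (fun s => phi z s) t.
Definition d1_ {R : realType} (phi : vec3 R -> R -> R) (z : vec3 R) (t : R) : R :=
  derive1 (fun s => phi ((s, c2 z), c3 z) t) (c1 z).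
Definition d2_ {R : realType} (phi : vec3 R -> R -> R) (z : vec3 R) (t : R) : R :=
  derive1 (fun s => phi ((c1 z, s), c3 z) t) (c2 z).
Definition d3_ {R : realType} (phi : vec3 R -> R -> R) (z : vec3 R) (t : R) : R :=
  derive1 (fun s => phi ((c1 z, c2 z), s) t) (c3 z).
Definition grad_ {R : realType} (phi : vec3 R -> R -> R) (z : vec3 R) (t : R)
  : vec3 R := ((d1_ phi z t, d2_ phi z t), d3_ phi z t).

Definition C1_on {R : realType} (T : R) (f : R -> R) : Prop :=
  exists g : R -> R,
    {within `[0, T], continuous g} /\
    forall t, 0 <= t <= T ->
      (fun s => (f s - f t) / (s - t))
        @ within (fun s => 0 <= s <= T /\ s != t) (nbhs t) --> g t.

Definition coupling {R : realType} (N N' : nat) (m : 'I_N -> R) (m' : 'I_N' -> R)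
  (pi : 'I_N -> 'I_N' -> R) : Prop :=
  (forall i j, 0 <= pi i j) /\
  (forall i, \sum_(j < N') pi i j = m i) /\
  (forall j, \sum_(i < N) pi i j = m' j).

Definition W2disc {R : realType} (N N' : nat) (m : 'I_N -> R) (x : 'I_N -> vec3 R)
  (m' : 'I_N' -> R) (y : 'I_N' -> vec3 R) : R :=
  Num.sqrt (inf [set c : R | exists pi, coupling m m' pi /\
       c = \sum_(i < N) \sum_(j < N') pi i j * dist2 (x i) (y j)]).

(* alpha_t = sum_i m_i delta_{z_i(t)}; initial measure
   abar = sum_j mb_j delta_{zb_j}. *)
Definition weak_geostrophic {R : realType} (O : set (vec3 R)) (T : R)
  (Nb : nat) (mb : 'I_Nb -> R) (zb : 'I_Nb -> vec3 R)
  (N : nat) (m : 'I_N -> R) (z : 'I_N -> R -> vec3 R) : Prop :=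
  forall phi : vec3 R -> R -> R, test_function phi ->
    ((\int[@lebesgue_measure R]_(t in `[0%R, T]%classic)
        (\sum_(i < N) m i * (dt_ phi (z i t) t
                             + dot3 (Jmul (z i t)) (grad_ phi (z i t) t)))%:E)
     - (\int[@lebesgue_measure R]_(t in `[0%R, T]%classic)
          (\int[@leb3 R]_(x in O)
             (dot3 (Jmul x)
                (grad_ phi (gradB O (disc m (fun i => z i t)) x) t))%:E))
     = (\sum_(i < N) m i * phi (z i T) T - \sum_(j < Nb) mb j * phi (zb j) 0)%:E)%E.

Definition discrete_geostrophic_solution {R : realType} (O : set (vec3 R)) (T : R)
  (Nb : nat) (mb : 'I_Nb -> R) (zb : 'I_Nb -> vec3 R)
  (N : nat) (m : 'I_N -> R) (z : 'I_N -> R -> vec3 R) : Prop :=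
  (forall t, 0 <= t <= T -> inQN m (fun i => z i t)) /\
  (forall i, C1_on T (fun t => c1 (z i t)) /\ C1_on T (fun t => c2 (z i t)) /\
             C1_on T (fun t => c3 (z i t))) /\
  (forall t, 0 <= t <= T -> forall e : R, 0 < e -> exists d : R, 0 < d /\
     forall s, 0 <= s <= T -> `|s - t| < d ->
       W2disc m (fun i => z i s) m (fun i => z i t) < e) /\
  weak_geostrophic O T mb zb m z.

Definition energy_conserving {R : realType} (O : set (vec3 R)) (T : R)
  (N : nat) (m : 'I_N -> R) (z : 'I_N -> R -> vec3 R) : Prop :=
  forall s t, 0 <= s <= T -> 0 <= t <= T ->
    energy O (disc m (fun i => z i s)) = energy O (disc m (fun i => z i t)).

(* Main.v *)
Require Import Defs.
From HB Require Import structures.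
From mathcomp Require Import all_boot all_order all_algebra.
From mathcomp Require Import all_classical all_reals all_analysis.
From mathcomp Require Import measurable_realfun.
From mathcomp Require Import ring lra.
Import Order.TTheory GRing.Theory Num.Theory.
Import numFieldNormedType.Exports.
Set Implicit Arguments. Unset Strict Implicit. Unset Printing Implicit Defensive.
Local Open Scope classical_set_scope.
Local Open Scope ring_scope.

(* If the seeds z_i keep distinct heights, the optimal transport map onto
   sum_i m_i delta_{z_i} is given by a Laguerre tessellation of Omega. Since the
   bisecting planes of two seeds are uniformly transverse to the vertical
   direction, the set of points whose best seed changes under a horizontal
   perturbation of size e has volume O(e). Hence the optimal reward
   F(z) = int x . z_{s(x)} is C^{1,1} in the horizontal positions, with gradient the
   cell moments M_i, which are therefore globally Lipschitz. The solution is the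
   Picard flow of the ODE z_i' = J (z_i - M_i / m_i), which keeps the heights
   fixed; the energy is 1/2 sum_i m_i |z_i|_h^2 - F(z) up to a constant, and its
   derivative along the flow vanishes because J is antisymmetric.

   Conversely, testing the weak formulation of an arbitrary discrete solution with
   tensor products of bump functions shows that its initial points and masses are
   those of the initial measure, that the distribution of heights is conserved (so
   by continuity and the gap each height is constant), and that the horizontal
   positions satisfy the integrated ODE; uniqueness is then Gronwall's lemma. *)

(** [gradB] is a chosen optimal map, so nothing is known of it until an optimal map is shown to
    exist and to be unique almost everywhere. Both facts come from weights [w] for which every
    Laguerre cell has its prescribed volume: the weight term has the same integral for all plans, so
    maximising [x . z_i + w_i] pointwise is optimal, and another optimal plan can differ only on
    ties, which are negligible. The gap [r] between heights makes each tie set a thin slab, with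
    constants independent of the horizontal positions; hence the Lipschitz bound on the velocity is
    global and the flow reaches any [T]. Cell volumes are never differentiated: moments are
    controlled by comparing the rewards of two plans. For uniqueness the obstacle is that a
    competitor is not known to keep a gap, so its [gradB] integrand is not known to be measurable.
    The first consequences are drawn from integral bounds that need no measurability; once the
    heights are frozen, the cell moments of the competitor are continuous in time. *)

(** * Lebesgue measure on triples: measurability and integral bounds *)

Section leb3_measure.
Variable R : realType.
Let P := ((@lebesgue_measure R \x @lebesgue_measure R) \x @lebesgue_measure R)%E.
Let leb3_0 : @leb3 R set0 = 0%E. Proof. exact: (measure0 P). Qed.
Let leb3_ge0 (A : set (vec3 R)) : (0 <= @leb3 R A)%E.
Proof. exact: (measure_ge0 P A). Qed.
Let leb3_sa : semi_sigma_additive (@leb3 R).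
Proof. exact: (@measure_semi_sigma_additive _ _ _ P). Qed.
(** [leb3] is a bare set function; registering the product measure structure on it makes the theory
    of integrals against a measure apply. *)
HB.instance Definition _ :=
  isMeasure.Build _ _ _ (@leb3 R) leb3_0 leb3_ge0 leb3_sa.
End leb3_measure.

Lemma open_vec3_ball (R : realType) (O : set (vec3 R)) (x : vec3 R) :
  open O -> O x -> exists2 e : R, 0 < e &
    forall y, `|c1 x - c1 y| < e -> `|c2 x - c2 y| < e -> `|c3 x - c3 y| < e ->
      O y.
Proof.
move=> oO Ox; have /nbhs_ballP[e /= e0 xO] : nbhs x O.
  by apply: open_nbhs_nbhs; split.
exists e => // y h1 h2 h3; by apply: xO; split.
Qed.

(** The sigma-algebra is the product one, so an open set is written as the countable union of the
    boxes with rational centre and radius that it contains. *)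
Lemma open_vec3_measurable (R : realType) (O : set (vec3 R)) :
  open O -> measurable O.
Proof.
move=> oO.
pose B (k : rat * rat * rat * rat) : set (vec3 R) :=
  (ball (ratr k.1.1.1 : R) (ratr k.2) `*` ball (ratr k.1.1.2 : R) (ratr k.2))
  `*` ball (ratr k.1.2 : R) (ratr k.2).
pose F k : set (vec3 R) := if pselect (B k `<=` O) then B k else set0.
have -> : O = \bigcup_k F k.
  apply/seteqP; split => [x Ox|x [k _]]; last first.
    by rewrite /F; case: pselect => // kO /kO.
  have [e e0 xO] := open_vec3_ball oO Ox.
  (* With radius below [e / 2], a box centred within that radius of [x] stays within [e] of [x]. *)
  have [d] : exists d : rat, (ratr d : R) \in `]0, (e / 2)[.
    by apply: rat_in_itvoo; rewrite divr_gt0.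
  rewrite in_itv/= => /andP[d0 de].
  have rd (y : R) : exists q : rat, `|ratr q - y| < ratr d.
    have [q] : exists q : rat, (ratr q : R) \in `]y, (y + ratr d)[.
      by apply: rat_in_itvoo; rewrite ltrDl.
    rewrite in_itv/= => /andP[h1 h2]; exists q.
    by rewrite ger0_norm; lra.
  have [q1 h1] := rd (c1 x); have [q2 h2] := rd (c2 x).
  have [q3 h3] := rd (c3 x).
  exists (q1, q2, q3, d) => //; rewrite /F; case: pselect => [?|[]].
    by split.
  have tri (a b c : R) : `|a - b| < ratr d -> `|a - c| < ratr d -> `|b - c| < e.
    by rewrite !ltr_norml => /andP[? ?] /andP[? ?]; apply/andP; split; lra.
  move=> y [[/= k1 k2] k3]; apply: xO.
  - exact: (tri _ _ _ h1 k1).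
  - exact: (tri _ _ _ h2 k2).
  - exact: (tri _ _ _ h3 k3).
apply: countable_bigcupT_measurable => [|k]; first exact: countableP.
rewrite /F; case: pselect => [?|?] /=; last exact: measurable0.
apply: measurableX; first by apply: measurableX; exact: measurable_ball.
exact: measurable_ball.
Qed.

Lemma continuous_vec3_measurable (R : realType) (f : vec3 R -> R) :
  continuous f -> measurable_fun setT f.
Proof.
move=> cf; apply: (measurability _ (RGenOInfty.measurableE R)).
move=> _ [_ [a ->] <-]; rewrite setTI; apply: open_vec3_measurable.
by apply: open_comp => // x _; exact: cf.
Qed.

Section coordinates.
Context {R : realType}.
Lemma measurable_c1 (D : set (vec3 R)) : measurable_fun D c1.
Proof.
apply: measurable_funTS; rewrite /c1.
exact: (measurableT_comp measurable_fst measurable_fst).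
Qed.
Lemma measurable_c2 (D : set (vec3 R)) : measurable_fun D c2.
Proof.
apply: measurable_funTS; rewrite /c2.
exact: (measurableT_comp measurable_snd measurable_fst).
Qed.
Lemma measurable_c3 (D : set (vec3 R)) : measurable_fun D c3.
Proof. apply: measurable_funTS; rewrite /c3; exact: measurable_snd. Qed.
Lemma measurable_dot3l (D : set (vec3 R)) (y : vec3 R) :
  measurable_fun D (fun x => dot3 x y).
Proof.
rewrite /dot3; apply: measurable_funD.
  apply: measurable_funD; apply: measurable_funM; try exact: measurable_cst.
    exact: measurable_c1.
  exact: measurable_c2.
apply: measurable_funM; [exact: measurable_c3|exact: measurable_cst].
Qed.
End coordinates.

(* No measurability is needed: nonnegative integrals are suprema over simple
   functions below the integrand. *)
Lemma ge0_le_integral_nomeas d (T : measurableType d) (R : realType)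
  (mu : {measure set T -> \bar R}) (D : set T) (f g : T -> \bar R) :
  (forall x, D x -> (0 <= f x)%E) -> (forall x, D x -> (f x <= g x)%E) ->
  (\int[mu]_(x in D) f x <= \int[mu]_(x in D) g x)%E.
Proof.
move=> f0 fg; rewrite !ge0_integralE//; last first.
  by move=> x Dx; apply: le_trans (f0 _ Dx) (fg _ Dx).
apply: le_ereal_sup => _ [h hf <-].
exists h => // x; apply: le_trans (hf x) _.
by rewrite !patchE; case: ifPn => // /set_mem /fg.
Qed.

(** Measurability of [f] is not assumed, because the integrands of an arbitrary solution may fail to
    have it: the integrals of [f^\+] and [f^\-] both lie between 0 and [c * b], which bounds their
    difference. *)
Lemma integral_bound_nomeas d (T : measurableType d) (R : realType)
  (mu : {measure set T -> \bar R}) (D : set T) (f : T -> \bar R) (c b : R) :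
  measurable D -> mu D = b%:E -> 0 <= c ->
  (forall x, D x -> (`|f x| <= c%:E)%E) ->
  (`|\int[mu]_(x in D) f x| <= (c * b)%:E)%E.
Proof.
move=> mD mub c0 fc.
have ic : (\int[mu]_(x in D) c%:E = (c * b)%:E)%E.
  by rewrite integral_cst// mub EFinM.
have hp : (\int[mu]_(x in D) (f^\+ x) <= (c * b)%:E)%E.
  rewrite -ic; apply: ge0_le_integral_nomeas => x Dx //.
  by rewrite funeposE ge_max lee_fin c0 andbT (le_trans _ (fc _ Dx))// lee_abs.
have hn : (\int[mu]_(x in D) (f^\- x) <= (c * b)%:E)%E.
  rewrite -ic; apply: ge0_le_integral_nomeas => x Dx //.
  rewrite funenegE ge_max lee_fin c0 andbT (le_trans _ (fc _ Dx))//.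
  by rewrite -abseN lee_abs.
have hp0 : (0 <= \int[mu]_(x in D) (f^\+ x))%E by exact: integral_ge0.
have hn0 : (0 <= \int[mu]_(x in D) (f^\- x))%E by exact: integral_ge0.
rewrite integralE.
move: hp hn hp0 hn0.
case: (\int[mu]_(x in D) (f^\+ x))%E => //= a.
case: (\int[mu]_(x in D) (f^\- x))%E => //= a'.
rewrite !lee_fin => ? ? ? ?; rewrite ler_norml; apply/andP; split; lra.
Qed.
(* Each vertical fibre of the slab is an interval of length 2 e / |c|. *)
Lemma leb3_slab (R : realType) (M e r : R) (y : vec3 R) (d : R) :
  0 <= M -> 0 <= e -> 0 < r -> r <= `|c3 y| ->
  (@leb3 R [set x | ((`|c1 x| <= M /\ `|c2 x| <= M) /\ `|dot3 x y + d| <= e)%R]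
   <= ((2 * M) * (2 * M) * (2 * e / r))%:E)%E.
Proof.
move=> M0 e0 r0 ry; set S := [set x | _].
have y0 : 0 < `|c3 y| by exact: lt_le_trans ry.
have mS : measurable S.
  have -> : S = (`[- M, M]%classic `*` `[- M, M]%classic) `*` setT
      `&` [set x | `|dot3 x y + d| <= e].
    apply/seteqP; split => [x [[h1 h2] h3]|x [[[/= h1 h2] _] h3]].
      by split => //; split => //; split; rewrite /= in_itv/= -ler_norml.
    split => //; move: h1 h2; rewrite !in_itv/= -!ler_norml.
    by move=> ? ?; split.
  apply: measurableI; first by do !apply: measurableX.
  rewrite -[X in measurable X]setTI.
  have -> : [set x | `|dot3 x y + d| <= e] =
     (fun x : vec3 R => `|dot3 x y + d|) @^-1` `]-oo, e].
    by apply/seteqP; split => x /=; rewrite in_itv.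
  apply: measurableT_comp => //.
  apply: measurable_funD; [exact: measurable_dot3l|exact: measurable_cst].
have sec (p : R * R) : (@lebesgue_measure R (xsection S p) <=
    ((2 * e / r)%:E * (\1_(`[- M, M]%classic `*` `[- M, M]%classic) p)%:E))%E.
  have [[p1 p2]|np] := pselect ((`[- M, M]%classic `*` `[- M, M]%classic) p).
    rewrite indicE mem_set//= mule1.
    (* [c] is the height at which the affine function vanishes on the fibre over [p]. *)
    pose c := - (c1 y * p.1 + c2 y * p.2 + d) / c3 y.
    have sub : xsection S p `<=` `[c - e / `|c3 y|, c + e / `|c3 y|]%classic.
      move=> t; rewrite /xsection/= inE => -[_ /=].
      have -> : dot3 (p, t) y + d = c3 y * (t - c).
        have : c3 y != 0 by rewrite -normr_gt0.
        rewrite /dot3 /c /c1 /c2 /c3 /= => ?; by field.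
      by rewrite normrM -ler_pdivlMl// mulrC in_itv/= -ler_distlC distrC.
    apply: (@le_trans _ _ (@lebesgue_measure R
        `[c - e / `|c3 y|, c + e / `|c3 y|]%classic)).
      apply: le_measure => //; rewrite inE//.
      exact: measurable_xsection.
    rewrite lebesgue_measure_itv /= lte_fin; case: ifPn => _; last first.
      by rewrite lee_fin divr_ge0 ?mulr_ge0// ltW.
    rewrite -EFinB lee_fin.
    have -> : c + e / `|c3 y| - (c - e / `|c3 y|) = 2 * e / `|c3 y| by ring.
    by rewrite ler_wpM2l ?mulr_ge0// lef_pV2.
  rewrite (_ : xsection S p = set0) ?measure0.
    by rewrite mule_ge0// lee_fin ?divr_ge0 ?mulr_ge0// ltW.
  apply/seteqP; split => // t; rewrite /xsection/= inE => -[[h1 h2] _]; apply: np.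
  by split; rewrite /= in_itv/= -ler_norml.
pose I : set (measurableTypeR R) := `[- M, M]%classic.
have mI : measurable I by exact: measurable_itv.
(* The product measure is the integral of the measures of the sections, so the fibre bound
   integrates over the square of side [2 * M]. *)
apply: (@le_trans _ _ (\int[@lebesgue_measure R \x @lebesgue_measure R]_p
   ((2 * e / r)%:E * (\1_(I `*` I) p)%:E))%E).
  by apply: (@ge0_le_integral_nomeas _ _ R (@lebesgue_measure R \x @lebesgue_measure R)%E
    setT (fun p => @lebesgue_measure R (xsection S p))).
rewrite ge0_integralZl//; last 2 first.
- by apply/measurable_EFinP; apply: measurable_indic; exact: measurableX.
- by rewrite lee_fin divr_ge0 ?mulr_ge0// ltW.
rewrite integral_indic//; last exact: measurableX.
rewrite setIT.
rewrite [X in (_ * X)%E](_ : _ =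
    (@lebesgue_measure R I * @lebesgue_measure R I)%E); last exact: product_measure1E.
have -> : @lebesgue_measure R I = (2 * M)%:E.
  rewrite lebesgue_measure_itv /= lte_fin; case: ifPn => h.
    by rewrite -EFinB; congr EFin; ring.
  have -> : M = 0 by move: h; rewrite -leNgt => h; lra.
  by rewrite mulr0.
by rewrite -!EFinM lee_fin mulrC.
Qed.

(** * Bounded measurable functions on a domain of volume one *)

Section bounded_integral.
Context {R : realType} (Om : set (vec3 R)) (M : R).
Hypothesis mOm : measurable Om.
Hypothesis OmM : forall x, Om x -> `|c1 x| <= M /\ `|c2 x| <= M /\ `|c3 x| <= M.
Hypothesis Om1 : @leb3 R Om = 1%E.

(** On a set of measure one boundedness gives integrability and, unlike integrability, it passes to
    products. *)
Definition bmeas (f : vec3 R -> R) :=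
  measurable_fun Om f /\ exists C, forall x, Om x -> `|f x| <= C.

Definition IOm (f : vec3 R -> R) : R := \int[@leb3 R]_(x in Om) f x.

Lemma bmeas_integrable f : bmeas f -> (@leb3 R).-integrable Om (EFin \o f).
Proof.
move=> [mf [C fC]]; apply: measurable_bounded_integrable => //.
  by rewrite (_ : _ Om = 1%E)// ltry.
exists C; split; first exact: num_real.
by move=> y Cy x Omx; apply: le_trans (fC _ Omx) (ltW Cy).
Qed.

Lemma bmeas_EFin f : bmeas f -> (\int[@leb3 R]_(x in Om) (f x)%:E = (IOm f)%:E)%E.
Proof.
by move=> bf; rewrite /IOm /Rintegral fineK//; apply: integrable_fin_num => //;
   exact: bmeas_integrable.
Qed.

Lemma eq_bmeas f g : (forall x, Om x -> f x = g x) -> bmeas f -> bmeas g.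
Proof.
move=> fg [mf [C fC]]; split.
  by apply: eq_measurable_fun mf => x /set_mem; exact: fg.
by exists C => x Ox; rewrite -fg//; exact: fC.
Qed.

Lemma bmeas_cst k : bmeas (fun=> k).
Proof. by split; [exact: measurable_cst|exists `|k|]. Qed.

Lemma bmeasD f g : bmeas f -> bmeas g -> bmeas (fun x => f x + g x).
Proof.
move=> [mf [C fC]] [mg [D gD]]; split; first exact: measurable_funD.
exists (C + D) => x Ox; apply: le_trans (ler_normD _ _) _.
by apply: lerD; [exact: fC|exact: gD].
Qed.

Lemma bmeasM f g : bmeas f -> bmeas g -> bmeas (fun x => f x * g x).
Proof.
move=> [mf [C fC]] [mg [D gD]]; split; first exact: measurable_funM.
exists (C * D) => x Ox; rewrite normrM ler_pM//; first exact: fC.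
exact: gD.
Qed.

Lemma bmeasZ k f : bmeas f -> bmeas (fun x => k * f x).
Proof. by move=> bf; apply: bmeasM => //; exact: bmeas_cst. Qed.

Lemma bmeasB f g : bmeas f -> bmeas g -> bmeas (fun x => f x - g x).
Proof.
move=> bf bg; apply: (@eq_bmeas (fun x => f x + (-1) * g x)) => [x _|].
  by rewrite mulN1r.
by apply: bmeasD => //; exact: bmeasZ.
Qed.

Lemma bmeas_sum (I : finType) (f : I -> vec3 R -> R) :
  (forall i, bmeas (f i)) -> bmeas (fun x => \sum_i f i x).
Proof.
move=> bf; elim: (index_enum I) => [|i s ih].
  by apply: (eq_bmeas _ (bmeas_cst 0)) => x _; rewrite big_nil.
apply: (eq_bmeas _ (bmeasD (bf i) ih)) => x _.
by rewrite big_cons.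
Qed.

Lemma bmeas_c1 : bmeas c1.
Proof. by split; [exact: measurable_c1|exists M => x /OmM[]]. Qed.
Lemma bmeas_c2 : bmeas c2.
Proof. by split; [exact: measurable_c2|exists M => x /OmM[_ []]]. Qed.
Lemma bmeas_c3 : bmeas c3.
Proof. by split; [exact: measurable_c3|exists M => x /OmM[_ []]]. Qed.

Lemma bmeas_dot y : bmeas (fun x => dot3 x y).
Proof.
rewrite /dot3; apply: bmeasD; last first.
  by apply: bmeasM; [exact: bmeas_c3|exact: bmeas_cst].
apply: bmeasD; apply: bmeasM; try exact: bmeas_cst.
  exact: bmeas_c1.
exact: bmeas_c2.
Qed.

Lemma bmeas_indic A : measurable A -> bmeas (\1_A).
Proof.
move=> mA; split; first exact: measurable_indic.
exists 1 => x _; rewrite indicE; case: (_ \in _); by rewrite ?normr1 ?normr0.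
Qed.

Lemma IOm_ext f g : (forall x, Om x -> f x = g x) -> IOm f = IOm g.
Proof. by move=> fg; apply: eq_Rintegral => x /set_mem; exact: fg. Qed.

Lemma IOm_cst k : IOm (fun=> k) = k.
Proof. by rewrite /IOm Rintegral_cst// (_ : _ Om = 1%E)// mulr1. Qed.

Lemma IOmD f g : bmeas f -> bmeas g -> IOm (fun x => f x + g x) = IOm f + IOm g.
Proof. by move=> bf bg; rewrite /IOm RintegralD//; exact: bmeas_integrable. Qed.

Lemma IOmB f g : bmeas f -> bmeas g -> IOm (fun x => f x - g x) = IOm f - IOm g.
Proof. by move=> bf bg; rewrite /IOm RintegralB//; exact: bmeas_integrable. Qed.

Lemma IOmZ k f : bmeas f -> IOm (fun x => k * f x) = k * IOm f.
Proof. by move=> bf; rewrite /IOm RintegralZl//; exact: bmeas_integrable. Qed.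

Lemma IOm_sum (I : finType) (f : I -> vec3 R -> R) :
  (forall i, bmeas (f i)) -> IOm (fun x => \sum_i f i x) = \sum_i IOm (f i).
Proof.
move=> bf.
have h (s : seq I) : bmeas (fun x => \sum_(i <- s) f i x) /\
    IOm (fun x => \sum_(i <- s) f i x) = \sum_(i <- s) IOm (f i).
  elim: s => [|i s [bs ih]].
    split; first by apply: (eq_bmeas _ (bmeas_cst 0)) => x _; rewrite big_nil.
    rewrite big_nil -[RHS]IOm_cst; apply: IOm_ext => x _; by rewrite big_nil.
  split.
    apply: (eq_bmeas _ (bmeasD (bf i) bs)) => x _; by rewrite big_cons.
  rewrite big_cons -ih -IOmD//; apply: IOm_ext => x _; by rewrite big_cons.
by have [_ ->] := h (index_enum I).
Qed.

Lemma IOm_le f g : bmeas f -> bmeas g -> (forall x, Om x -> f x <= g x) ->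
  IOm f <= IOm g.
Proof.
by move=> bf bg fg; apply: le_Rintegral => //; exact: bmeas_integrable.
Qed.

Lemma IOm_indic A : measurable A -> A `<=` Om -> (IOm \1_A)%:E = @leb3 R A.
Proof.
move=> mA AO; rewrite -bmeas_EFin; last exact: bmeas_indic.
by rewrite integral_indic// setIidl.
Qed.

(** Turns positive volume into an actual point, at which utilities can be compared. *)
Lemma IOm_indic_gt0 A : 0 < IOm \1_A -> exists2 x, Om x & A x.
Proof.
move=> h; apply: contrapT => nA.
suff h0 : IOm \1_A = 0 by rewrite h0 ltxx in h.
rewrite -[RHS]IOm_cst; apply: IOm_ext => x Ox.
by rewrite indicE memNset// => Ax; apply: nA; exists x.
Qed.
End bounded_integral.

(** * Plans, Laguerre cells and the volume of near-ties *)

Section laguerre.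
Context {R : realType} (Om : set (vec3 R)) (M : R).
Hypothesis mOm : measurable Om.
Hypothesis OmM : forall x, Om x -> `|c1 x| <= M /\ `|c2 x| <= M /\ `|c3 x| <= M.
Hypothesis Om1 : @leb3 R Om = 1%E.
Let M0 : 0 <= M.
Proof.
have [x Ox _] : exists2 x, Om x & setT x.
  by apply: (IOm_indic_gt0 mOm Om1); rewrite indicT IOm_cst.
by have [h _] := OmM Ox; exact: le_trans h.
Qed.

Local Notation IOm := (@IOm R Om).
Local Notation bmeas := (@bmeas R Om).

Context (N : nat) (m : 'I_N -> R).

(* A Monge plan onto N labelled points, recorded by the label it assigns. *)
Definition plan (s : vec3 R -> 'I_N) := forall i,
  measurable (Om `&` [set x | s x = i]) /\
  IOm \1_(Om `&` [set x | s x = i]) = m i.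

Definition lab (s : vec3 R -> 'I_N) i (x : vec3 R) : R := (s x == i)%:R.

Definition label_measurable (s : vec3 R -> 'I_N) :=
  forall i, measurable (Om `&` [set x | s x = i]).

Lemma lab_indic s i x : Om x -> lab s i x = \1_(Om `&` [set x | s x = i]) x.
Proof.
move=> Ox; rewrite indicE /lab; congr (_%:R); congr nat_of_bool.
apply/eqP/idP => [h|/set_mem[]//]; by apply/mem_set.
Qed.

Lemma bmeas_lab s i : label_measurable s -> bmeas (lab s i).
Proof.
move=> ms; apply: (@eq_bmeas _ _ (\1_(Om `&` [set x | s x = i]))) => [x Ox|].
  by rewrite lab_indic.
exact: bmeas_indic.
Qed.

Lemma IOm_lab s i : IOm (lab s i) = IOm \1_(Om `&` [set x | s x = i]).
Proof. by apply: IOm_ext => x; exact: lab_indic. Qed.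

Lemma plan_label_measurable s : plan s -> label_measurable s.
Proof. by move=> ps i; have [] := ps i. Qed.

(** A choice depending on the point becomes a finite combination of indicators, so measurability and
    integration of [f (s x) x] reduce to those of each [f i]. *)
Lemma label_sum s (f : 'I_N -> vec3 R -> R) x :
  f (s x) x = \sum_i lab s i x * f i x.
Proof.
rewrite (bigD1 (s x))//= /lab eqxx mul1r big1 ?addr0// => i si.
by rewrite eq_sym (negbTE si) mul0r.
Qed.

Lemma bmeas_label s f : label_measurable s -> (forall i, bmeas (f i)) ->
  bmeas (fun x => f (s x) x).
Proof.
move=> ms bf; apply: (@eq_bmeas _ _ (fun x => \sum_i lab s i x * f i x)).
  by move=> x _; rewrite -label_sum.
by apply: bmeas_sum => // i; apply: bmeasM => //; exact: bmeas_lab.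
Qed.

Lemma IOm_label_cst s (k : 'I_N -> R) : plan s ->
  IOm (fun x => k (s x)) = \sum_i m i * k i.
Proof.
move=> ps; have ms := plan_label_measurable ps.
rewrite (@IOm_ext _ _ _ (fun x => \sum_i k i * lab s i x)); last first.
  move=> x _; rewrite (label_sum s (fun i _ => k i)).
  by apply: eq_bigr => i _; rewrite mulrC.
rewrite IOm_sum//; last by move=> i; apply: bmeasZ; exact: bmeas_lab.
apply: eq_bigr => i _; rewrite IOmZ//; last exact: bmeas_lab.
by rewrite IOm_lab; have [_ ->] := ps i; rewrite mulrC.
Qed.

(* The moment of the region labelled i: m_i times its centroid. *)
Definition moment s i : vec3 R :=
  ((IOm (fun x => lab s i x * c1 x), IOm (fun x => lab s i x * c2 x)),
    IOm (fun x => lab s i x * c3 x)).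

(** Expanding the squared distance, the cost of a plan is a constant minus twice this quantity. *)
Definition reward s (y : 'I_N -> vec3 R) := IOm (fun x => dot3 x (y (s x))).

(** For a fixed labelling the reward is linear in the seeds; the optimal reward is therefore a
    maximum of linear functions, with the moments as subgradients. *)
Lemma rewardE s y : label_measurable s ->
  reward s y = \sum_i dot3 (moment s i) (y i).
Proof.
move=> ms; rewrite /reward.
have bl i := bmeas_lab i ms.
have b1 i : bmeas (fun x => lab s i x * c1 x) by apply: bmeasM; last exact: bmeas_c1 OmM.
have b2 i : bmeas (fun x => lab s i x * c2 x) by apply: bmeasM; last exact: bmeas_c2 OmM.
have b3 i : bmeas (fun x => lab s i x * c3 x) by apply: bmeasM; last exact: bmeas_c3 OmM.
rewrite (@IOm_ext _ _ _ (fun x => \sum_i (c1 (y i) * (lab s i x * c1 x) +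
   c2 (y i) * (lab s i x * c2 x) + c3 (y i) * (lab s i x * c3 x)))); last first.
  move=> x _; rewrite (label_sum s (fun i x => dot3 x (y i))).
  by apply: eq_bigr => i _; rewrite /dot3; ring.
rewrite IOm_sum//; last first.
  by move=> i; do 2!(apply: bmeasD; last exact: bmeasZ); exact: bmeasZ.
apply: eq_bigr => i _; rewrite IOmD ?IOmD ?IOmZ//; try exact: bmeasZ.
  by rewrite /dot3 /moment /c1 /c2 /c3 /=; ring.
by apply: bmeasD; exact: bmeasZ.
Qed.

Variable i0 : 'I_N.

Definition util (z : 'I_N -> vec3 R) (w : 'I_N -> R) i x := dot3 x (z i) + w i.

(** Ties go to the smallest index, so exactly one label is selected at each point and a cell is cut
    out by finitely many affine inequalities. *)
Definition firstmax z w x i :=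
  [forall j, util z w j x <= util z w i x] &&
  [forall j : 'I_N, (j < i)%N ==> (util z w j x < util z w i x)].

Definition laguerre z w x := odflt i0 [pick i | firstmax z w x i].

Lemma firstmax_uniq z w x i j : firstmax z w x i -> firstmax z w x j -> i = j.
Proof.
move=> /andP[/forallP hi /forallP hi'] /andP[/forallP hj /forallP hj'].
case: (ltngtP i j) => [ij|ij|/val_inj//].
  by have := lt_le_trans (implyP (hj' i) ij) (hi j); rewrite ltxx.
by have := lt_le_trans (implyP (hi' j) ij) (hj i); rewrite ltxx.
Qed.

Lemma laguerreP z w x : firstmax z w x (laguerre z w x).
Proof.
rewrite /laguerre; case: pickP => //= nf; exfalso.
case: (@arg_maxP _ _ _ i0 predT (fun i => util z w i x)) => // a _ ha.
case: (@arg_minnP _ a (fun i => util z w i x == util z w a x) (fun i => i : nat)) => //.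
move=> b /eqP hb mb; have /negP[] := nf b; apply/andP; split.
  by apply/forallP => j; rewrite hb; exact: ha.
apply/forallP => j; apply/implyP => jb; rewrite hb lt_neqAle; apply/andP; split; last exact: ha.
by apply/negP => /mb; rewrite leqNgt jb.
Qed.

Lemma laguerre_eq z w x i : (laguerre z w x = i) <-> firstmax z w x i.
Proof.
by split => [<-|h]; [exact: laguerreP|exact: (firstmax_uniq (laguerreP _ _ _))].
Qed.

Lemma laguerre_max z w x i : util z w i x <= util z w (laguerre z w x) x.
Proof. by have /andP[/forallP h _] := laguerreP z w x. Qed.

Lemma bmeas_util z w i : bmeas (util z w i).
Proof. by apply: bmeasD; [exact: bmeas_dot OmM _|exact: bmeas_cst]. Qed.

Lemma measurable_util z w i (D : set (vec3 R)) : measurable_fun D (util z w i).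
Proof. by apply: measurable_funD; [exact: measurable_dot3l|exact: measurable_cst]. Qed.

Lemma laguerre_measurable z w : label_measurable (laguerre z w).
Proof.
move=> i.
pose F (j : 'I_N) : set (vec3 R) := (fun x => (util z w j x <= util z w i x) &&
  ((j < i)%N ==> (util z w j x < util z w i x))) @^-1` [set true].
have -> : Om `&` [set x | laguerre z w x = i] = Om `&` \bigcap_(j in setT) F j.
  apply/seteqP; split => x [Ox]; rewrite /= laguerre_eq.
    move=> /andP[/forallP h /forallP h']; split=> // j _.
    by rewrite /F /=; apply/andP.
  move=> h; split=> //; apply/andP; split; apply/forallP => j.
    by have := h j I; rewrite /F /= => /andP[].
  by have := h j I; rewrite /F /= => /andP[].
apply: measurableI => //; apply: fin_bigcap_measurable; first exact: finite_finset.
move=> j _; rewrite /F -[X in measurable X]setTI.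
apply: measurable_and => //.
  by apply: measurable_fun_ler; exact: measurable_util.
case: (j < i)%N => /=; last exact: measurable_cst.
by apply: measurable_fun_ltr; exact: measurable_util.
Qed.

Definition gap (r : R) (z : 'I_N -> vec3 R) :=
  forall i j, i != j -> r <= `|c3 (z i) - c3 (z j)|.


Definition tie z w (e : R) (k : 'I_N * 'I_N) : set (vec3 R) := Om `&`
  [set x | `|util z w k.1 x - util z w k.2 x| <= e].

(** A bounded majorant of the indicator of the region where two utilities are within [e]; counting
    ordered pairs with multiplicity costs only a constant. *)
Definition ties z w (e : R) x : R := \sum_(k : 'I_N * 'I_N | k.1 != k.2) \1_(tie z w e k) x.

Lemma ties_ge0 z w e x : 0 <= ties z w e x.
Proof. by apply: sumr_ge0 => k _; rewrite indicE. Qed.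

Lemma ties_ge1 z w e x i j : Om x -> i != j ->
  `|util z w i x - util z w j x| <= e -> 1 <= ties z w e x.
Proof.
move=> Ox ij h; rewrite /ties (bigD1 (i, j))//= indicE mem_set//.
by rewrite lerDl; apply: sumr_ge0 => k _; rewrite indicE.
Qed.

Lemma measurable_tie z w e k : measurable (tie z w e k).
Proof.
apply: measurableI => //; rewrite -[X in measurable X]setTI.
have -> : [set x | `|util z w k.1 x - util z w k.2 x| <= e] =
   (fun x : vec3 R => `|util z w k.1 x - util z w k.2 x|) @^-1` `]-oo, e].
  by apply/seteqP; split => x /=; rewrite in_itv.
apply: measurableT_comp => //.
by apply: measurable_funB; exact: measurable_util.
Qed.

Lemma bmeas_ties z w e : bmeas (ties z w e).
Proof.
apply: (@eq_bmeas _ _ (fun x => \sum_k (if k.1 != k.2 then 1 else 0) * \1_(tie z w e k) x)).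
  move=> x _; rewrite /ties [RHS]big_mkcond; apply: eq_bigr => k _.
  by case: ifP => _; rewrite ?mul1r ?mul0r.
apply: bmeas_sum => // k; apply: bmeasZ; apply: bmeas_indic => //.
exact: measurable_tie.
Qed.

(** The slab volume of [leb3_slab] divided by [e], once for each of the [N * N] pairs of labels. *)
Definition Ktie r : R := (N * N)%:R * (2 * M * (2 * M) * (2 / r)).

Lemma Ktie_ge0 (r : R) : 0 < r -> 0 <= Ktie r.
Proof. by move=> r0; rewrite /Ktie !mulr_ge0// invr_ge0 ltW. Qed.

Lemma IOm_tie z w (e r : R) k : 0 < r -> gap r z -> 0 <= e -> k.1 != k.2 ->
  IOm \1_(tie z w e k) <= 2 * M * (2 * M) * (2 / r) * e.
Proof.
move=> r0 gz e0 kk; rewrite -lee_fin IOm_indic//; last 2 first.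
  exact: measurable_tie.
  by move=> x [].
have := @leb3_slab R M e r (z k.1 - z k.2) (w k.1 - w k.2) M0 e0 r0 (gz _ _ kk).
set B := [set x | _] => h.
have -> : 2 * M * (2 * M) * (2 / r) * e = 2 * M * (2 * M) * (2 * e / r) by ring.
have uE x : util z w k.1 x - util z w k.2 x = dot3 x (z k.1 - z k.2) + (w k.1 - w k.2).
  by rewrite /util /dot3 /c1 /c2 /c3 /=; ring.
apply: le_trans h.
have -> : tie z w e k = Om `&` (B `&` [set x | `|util z w k.1 x - util z w k.2 x| <= e]).
  apply/seteqP; split => x [Ox]; last by move=> [_ ?]; split.
  move=> /= h; split=> //; split=> //; rewrite /B /= -uE; split => //.
  by have [? [? _]] := OmM Ox.
have mE : measurable [set x | `|util z w k.1 x - util z w k.2 x| <= e].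
  rewrite -[X in measurable X]setTI.
  have -> : [set x | `|util z w k.1 x - util z w k.2 x| <= e] =
     (fun x : vec3 R => `|util z w k.1 x - util z w k.2 x|) @^-1` `]-oo, e].
    by apply/seteqP; split => x /=; rewrite in_itv.
  apply: measurableT_comp => //.
  by apply: measurable_funB; exact: measurable_util.
have mB : measurable B.
  have -> : B = (`[- M, M]%classic `*` `[- M, M]%classic) `*` setT
      `&` [set x | `|util z w k.1 x - util z w k.2 x| <= e].
    apply/seteqP; split => [x [[h1 h2] h3]|x [[[/= h1 h2] _] h3]].
      by split; [split => //; split; rewrite /= in_itv/= -ler_norml|rewrite /= uE].
    split; last by rewrite -uE.
    by move: h1 h2; rewrite !in_itv/= -!ler_norml.
  by apply: measurableI => //; do !apply: measurableX.
apply: le_measure; rewrite ?inE//; last by move=> x [_ []].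
by apply: measurableI => //; exact: measurableI.
Qed.

Lemma IOm_ties z w (e r : R) : 0 < r -> gap r z -> 0 <= e ->
  IOm (ties z w e) <= Ktie r * e.
Proof.
move=> r0 gz e0; rewrite (@IOm_ext _ _ _
   (fun x => \sum_k (if k.1 != k.2 then 1 else 0) * \1_(tie z w e k) x)); last first.
  move=> x _; rewrite /ties [LHS]big_mkcond; apply: eq_bigr => k _.
  by case: ifP => _; rewrite ?mul1r ?mul0r.
have bt k : bmeas (\1_(tie z w e k)) by apply: bmeas_indic => //; exact: measurable_tie.
rewrite IOm_sum//; last by move=> k; exact: bmeasZ.
apply: (@le_trans _ _ (\sum_(k : 'I_N * 'I_N) 2 * M * (2 * M) * (2 / r) * e)).
  apply: ler_sum => k _; rewrite IOmZ//; case: ifPn => kk.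
    by rewrite mul1r; exact: IOm_tie.
  by rewrite mul0r !mulr_ge0// invr_ge0 ltW.
by rewrite sumr_const card_prod card_ord /Ktie -[X in X <= _]mulr_natl mulrA.
Qed.

Definition vol z w i := IOm (lab (laguerre z w) i).

Lemma vol_sum z w : \sum_i vol z w i = 1.
Proof.
rewrite /vol -IOm_sum//; last first.
  by move=> i; apply: bmeas_lab; exact: laguerre_measurable.
rewrite -[RHS](IOm_cst mOm Om1); apply: IOm_ext => x _.
rewrite (bigD1 (laguerre z w x))//= /lab eqxx big1 ?addr0// => i.
by rewrite eq_sym => /negbTE ->.
Qed.

(** A point that leaves cell [i] when [w] is replaced by [w'] moves to a label whose utility for [w]
    is within [2 * e] of that of [i], so it lies in a tie slab. *)
Lemma vol_lip z w w' (e r : R) i : 0 < r -> gap r z ->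
  (forall j, `|w j - w' j| <= e) -> vol z w i <= vol z w' i + Ktie r * (2 * e).
Proof.
move=> r0 gz we.
have e0 : 0 <= e by exact: le_trans (normr_ge0 _) (we i0).
have bl w1 := bmeas_lab i (@laguerre_measurable z w1).
apply: (@le_trans _ _ (vol z w' i + IOm (ties z w (2 * e)))); last first.
  by rewrite lerD2l; apply: IOm_ties => //; rewrite mulr_ge0.
rewrite -IOmD//; last exact: bmeas_ties.
apply: IOm_le => //; first by apply: bmeasD => //; exact: bmeas_ties.
move=> x Ox; rewrite /lab.
have [h|h] := eqVneq (laguerre z w x) i; last by rewrite addr_ge0// ties_ge0.
have [h'|h'] := eqVneq (laguerre z w' x) i; first by rewrite lerDl ties_ge0.
rewrite add0r; apply: (@ties_ge1 _ _ _ _ i (laguerre z w' x)) => //.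
  by rewrite eq_sym.
have h1 := laguerre_max z w x (laguerre z w' x).
have h2 := laguerre_max z w' x i.
rewrite h in h1.
move: h1 h2 (we i) (we (laguerre z w' x)); rewrite /util !ler_norml.
by move=> h1 h2 /andP[h3 h4] /andP[h5 h6]; apply/andP; split; lra.
Qed.

(** The rivals of [i] only gain from [w] to [w'], so a point won by [i] under [w'] was already won
    under [w]. This makes subsolutions stable under maxima. *)
Lemma vol_mono z w w' i : w i = w' i -> (forall j, w j <= w' j) ->
  vol z w' i <= vol z w i.
Proof.
move=> wi ww; apply: IOm_le => //; try exact: bmeas_lab (@laguerre_measurable _ _).
move=> x _; rewrite /lab; have [h|_] := eqVneq (laguerre z w' x) i; last by [].
suff -> : laguerre z w x = i by rewrite eqxx.
have /laguerre_eq/andP[/forallP h1 /forallP h2] := h.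
apply/laguerre_eq/andP; split; apply/forallP => j.
  by have := h1 j; have := ww j; rewrite /util wi; lra.
apply/implyP => ji; have := implyP (h2 j) ji; have := ww j; rewrite /util wi; lra.
Qed.

End laguerre.

(** * Existence of Laguerre weights and optimality of Laguerre plans *)

Section optimal_plans.
Context {R : realType} (Om : set (vec3 R)) (M : R).
Hypothesis mOm : measurable Om.
Hypothesis OmM : forall x, Om x -> `|c1 x| <= M /\ `|c2 x| <= M /\ `|c3 x| <= M.
Hypothesis Om1 : @leb3 R Om = 1%E.
Local Notation IOm := (@IOm R Om).
Local Notation bmeas := (@bmeas R Om).
Context (N : nat) (m : 'I_N -> R) (i0 : 'I_N).
Hypothesis m_gt0 : forall i, 0 < m i.
Hypothesis m_sum : \sum_i m i = 1.
Local Notation plan := (plan Om m).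
Local Notation vol := (@vol R Om N i0).
Local Notation laguerre := (@laguerre R N i0).
Local Notation Ktie := (@Ktie R M N).

(** The normalisation at [i0] removes the invariance under adding a constant to all weights. The
    cell of [i0] carries no constraint of its own: since the others are not too large, it has volume
    at least [m i0]. *)
Definition subsol z (w : 'I_N -> R) :=
  w i0 = 0 /\ forall i, i != i0 -> vol z w i <= m i.

Lemma dot3_bound x (y : vec3 R) : Om x ->
  `|dot3 x y| <= M * (`|c1 y| + `|c2 y| + `|c3 y|).
Proof.
move=> /OmM[h1 [h2 h3]]; rewrite /dot3 !mulrDr.
apply: le_trans (ler_normD _ _) _; apply: lerD; last first.
  by rewrite normrM ler_wpM2r.
apply: le_trans (ler_normD _ _) _; apply: lerD; by rewrite normrM ler_wpM2r.
Qed.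

(** The cell of [i0] has positive volume, hence contains a point; there [i0] beats [i], which bounds
    [w i] by a difference of dot products. *)
Lemma subsol_bound z : exists B : R, forall w, subsol z w -> forall i, w i <= B.
Proof.
pose b i := M * (`|c1 (z i0 - z i)| + `|c2 (z i0 - z i)| + `|c3 (z i0 - z i)|).
exists (\sum_i `|b i|) => w [w0 wm] i.
have : 0 < vol z w i0.
  have := vol_sum mOm Om1 i0 z w; rewrite (bigD1 i0)//= => h.
  have h2 : \sum_(j | j != i0) vol z w j <= \sum_(j | j != i0) m j.
    by apply: ler_sum => j; exact: wm.
  move: m_sum; rewrite (bigD1 i0)//= => h3.
  have := m_gt0 i0; lra.
rewrite /vol IOm_lab => /(IOm_indic_gt0 mOm Om1)[x Ox [_ /= sx]].
have := laguerre_max i0 z w x i; rewrite sx /util w0 => h.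
have hb : `|dot3 x (z i0 - z i)| <= b i by exact: dot3_bound.
have e : dot3 x (z i0 - z i) = dot3 x (z i0) - dot3 x (z i).
  by rewrite /dot3 /c1 /c2 /c3 /=; ring.
apply: (@le_trans _ _ `|b i|); last first.
  by rewrite (bigD1 i)//= lerDl sumr_ge0.
apply: le_trans (ler_norm (b i)); move: hb; rewrite e ler_norml => /andP[_ hb]; lra.
Qed.

(** Weights so low that [i0] wins everywhere leave the other cells empty. *)
Lemma subsol_exists z : exists w, subsol z w.
Proof.
pose b i := M * (`|c1 (z i0 - z i)| + `|c2 (z i0 - z i)| + `|c3 (z i0 - z i)|).
exists (fun i => if i == i0 then 0 else - (`|b i| + 1)); split; first by rewrite eqxx.
move=> i ii0; apply: (@le_trans _ _ 0); last by rewrite ltW.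
rewrite -[X in _ <= X](IOm_cst mOm Om1); apply: IOm_le => //.
- by apply: bmeas_lab => //; exact: laguerre_measurable.
- exact: bmeas_cst.
move=> x Ox; rewrite /lab; case: eqVneq => // sx.
set w := fun i => _ in sx.
have := laguerre_max i0 z w x i0; rewrite sx /util /w eqxx (negbTE ii0) => h.
have hb : `|dot3 x (z i0 - z i)| <= b i by exact: dot3_bound.
have e : dot3 x (z i0 - z i) = dot3 x (z i0) - dot3 x (z i).
  by rewrite /dot3 /c1 /c2 /c3 /=; ring.
have := ler_norm (b i); move: hb; rewrite e ler_norml => /andP[hb _]; lra.
Qed.

(** In the coordinatewise maximum, coordinate [i] comes from one of the given subsolutions and all
    others are at least as large, so [vol_mono] bounds cell [i]. *)
Lemma subsol_max z (ws : 'I_N -> 'I_N -> R) : (forall k, subsol z (ws k)) ->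
  exists2 w, subsol z w & forall k i, ws k i <= w i.
Proof.
move=> hw.
have hk i : exists k, forall k', ws k' i <= ws k i.
  case: (@arg_maxP _ _ _ i0 predT (fun k => ws k i)) => // k _ hk.
  by exists k => k'; exact: hk.
have [kk hkk] := choice hk.
exists (fun i => ws (kk i) i) => [|k i]; last exact: hkk.
split; first by have [] := hw (kk i0).
move=> i ii0; have [_ h] := hw (kk i); apply: le_trans (h i ii0).
by apply: vol_mono.
Qed.

(* Perron's method: the supremum of all subsolutions is a solution. *)
Lemma weights_exist (r : R) z : 0 < r -> gap r z -> exists w, plan (laguerre z w).
Proof.
move=> r0 gz.
have [B hB] := subsol_bound z; have [wi hwi] := subsol_exists z.
pose E i := [set a : R | exists2 w, subsol z w & a = w i].
have hE i : has_sup (E i).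
  split; first by exists (wi i), wi.
  by exists B => _ [w hw ->]; exact: hB.
pose w i := sup (E i).
have w_ub w' i : subsol z w' -> w' i <= w i.
  by move=> hw'; apply: sup_upper_bound => //; exists w'.
(* One subsolution comes near the supremum in all coordinates at once: the maximum of one
   near-maximiser per coordinate. *)
have w_approx (e : R) : 0 < e -> exists2 w', subsol z w' & forall i, `|w i - w' i| <= e.
  move=> e0.
  have hk k : exists w', subsol z w' /\ w k - e < w' k.
    by have [_ [w' hw' ->] hlt] := sup_adherent e0 (hE k); exists w'.
  have [ws hws] := choice hk.
  have [w' hw' hmax] := @subsol_max z ws (fun k => (hws k).1).
  exists w' => // i; have := (hws i).2; have := hmax i i; have := w_ub _ i hw'.
  by move=> h1 h2 h3; rewrite ger0_norm; lra.
have K0 : 0 <= Ktie r by exact: (Ktie_ge0 mOm OmM Om1).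
have w0 : w i0 = 0.
  apply/eqP; rewrite eq_le; apply/andP; split.
    by apply: ge_sup; [exists (wi i0), wi|move=> _ [w' [-> _] ->]].
  by apply: le_trans (w_ub _ i0 hwi); have [-> _] := hwi.
have wsub : subsol z w.
  split=> // i ii0; apply/ler_addgt0Pr => e e0.
  (* With this [d], the loss [Ktie r * (2 * d)] of [vol_lip] is at most [e]; the [+ 1] keeps the
     denominator positive. *)
  have d0 : 0 < e / (2 * Ktie r + 1) by rewrite divr_gt0//; lra.
  have [w' [_ hw'] hd] := w_approx _ d0.
  apply: le_trans (vol_lip mOm OmM Om1 i0 i r0 gz hd) _.
  apply: lerD; first exact: hw'.
  rewrite mulrCA mulrA mulrA ler_pdivrMr; last lra.
  by rewrite mulrC; nra.
have weq i : i != i0 -> vol z w i = m i.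
  move=> ii0; apply/eqP; rewrite eq_le (wsub.2 _ ii0)/= leNgt; apply/negP => hlt.
  (* Raising the weight of a deficient cell by [d] adds at most the missing volume to it and shrinks
     the other cells: a subsolution above the supremum. *)
  pose d := (m i - vol z w i) / (2 * Ktie r + 1).
  have d0 : 0 < d by rewrite divr_gt0//; lra.
  pose w' j := if j == i then w j + d else w j.
  have hd j : `|w' j - w j| <= d.
    rewrite /w'; case: ifP => _; last by rewrite subrr normr0 ltW.
    by rewrite addrAC subrr add0r ger0_norm// ltW.
  have : subsol z w'.
    split; first by rewrite /w' eq_sym (negbTE ii0).
    move=> j ji0; have [->|ji] := eqVneq j i.
      apply: le_trans (vol_lip mOm OmM Om1 i0 i r0 gz hd) _.
      rewrite -lerBrDl mulrCA mulrA mulrA ler_pdivrMr; last lra.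
      by rewrite mulrC; nra.
    apply: le_trans (wsub.2 _ ji0); apply: vol_mono => //.
      by rewrite /w' (negbTE ji).
    by move=> k; rewrite /w'; case: ifP => // _; rewrite lerDl ltW.
  by move=> /(w_ub _ i); rewrite /w' eqxx; lra.
exists w => i; split; first exact: laguerre_measurable.
rewrite -IOm_lab -/(vol z w i); have [->|ii0] := eqVneq i i0; last exact: weq.
(* The cell of [i0] takes what is left of the total volume 1. *)
have := vol_sum mOm Om1 i0 z w; rewrite (bigD1 i0)//= (eq_bigr m weq).
by move: m_sum; rewrite (bigD1 i0)//= => <- /addIr.
Qed.

(** The weight term depends only on the masses of the labels, so it shifts the reward of every plan
    by the same amount. *)
Lemma plan_utility s z w : plan s ->
  IOm (fun x => util z w (s x) x) = reward Om s z + \sum_i m i * w i.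
Proof.
move=> ps; have ms := plan_label_measurable ps.
rewrite -(IOm_label_cst mOm Om1 w ps) -IOmD//.
- apply: (bmeas_label (f := fun i x => dot3 x (z i)) ms) => i; exact: bmeas_dot OmM _.
- by apply: (bmeas_label (f := fun i _ => w i) ms) => i; exact: bmeas_cst.
Qed.

(** Weak duality: rewards of plans compare like integrals of utilities, and the Laguerre label
    maximises the utility at every point. *)
Lemma laguerre_reward_max s z w : plan s -> plan (laguerre z w) ->
  reward Om s z <= reward Om (laguerre z w) z.
Proof.
move=> ps pl; rewrite -(lerD2r (\sum_i m i * w i)) -!plan_utility//.
have bu s' : plan s' -> bmeas (fun x => util z w (s' x) x).
  move=> ps'; apply: (bmeas_label (f := util z w) (plan_label_measurable ps')) => i.
  exact: (bmeas_util OmM).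
by apply: IOm_le => //; [exact: bu|exact: bu|move=> x _; exact: laguerre_max].
Qed.

(* Perturbing the seeds of an optimal plan only matters on the slab where two
   utilities almost tie, whose volume is O(e). *)
Lemma laguerre_reward_quad s z w y (r e : R) : 0 < r -> gap r z -> 0 <= e ->
  plan s -> plan (laguerre z w) ->
  (forall x i, Om x -> `|dot3 x (y i) - dot3 x (z i)| <= e) ->
  reward Om s y <= reward Om (laguerre z w) y + 4 * Ktie r * e ^+ 2.
Proof.
move=> r0 gz e0 ps pl he.
have bu s' : plan s' -> bmeas (fun x => util y w (s' x) x).
  move=> ps'; apply: (bmeas_label (f := util y w) (plan_label_measurable ps')) => i.
  exact: (bmeas_util OmM).
have e20 : 0 <= 2 * e by lra.
have bt := bmeas_ties mOm z w (2 * e).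
rewrite -(lerD2r (\sum_i m i * w i)) addrAC -!plan_utility//.
(* Passing from [z] to [y] changes each utility by at most [e]. A label other than the Laguerre one
   thus gains at most [2 * e], and only where the two utilities for [z] are within [2 * e]; the
   product of gain and volume is quadratic. *)
apply: (@le_trans _ _ (IOm (fun x => util y w (laguerre z w x) x)
    + IOm (fun x => 2 * e * ties Om z w (2 * e) x))).
  rewrite -IOmD//; [|exact: bu|exact: bmeasZ].
  apply: IOm_le => //; [exact: bu|apply: bmeasD; [exact: bu|exact: bmeasZ]|].
  move=> x Ox.
  have t0 := ties_ge0 Om z w (2 * e) x.
  have [<-|ne] := eqVneq (s x) (laguerre z w x).
    by rewrite lerDl mulr_ge0.
  have h1 := laguerre_max i0 z w x (s x).
  have [h2|h2] := leP `|util z w (s x) x - util z w (laguerre z w x) x| (2 * e).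
    have t1 := ties_ge1 Ox ne h2.
    have t2 : 2 * e <= 2 * e * ties Om z w (2 * e) x by rewrite ler_peMr.
    move: h1 (he x (s x) Ox) (he x (laguerre z w x) Ox); rewrite /util !ler_norml.
    by move=> h1 /andP[? ?] /andP[? ?]; lra.
  have t2 : 0 <= 2 * e * ties Om z w (2 * e) x by rewrite mulr_ge0.
  rewrite ler0_norm in h2; last lra.
  move: h1 h2 (he x (s x) Ox) (he x (laguerre z w x) Ox); rewrite /util !ler_norml.
  by move=> h1 h2 /andP[? ?] /andP[? ?]; lra.
rewrite lerD2l IOmZ//.
have := IOm_ties mOm OmM Om1 w r0 gz e20.
set T := IOm _ => hT.
apply: (@le_trans _ _ (2 * e * (Ktie r * (2 * e)))); first by rewrite ler_wpM2l.
by rewrite le_eqVlt; apply/orP; left; apply/eqP; ring.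
Qed.
End optimal_plans.

(** With step [t = 1 / (2 C)] the quadratic loss [C t^2 D] is half the linear gain [t D]; the other
    half is left to be bounded by [C S]. *)
Lemma quad_bound_algebra (R : realType) (C S D a b d f e p q : R) : 0 < C ->
  let t := (2 * C)^-1 in
  a <= b -> b <= d + C * (t ^+ 2 * D) -> e <= f + C * S ->
  a = f + p -> d = e + q -> p - q = t * D -> D <= (2 * C) ^+ 2 * S.
Proof.
move=> C0 t h1 h2 h3 e1 e2 s2.
have key : t * D <= C * S + C * (t ^+ 2 * D) by lra.
have tE : t * (2 * C) = 1 by rewrite /t mulVf//; lra.
have k2 : C * (t ^+ 2 * D) = t * D / 2.
  have -> : C * (t ^+ 2 * D) = t * (2 * C) * (t * D) / 2 by field.
  by rewrite tE mul1r.
have k3 : t * D <= 2 * C * S by rewrite k2 in key; lra.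
have := ler_wpM2r (ltW (mulr_gt0 (ltr0n _ 2) C0)) k3.
have -> : t * D * (2 * C) = t * (2 * C) * D by ring.
rewrite tE mul1r => /le_trans; apply; rewrite le_eqVlt; apply/orP; left.
by apply/eqP; ring.
Qed.

(** * Lipschitz dependence of the cell moments on the horizontal positions *)

Section stability.
Context {R : realType} (Om : set (vec3 R)) (M : R).
Hypothesis mOm : measurable Om.
Hypothesis OmM : forall x, Om x -> `|c1 x| <= M /\ `|c2 x| <= M /\ `|c3 x| <= M.
Hypothesis Om1 : @leb3 R Om = 1%E.
Local Notation IOm := (@IOm R Om).
Local Notation bmeas := (@bmeas R Om).
Context (N : nat) (m : 'I_N -> R) (i0 : 'I_N).
Hypothesis m_gt0 : forall i, 0 < m i.
Hypothesis m_sum : \sum_i m i = 1.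
Local Notation plan := (plan Om m).
Local Notation laguerre := (@laguerre R N i0).

Definition optlab z : vec3 R -> 'I_N :=
  laguerre z (xget (fun=> 0) [set w | plan (laguerre z w)]).

Lemma optlab_plan (r : R) z : 0 < r -> gap r z -> plan (optlab z).
Proof.
move=> r0 gz; have h := @weights_exist _ _ _ mOm OmM Om1 _ _ i0 m_gt0 m_sum r z r0 gz.
exact: (xgetPex (fun=> 0) h).
Qed.

Context (h : 'I_N -> R) (r : R).
Hypothesis r0 : 0 < r.
Hypothesis hr : forall i j, i != j -> r <= `|h i - h j|.

(* [X (i, false)] and [X (i, true)] are the horizontal coordinates of the i-th seed. *)
Definition pos (X : 'I_N * bool -> R) (i : 'I_N) : vec3 R :=
  ((X (i, false), X (i, true)), h i).

Lemma gap_pos X : gap r (pos X). Proof. by move=> i j; exact: hr. Qed.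

Definition hmoment (s : vec3 R -> 'I_N) (k : 'I_N * bool) : R :=
  if k.2 then c2 (moment Om s k.1) else c1 (moment Om s k.1).

Lemma sum_pair_bool (F : 'I_N * bool -> R) :
  \sum_k F k = \sum_i (F (i, false) + F (i, true)).
Proof.
rewrite (eq_bigr (fun k => F (k.1, k.2))); last by case.
rewrite -(pair_bigA _ (fun i b => F (i, b)))/=.
by apply: eq_bigr => i _; rewrite big_bool/= addrC.
Qed.

Lemma reward_diff s X Y : plan s ->
  reward Om s (pos Y) = reward Om s (pos X) + \sum_k hmoment s k * (Y k - X k).
Proof.
move=> /plan_label_measurable ms; rewrite !(rewardE mOm OmM Om1)// sum_pair_bool.
rewrite -big_split/=; apply: eq_bigr => i _.
by rewrite /hmoment /dot3 /pos /= /c1 /c2 /c3 /=; ring.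
Qed.

(** The bound [4 * Ktie * e ^+ 2] of [laguerre_reward_quad] at [e ^+ 2 = 2 * M ^+ 2 * S], where [S]
    is the squared displacement; the [+ 1] makes the constant positive, so that it can be divided
    by. *)
Definition Kquad : R := 8 * Ktie M N r * M ^+ 2 + 1.

Lemma Kquad_gt0 : 0 < Kquad.
Proof.
have h0 := Ktie_ge0 mOm OmM Om1 N r0.
by rewrite /Kquad ltr_wpDl// mulr_ge0 ?sqr_ge0// mulr_ge0.
Qed.

Definition opt X := optlab (pos X).
Lemma opt_plan X : plan (opt X).
Proof. exact: (optlab_plan r0 (@gap_pos X)). Qed.

Lemma reward_opt_max s X : plan s -> reward Om s (pos X) <= reward Om (opt X) (pos X).
Proof. move=> ps; apply: (laguerre_reward_max mOm OmM Om1 ps); exact: opt_plan. Qed.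

Lemma reward_opt_quad s X Y : plan s ->
  reward Om s (pos Y) <= reward Om (opt X) (pos Y) + Kquad * \sum_k (Y k - X k) ^+ 2.
Proof.
move=> ps; set S := \sum_k _.
have S0 : 0 <= S by apply: sumr_ge0 => k _; exact: sqr_ge0.
have [x Ox _] : exists2 x, Om x & setT x.
  by apply: (IOm_indic_gt0 mOm Om1); rewrite indicT IOm_cst.
have M0 : 0 <= M by have [hh _] := OmM Ox; exact: le_trans hh.
(* Moving a seed horizontally by [(a, b)] changes its dot product with a point of the domain by at
   most [M (|a| + |b|)], and [(|a| + |b|)^2 <= 2 (a^2 + b^2) <= 2 S]. *)
pose e := M * Num.sqrt (2 * S).
have e0 : 0 <= e by rewrite mulr_ge0// sqrtr_ge0.
have he y i : Om y -> `|dot3 y (pos Y i) - dot3 y (pos X i)| <= e.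
  move=> Oy.
  set a := Y (i, false) - X (i, false); set b := Y (i, true) - X (i, true).
  have -> : dot3 y (pos Y i) - dot3 y (pos X i) = c1 y * a + c2 y * b.
    by rewrite /dot3 /pos /a /b /c1 /c2 /c3 /=; ring.
  have abS : a ^+ 2 + b ^+ 2 <= S.
    rewrite /S sum_pair_bool (bigD1 i)//= lerDl.
    by apply: sumr_ge0 => j _; rewrite addr_ge0// sqr_ge0.
  have ab : `|a| + `|b| <= Num.sqrt (2 * S).
    rewrite -(@ler_pXn2r _ 2)// ?nnegrE ?addr_ge0 ?sqrtr_ge0//.
    rewrite sqr_sqrtr ?mulr_ge0//.
    have := sqr_ge0 (`|a| - `|b|).
    have := real_normK (num_real a); have := real_normK (num_real b).
    by move: (`|a|) (`|b|) abS => p q; nra.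
  have [y1 [y2 _]] := OmM Oy.
  apply: le_trans (ler_normD _ _) _; rewrite !normrM.
  apply: (@le_trans _ _ (M * (`|a| + `|b|))); last by rewrite ler_wpM2l.
  by rewrite mulrDr lerD// ler_wpM2r.
have := laguerre_reward_quad mOm OmM Om1 r0 (@gap_pos X) e0 ps (opt_plan X) he.
move/le_trans; apply; rewrite lerD2l /e exprMn sqr_sqrtr ?mulr_ge0//.
rewrite /Kquad; have := Ktie_ge0 mOm OmM Om1 N r0.
by move: (Ktie M N r) (sqr_ge0 M) => K; nra.
Qed.

(* Baillon-Haddad: a convex function with a quadratic upper bound at every
   point has a Lipschitz gradient; here the gradient of the optimal reward is
   the moment map. *)
Lemma hmoment_lip X Y :
  \sum_k (hmoment (opt X) k - hmoment (opt Y) k) ^+ 2 <=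
  (2 * Kquad) ^+ 2 * \sum_k (X k - Y k) ^+ 2.
Proof.
have C0 := Kquad_gt0; set C := Kquad in C0 *.
set D := \sum_k _; set S := \sum_k _.
pose dl k := hmoment (opt X) k - hmoment (opt Y) k.
pose t := (2 * C)^-1.
(* The test point is a gradient step from [Y] along the difference of the two gradients. *)
pose Z k := Y k + t * dl k.
have h1 := reward_opt_max Z (opt_plan X).
have h2 := reward_opt_quad Y Z (opt_plan Z).
have h3 := reward_opt_quad X Y (opt_plan Y).
have e1 := reward_diff Y Z (opt_plan X).
have e2 := reward_diff Y Z (opt_plan Y).
have ZY k : Z k - Y k = t * dl k by rewrite /Z addrAC subrr add0r.
have s1 : \sum_k (Z k - Y k) ^+ 2 = t ^+ 2 * D.
  rewrite mulr_sumr; apply: eq_bigr => k _; by rewrite ZY exprMn.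
have s2 : \sum_k hmoment (opt X) k * (Z k - Y k) -
          \sum_k hmoment (opt Y) k * (Z k - Y k) = t * D.
  rewrite -sumrB mulr_sumr; apply: eq_bigr => k _.
  by rewrite ZY -mulrBl -/(dl k) mulrCA -expr2.
have s3 : \sum_k (Y k - X k) ^+ 2 = S.
  by apply: eq_bigr => k _; rewrite -sqrrN opprB.
rewrite -/C in h2 h3; rewrite s1 in h2; rewrite s3 in h3.
exact: (quad_bound_algebra C0 h1 h2 h3 e1 e2 s2).
Qed.

End stability.

(** * Optimal maps onto a discrete measure: existence and uniqueness almost everywhere *)

Lemma measurable_vec3_set1 (R : realType) (y : vec3 R) : measurable [set y].
Proof.
have -> : [set y] = ([set y.1.1] `*` [set y.1.2]) `*` [set y.2].
  apply/seteqP; split => [_ ->//|[[a b] c] [[/= -> ->] ->]].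
  by case: y => [[]].
by do !apply: measurableX.
Qed.

Section optimal_maps.
Context {R : realType} (Om : set (vec3 R)) (M : R).
Hypothesis mOm : measurable Om.
Hypothesis OmM : forall x, Om x -> `|c1 x| <= M /\ `|c2 x| <= M /\ `|c3 x| <= M.
Hypothesis Om1 : @leb3 R Om = 1%E.
Local Notation IOm := (@IOm R Om).
Local Notation bmeas := (@bmeas R Om).
Context (N : nat) (m : 'I_N -> R) (i0 : 'I_N).
Hypothesis m_gt0 : forall i, 0 < m i.
Hypothesis m_sum : \sum_i m i = 1.
Local Notation plan := (plan Om m).
Context (z : 'I_N -> vec3 R) (r : R).
Hypothesis r0 : 0 < r.
Hypothesis gz : gap r z.
Local Notation s0 := (optlab Om m i0 z).

Let z_inj : injective z.
Proof.
move=> i j zij; apply: contrapT => /eqP ij.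
by have := gz ij; rewrite zij subrr normr0 leNgt r0.
Qed.

Let s0_plan : plan s0. Proof. exact: (optlab_plan mOm OmM Om1 i0 m_gt0 m_sum r0 gz). Qed.

Lemma plan_transports s : plan s -> transports Om (disc m z) (fun x => z (s x)).
Proof.
move=> ps; have ms := plan_label_measurable ps.
have mA (A : set (vec3 R)) : measurable (Om `&` (fun x => z (s x)) @^-1` A).
  have -> : Om `&` (fun x => z (s x)) @^-1` A =
      \bigcup_(i in [set i | A (z i)]) (Om `&` [set x | s x = i]).
    apply/seteqP; split => [x [Ox Ax]|x [i Ai [Ox si]]]; first by exists (s x).
    by split => //; rewrite /preimage/= si.
  by apply: fin_bigcup_measurable => //; exact: finite_finset.
split; first by move=> _ A _; exact: mA.
move=> A _; rewrite -(IOm_indic mOm Om1 (mA A)); last by move=> x [].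
congr EFin; rewrite /disc -(IOm_label_cst mOm Om1 (fun i => \1_A (z i)) ps).
apply: IOm_ext => x Ox; rewrite !indicE; congr (_%:R); congr nat_of_bool.
apply/idP/idP => [/set_mem[_ h]|/set_mem h]; exact/mem_set.
Qed.

(** Inverse of [z] on the seeds, extended by [i0] elsewhere; it turns any transport map into a
    labelling. *)
Definition seed_index (y : vec3 R) : 'I_N := odflt i0 [pick i | z i == y].

Lemma seed_indexK i : seed_index (z i) = i.
Proof.
rewrite /seed_index; case: pickP => [j /eqP /z_inj//|/(_ i)].
by rewrite eqxx.
Qed.

Lemma measurable_seed_index i : measurable [set y | seed_index y = i].
Proof.
have ms j : measurable [set z j] by exact: measurable_vec3_set1.
have [->|ii0] := eqVneq i i0.
  have -> : [set y | seed_index y = i0] =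
      ~` \bigcup_(j in [set j | j != i0]) [set z j].
    apply/seteqP; split => y /=.
      by move=> yi [j /= ji yj]; move: yi; rewrite yj seed_indexK => jj; rewrite jj eqxx in ji.
    move=> h; rewrite /seed_index; case: pickP => //= j /eqP zj.
    by apply: contrapT => /eqP ji; apply: h; exists j.
  by apply: measurableC; apply: fin_bigcup_measurable => //; exact: finite_finset.
have -> : [set y | seed_index y = i] = [set z i]; last exact: ms.
apply/seteqP; split => y /=; last by move=> ->; exact: seed_indexK.
rewrite /seed_index; case: pickP => /= [j /eqP <- ->//|_ hi].
by rewrite hi eqxx in ii0.
Qed.

Lemma transports_plan S : transports Om (disc m z) S -> plan (seed_index \o S).
Proof.
move=> [mS hS] i.
have e : Om `&` [set x | (seed_index \o S) x = i] =
  Om `&` S @^-1` [set y | seed_index y = i] by [].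
have mi := measurable_seed_index i.
split; first by rewrite e; exact: mS.
apply: EFin_inj; rewrite (IOm_indic mOm Om1); last 2 first.
  by rewrite e; exact: mS.
  by move=> x [].
rewrite e hS//; congr EFin; rewrite /disc (bigD1 i)//= big1 ?addr0.
  by rewrite indicE mem_set ?mulr1//=; exact: seed_indexK.
move=> j ji; rewrite indicE memNset ?mulr0//= seed_indexK => ji'.
by rewrite ji' eqxx in ji.
Qed.

(** The target measure gives no mass to the complement of the seeds, so its preimage is
    negligible. *)
Lemma transports_ae S : transports Om (disc m z) S ->
  {ae @leb3 R, forall x, Om x -> S x = z (seed_index (S x))}.
Proof.
move=> [mS hS].
have mr : measurable (range z).
  have -> : range z = \bigcup_(i in setT) [set z i].
    by apply/seteqP; split => [_ [i _ <-]|_ [i _ ->]]; exists i.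
  apply: fin_bigcup_measurable; first exact: finite_finset.
  by move=> i _; exact: measurable_vec3_set1.
exists (Om `&` S @^-1` (~` range z)); split.
- by apply: mS => //; exact: measurableC.
- rewrite (_ : leb3 _ = 0%E)//.
  rewrite hS; last exact: measurableC.
  rewrite /disc big1// => i _; rewrite indicE memNset ?mulr0//.
  by apply; exists i.
- move=> x /= /not_implyP[Ox nS]; split=> // -[i _ zi].
  by apply: nS; rewrite -zi seed_indexK.
Qed.

Definition sqn (x : vec3 R) := c1 x ^+ 2 + c2 x ^+ 2 + c3 x ^+ 2.

Lemma bmeas_sqn : bmeas sqn.
Proof.
have b1 := bmeas_c1 OmM; have b2 := bmeas_c2 OmM; have b3 := bmeas_c3 OmM.
by rewrite /sqn; do 2!(apply: bmeasD; last exact: bmeasM); exact: bmeasM.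
Qed.

Lemma dist2E (x y : vec3 R) : dist2 x y = sqn x + sqn y - 2 * dot3 x y.
Proof. by rewrite /dist2 /sqn /dot3; ring. Qed.

Lemma bmeas_plan_cost s : plan s -> bmeas (fun x => dist2 x (z (s x))).
Proof.
move=> ps; apply: (bmeas_label (f := fun i x => dist2 x (z i)) (plan_label_measurable ps)).
move=> i; apply: (@eq_bmeas _ _ (fun x => sqn x + sqn (z i) - 2 * dot3 x (z i))).
  by move=> x _; rewrite dist2E.
apply: bmeasB; last by apply: bmeasZ; exact: (bmeas_dot OmM).
by apply: bmeasD; [exact: bmeas_sqn|exact: bmeas_cst].
Qed.

Lemma plan_costE s : plan s -> transport_cost Om (fun x => z (s x)) =
  (IOm sqn + \sum_i m i * sqn (z i) - 2 * reward Om s z)%:E.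
Proof.
move=> ps; rewrite /transport_cost (bmeas_EFin mOm Om1); last exact: bmeas_plan_cost.
congr EFin; have ms := plan_label_measurable ps.
have b1 : bmeas (fun x => sqn (z (s x))).
  by apply: (bmeas_label (f := fun i _ => sqn (z i)) ms) => i; exact: bmeas_cst.
have b2 : bmeas (fun x => dot3 x (z (s x))).
  by apply: (bmeas_label (f := fun i x => dot3 x (z i)) ms) => i; exact: (bmeas_dot OmM).
have bs := bmeas_sqn.
rewrite -(IOm_label_cst mOm Om1 (fun i => sqn (z i)) ps).
rewrite /reward -(IOmZ mOm Om1 2 b2) -(IOmD mOm Om1 bs b1).
rewrite -IOmB//; [|exact: bmeasD|exact: bmeasZ].
by apply: IOm_ext => x _; exact: dist2E.
Qed.

Lemma transports_costE S : transports Om (disc m z) S ->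
  transport_cost Om S = transport_cost Om (fun x => z (seed_index (S x))).
Proof.
move=> tS; have [mS _] := tS; apply: ae_eq_integral => //.
- apply/measurable_EFinP; rewrite /dist2.
  have mc (c : vec3 R -> R) : (forall D, measurable_fun D c) -> measurable_fun Om (fun x => c x - c (S x)).
    move=> mc; apply: measurable_funB; first exact: mc.
    by apply: measurableT_comp => //; exact: mc.
  apply: measurable_funD; last by apply: measurable_funX; apply: mc; exact: measurable_c3.
  apply: measurable_funD; apply: measurable_funX; apply: mc.
    exact: measurable_c1.
  exact: measurable_c2.
- apply/measurable_EFinP.
  by have [] := bmeas_plan_cost (transports_plan tS).
- apply: filterS (transports_ae tS) => x h Ox.
  by rewrite {1}h.
Qed.

Lemma optlab_optimal : optimal_map Om (disc m z) (fun x => z (s0 x)).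
Proof.
split; first exact: plan_transports.
move=> S tS; rewrite (transports_costE tS) !plan_costE//; last exact: transports_plan.
rewrite lee_fin lerD2l lerN2 ler_pM2l//.
exact: (laguerre_reward_max mOm OmM Om1 (transports_plan tS) s0_plan).
Qed.

(** Equal cost means that the utility lost by the labelling of [S] has zero integral. Being
    nonnegative, it vanishes almost everywhere, and away from ties this forces the same label. *)
Lemma optimal_map_ae S : optimal_map Om (disc m z) S ->
  {ae @leb3 R, forall x, Om x -> S x = z (s0 x)}.
Proof.
move=> [tS /(_ _ (plan_transports s0_plan))].
have ps := transports_plan tS.
rewrite (transports_costE tS) !plan_costE// lee_fin lerD2l lerN2 ler_pM2l// => hle.
pose w := xget (fun=> 0) [set w | plan (laguerre i0 z w)].
(* Adding the exact ties, of integral 0 by [IOm_ties] at [e = 0], lets one null set exclude both a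
   loss of utility and a tie. *)
pose g x := (util z w (s0 x) x - util z w (seed_index (S x)) x) + ties Om z w 0 x.
have bu s' : plan s' -> bmeas (fun x => util z w (s' x) x).
  move=> ps'; apply: (bmeas_label (f := util z w) (plan_label_measurable ps')) => i.
  exact: (bmeas_util OmM).
have bt := bmeas_ties mOm z w 0.
have bg : bmeas g by apply: bmeasD => //; apply: bmeasB; exact: bu.
have g_ge0 x : Om x -> 0 <= g x.
  move=> Ox; rewrite addr_ge0 ?ties_ge0// subr_ge0; exact: laguerre_max.
have Ig : IOm g = 0.
  apply/eqP; rewrite eq_le; apply/andP; split; last first.
    rewrite -[X in X <= _](IOm_cst mOm Om1); apply: IOm_le => //.
    exact: bmeas_cst.
  rewrite /g IOmD// ?IOmB//; try exact: bu; last by apply: bmeasB; exact: bu.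
  rewrite (plan_utility mOm OmM Om1 z w s0_plan) (plan_utility mOm OmM Om1 z w ps).
  have := IOm_ties mOm OmM Om1 w r0 gz (lexx 0); rewrite mulr0; lra.
have : ae_eq (@leb3 R) Om (EFin \o g) (cst 0%E).
  apply/ae_eq_integral_abs => //; first by apply/measurable_EFinP; case: bg.
  rewrite -[RHS]/(0%:E) -Ig -(bmeas_EFin mOm Om1 bg).
  by apply: eq_integral => x /set_mem Ox; rewrite /= ger0_norm// g_ge0.
move=> ag; apply: filterS2 (transports_ae tS) ag => x h1 h2 Ox.
rewrite h1//; congr z; apply: contrapT => /eqP ne.
have g0 : g x = 0 by apply: EFin_inj; exact: (h2 Ox).
have le := laguerre_max i0 z w x (seed_index (S x)).
have t0 := ties_ge0 Om z w 0 x.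
have eqz : util z w (s0 x) x - util z w (seed_index (S x)) x = 0.
  by move: g0; rewrite /g /=; rewrite /optlab in le *; lra.
have := @ties_ge1 _ Om _ z w 0 x _ _ Ox ne.
rewrite distrC eqz normr0 lexx => /(_ isT).
by move: g0; rewrite /g /= eqz; lra.
Qed.

Lemma gradB_optimal : optimal_map Om (disc m z) (gradB Om (disc m z)).
Proof.
apply: (ClassicalEpsilon.epsilon_spec (inhabits (fun x => x)) (optimal_map Om (disc m z))).
by exists (fun x => z (s0 x)); exact: optlab_optimal.
Qed.

(** Under an integral the chosen map may be replaced by the seed of the optimal label. Measurability
    of [Psi] is asked along every measurable map because [gradB] is known only up to a null set. *)
Lemma integral_gradB (Psi : vec3 R -> vec3 R -> R) :
  (forall S, measurable_fun Om S -> measurable_fun Om (fun x => Psi x (S x))) ->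
  (forall i, bmeas (fun x => Psi x (z i))) ->
  (\int[@leb3 R]_(x in Om) (Psi x (gradB Om (disc m z) x))%:E =
   (IOm (fun x => Psi x (z (s0 x))))%:E)%E.
Proof.
move=> mPsi bPsi.
have bP : bmeas (fun x => Psi x (z (s0 x))).
  by apply: (bmeas_label (f := fun i x => Psi x (z i)) (plan_label_measurable s0_plan)).
rewrite -(bmeas_EFin mOm Om1 bP); apply: ae_eq_integral => //.
- by apply/measurable_EFinP; apply: mPsi; have [[]] := gradB_optimal.
- by apply/measurable_EFinP; case: bP.
- by apply: filterS (optimal_map_ae gradB_optimal) => x h Ox; rewrite h.
Qed.
End optimal_maps.

(** * One-variable calculus: expansions, antiderivatives, comparison, limits *)

Section calculus.
Context {R : realType}.
Implicit Types (f g : R -> R).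

Lemma continuous_ptP f (x : R) : {for x, continuous f} <->
  forall e : R, 0 < e -> exists2 d : R, 0 < d &
    forall y, `|y - x| < d -> `|f y - f x| <= e.
Proof.
split=> [/cvgrPdist_le h e e0|h].
  have /nbhs_ballP[d /= d0 hd] := h e e0.
  exists d => // y yx; rewrite distrC; apply: hd.
  by rewrite -ball_normE /= distrC.
apply/cvgrPdist_le => e e0; have [d d0 hd] := h e e0.
exists d => // y /=; rewrite distrC => /hd.
by rewrite distrC.
Qed.

(** A first-order expansion without quotients or punctured neighbourhoods, suited to localising and
    dominating remainders. *)
Lemma is_derive_ptP f (x l : R) : is_derive x 1 f l <->
  forall e : R, 0 < e -> exists2 d : R, 0 < d &
    forall y, `|y - x| < d -> `|f y - f x - l * (y - x)| <= e * `|y - x|.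
Proof.
have P : (h^-1 *: (f (h *: 1 + x) - f x) @[h --> 0^'] --> l) <->
  (forall e : R, 0 < e -> exists2 d : R, 0 < d &
    forall y, `|y - x| < d -> `|f y - f x - l * (y - x)| <= e * `|y - x|).
  split=> [/cvgrPdist_le h e e0|h].
    have /nbhs_ballP[d /= d0 hd] := h e e0.
    exists d => // y yx; have [->|yx0] := eqVneq y x.
      by rewrite !subrr mulr0 subr0 normr0 mulr0.
    have yx1 : y - x != 0 by rewrite subr_eq0.
    have := hd (y - x); rewrite -ball_normE /= sub0r normrN => /(_ yx yx1).
    rewrite scaler1 subrK /GRing.scale/= => hh.
    have -> : f y - f x - l * (y - x) = - ((l - (y - x)^-1 * (f y - f x)) * (y - x)).
      by field.
    by rewrite normrN normrM ler_wpM2r.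
  apply/cvgrPdist_le => e e0; have [d d0 hd] := h e e0.
  apply/nbhs_ballP; exists d => // k; rewrite -ball_normE /= sub0r normrN => kd k0.
  have := hd (k + x); rewrite addrK => /(_ kd) hh.
  rewrite scaler1 /GRing.scale/=.
  have -> : l - k^-1 * (f (k + x) - f x) = - (k^-1 * (f (k + x) - f x - l * k)).
    by field.
  by rewrite normrN normrM normfV ler_pdivrMl ?normr_gt0// (mulrC _ e).
split=> [[dv dE]|/P h].
  by apply/P; rewrite -dE; exact: dv.
apply: DeriveDef; first by apply/cvg_ex; exists l.
exact: (cvg_lim _ h).
Qed.

Lemma is_derive_continuous f (x l : R) : is_derive x 1 f l -> {for x, continuous f}.
Proof. by move=> h; apply/differentiable_continuous/derivable1_diffP; exact: ex_derive. Qed.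

Lemma is_derive_cst' (k x : R) : is_derive x 1 (fun=> k) 0.
Proof. exact: (is_derive_cst k x 1). Qed.

Lemma is_derive_id' (x : R) : is_derive x 1 (fun s : R => s) 1.
Proof. exact: (is_derive_id x 1). Qed.

Lemma is_deriveD' f g (x a b : R) : is_derive x 1 f a -> is_derive x 1 g b ->
  is_derive x 1 (fun s => f s + g s) (a + b).
Proof. by move=> fa gb; exact: (@is_deriveD _ _ _ f g x 1 a b). Qed.

Lemma is_deriveN' f (x a : R) : is_derive x 1 f a ->
  is_derive x 1 (fun s => - f s) (- a).
Proof. by move=> fa; exact: (@is_deriveN _ _ _ f x 1 a). Qed.

Lemma is_deriveB' f g (x a b : R) : is_derive x 1 f a -> is_derive x 1 g b ->
  is_derive x 1 (fun s => f s - g s) (a - b).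
Proof. by move=> fa gb; apply: is_deriveD' => //; exact: is_deriveN'. Qed.

Lemma is_deriveM' f g (x a b : R) : is_derive x 1 f a -> is_derive x 1 g b ->
  is_derive x 1 (fun s => f s * g s) (a * g x + f x * b).
Proof.
move=> fa gb; have := @is_deriveM _ _ f g x 1 a b fa gb.
by rewrite /GRing.scale/= addrC (mulrC (g x)).
Qed.

Lemma is_deriveZ' f (k x a : R) : is_derive x 1 f a ->
  is_derive x 1 (fun s => k * f s) (k * a).
Proof. by move=> fa; exact: (@is_deriveZ _ _ _ f k x 1 a). Qed.

Lemma is_derive_comp' f g (x a b : R) : is_derive (g x) 1 f a ->
  is_derive x 1 g b -> is_derive x 1 (fun s => f (g s)) (a * b).
Proof. by move=> fa gb; exact: (@is_derive1_comp _ f g x a b). Qed.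

Lemma is_derive_sum' (I : finType) (F : I -> R -> R) (dF : I -> R) (x : R) :
  (forall i, is_derive x 1 (F i) (dF i)) ->
  is_derive x 1 (fun s => \sum_i F i s) (\sum_i dF i).
Proof.
move=> h; elim: (index_enum I) => [|i s ih].
  rewrite big_nil; under eq_fun do rewrite big_nil; exact: is_derive_cst'.
rewrite big_cons; under eq_fun do rewrite big_cons; exact: is_deriveD'.
Qed.

(** Integration starts at -1 so that 0 is an interior point and the derivative there is
    two-sided. *)
Lemma continuous_antiderivative g : continuous g ->
  exists2 G : R -> R, G 0 = 0 & forall t : R, -1 < t -> is_derive t 1 G (g t).
Proof.
move=> cg.
pose F x := \int[@lebesgue_measure R]_(t in `[(-1 : R), x]) g t.
exists (fun t => F t - F 0) => [|t t1]; first exact: subrr.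
have [dF eF] : derivable F t 1 /\ F^`()%classic t = g t.
  apply: (@continuous_FTC1_closed R g (-1) t (t + 1)) => //.
  - by rewrite ltrDl.
  - apply: continuous_compact_integrable; first exact: segment_compact.
    by apply: continuous_subspaceT => x; exact: cg.
  - exact: cg.
apply/is_derive_ptP => e e0.
have /is_derive_ptP/(_ e e0)[d d0 hd] : is_derive t 1 F (g t).
  by apply: DeriveDef; [exact: dF|rewrite -derive1E; exact: eF].
exists d => // y /hd.
by have -> : F y - F 0 - (F t - F 0) - g t * (y - t) = F y - F t - g t * (y - t) by ring.
Qed.

Lemma le0_is_derive_nincr f (df : R -> R) (a b : R) : a <= b ->
  (forall x, a <= x <= b -> is_derive x 1 f (df x)) ->
  (forall x, a <= x <= b -> df x <= 0) -> f b <= f a.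
Proof.
move=> ab fd df0.
have [c cab] : exists2 c, c \in `[a, b]%R & f b - f a = df c * (b - a).
  apply: MVT_segment => //.
    move=> x; rewrite in_itv/= => /andP[/ltW ax /ltW xb]; by apply: fd; rewrite ax.
  apply: derivable_within_continuous => x; rewrite in_itv/= => xab.
  by have [] := fd _ xab.
rewrite -subr_le0 => ->; by rewrite mulr_le0_ge0 ?subr_ge0// df0.
Qed.

(** The barrier [B e^(L t)] gives estimates in an exponentially weighted norm, in which Picard
    iteration contracts on all of [[0, T]] at once. *)
Lemma exp_comparison (u du : R -> R) (T L B : R) : 0 <= B -> u 0 = 0 ->
  (forall t, 0 <= t <= T -> is_derive t 1 u (du t)) ->
  (forall t, 0 <= t <= T -> `|du t| <= B * L * expR (L * t)) ->
  forall t, 0 <= t <= T -> `|u t| <= B * expR (L * t).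
Proof.
move=> B0 u0 ud du_le t /andP[t0 tT].
have dE (x : R) : is_derive x 1 (fun s => B * expR (L * s)) (B * L * expR (L * x)).
  rewrite -mulrA; apply: is_deriveZ'.
  have -> : L * expR (L * x) = expR (L * x) * (L * 1) by rewrite mulr1 mulrC.
  apply: (@is_derive_comp' expR (fun s => L * s)).
have inT x : 0 <= x <= t -> 0 <= x <= T.
  by move=> /andP[-> xt]; rewrite (le_trans xt).
rewrite ler_norml; apply/andP; split.
  have : - u t - B * expR (L * t) <= - u 0 - B * expR (L * 0).
    apply: (@le0_is_derive_nincr (fun s => - u s - B * expR (L * s))
      (fun s => - du s - B * L * expR (L * s)) 0 t) => //.
      move=> x /inT xT; apply: is_deriveB' => //; apply: is_deriveN'; exact: ud.
    by move=> x /inT /du_le; rewrite ler_norml => /andP[h _]; rewrite lerBlDr add0r lerNl.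
  rewrite u0 mulr0 expR0; lra.
have : u t - B * expR (L * t) <= u 0 - B * expR (L * 0).
  apply: (@le0_is_derive_nincr (fun s => u s - B * expR (L * s))
      (fun s => du s - B * L * expR (L * s)) 0 t) => //.
    move=> x /inT xT; apply: is_deriveB' => //; exact: ud.
  by move=> x /inT /du_le; rewrite ler_norml subr_le0 => /andP[_ h].
rewrite u0 mulr0 expR0; lra.
Qed.

(** The increments from index [k] on sum to at most [2 C / 2^k]; the intervals of that radius around
    [x k] are nested, and the supremum of their left ends is the limit. *)
Lemma geometric_limit (x : nat -> R) (C : R) :
  (forall k, `|x k.+1 - x k| <= C * 2^-1 ^+ k) ->
  exists l, forall k, `|l - x k| <= 2 * C * 2^-1 ^+ k.
Proof.
move=> hx; pose q k := 2^-1 ^+ k : R.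
have qS k : q k.+1 = q k / 2 by rewrite /q exprSr.
have q0 k : 0 < q k by rewrite exprn_gt0// invr_gt0.
have C0 : 0 <= C by have := le_trans (normr_ge0 _) (hx 0%N); rewrite expr0 mulr1.
pose lo k := x k - 2 * C * q k; pose hi k := x k + 2 * C * q k.
have loS k : lo k <= lo k.+1.
  have := hx k; rewrite -/(q k) ler_norml => /andP[h _].
  by rewrite /lo qS; lra.
have hiS k : hi k.+1 <= hi k.
  have := hx k; rewrite -/(q k) ler_norml => /andP[_ h].
  by rewrite /hi qS; lra.
have lo_mono i j : (i <= j)%N -> lo i <= lo j.
  by move=> /subnK <-; elim: (j - i)%N => [|n ih] //; apply: le_trans ih (loS _).
have hi_mono i j : (i <= j)%N -> hi j <= hi i.
  by move=> /subnK <-; elim: (j - i)%N => [|n ih] //; apply: le_trans (hiS _) ih.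
have lohi i j : lo i <= hi j.
  have hk k : lo k <= hi k by rewrite /lo /hi lerBlDr -addrA lerDl addr_ge0// !mulr_ge0// ltW.
  have [ij|ji] := leqP i j; first exact: le_trans (lo_mono _ _ ij) (hk j).
  exact: le_trans (hk i) (hi_mono _ _ (ltnW ji)).
pose E := [set a | exists k, a = lo k].
have hE : has_sup E by split; [exists (lo 0%N), 0%N|exists (hi 0%N) => _ [k ->]].
exists (sup E) => k; rewrite ler_norml; apply/andP; split.
  have : lo k <= sup E by apply: sup_upper_bound => //; exists k.
  by rewrite /lo /q; lra.
have : sup E <= hi k by apply: ge_sup; [exists (lo 0%N), 0%N|move=> _ [j ->]].
by rewrite /hi /q; lra.
Qed.

Lemma half_pow_small (C e : R) : 0 < e -> exists k : nat, C * 2^-1 ^+ k <= e.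
Proof.
move=> e0.
have : (fun k : nat => C * 2^-1 ^+ k) @ \oo --> (C * 0 : R).
  apply: cvgM; first exact: cvg_cst.
  by apply: cvg_expr; rewrite ger0_norm ?invr_ge0// invf_lt1// ltr1n.
rewrite mulr0 => /cvgrPdist_le/(_ e e0)[k _ hk].
exists k; have := hk k (leqnn k); rewrite sub0r normrN; exact/le_trans/ler_norm.
Qed.

End calculus.

(** * Picard existence and Gronwall uniqueness for a globally Lipschitz field *)

Section ode.
Context {R : realType} (I : finType) (f : (I -> R) -> I -> R) (K T : R).
Hypothesis K0 : 0 <= K.
Hypothesis T0 : 0 < T.
Hypothesis fK : forall X Y i, `|f X i - f Y i| <= K * \sum_j `|X j - Y j|.

(** Retraction of the line onto [[0, T]]: continuity on the interval becomes continuity of the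
    composite on the whole line. *)
Definition clamp (t : R) : R := Num.max 0 (Num.min t T).

Lemma clamp_in t : 0 <= clamp t <= T.
Proof. by rewrite /clamp le_max lexx /= ge_max (ltW T0) ge_min lexx orbT. Qed.

Lemma clamp_id t : 0 <= t <= T -> clamp t = t.
Proof. by move=> /andP[t0 tT]; rewrite /clamp (min_idPl tT) (max_idPr t0). Qed.

Lemma clamp_lip s t : `|clamp s - clamp t| <= `|s - t|.
Proof.
have cl (u : R) : [\/ (0 <= u /\ u <= T) /\ clamp u = u, u < 0 /\ clamp u = 0 | T < u /\ clamp u = T].
  have [u0|u0] := ltP u 0.
    apply: Or32; split=> //; rewrite /clamp (min_idPl _); last exact/ltW/(lt_trans u0).
    by apply/max_idPl; exact: ltW.
  have [uT|uT] := leP u T; first by apply: Or31; split => //; rewrite clamp_id// u0.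
  by apply: Or33; split=> //; rewrite /clamp (min_idPr (ltW uT)); apply/max_idPr; exact: ltW.
have h s' t' : clamp s' - clamp t' <= `|s' - t'|.
  have := ler_norm (s' - t'); have := normr_ge0 (s' - t').
  set d : R := `|s' - t'|; move: d => d d0 hd; have T0' := T0.
  case: (cl s') => [[[? ?] ->]|[? ->]|[? ->]];
    case: (cl t') => [[[? ?] ->]|[? ->]|[? ->]]; lra.
by rewrite ler_norml h lerNl opprB distrC h.
Qed.

Lemma continuous_comp_clamp (Y : R -> R) :
  (forall t : R, 0 <= t <= T -> {for t, continuous Y}) ->
  continuous (fun s => Y (clamp s)).
Proof.
move=> cY t; apply/continuous_ptP => e e0.
have /continuous_ptP/(_ e e0)[d d0 hd] := cY _ (clamp_in t).
by exists d => // y yt; apply: hd; exact: le_lt_trans (clamp_lip _ _) yt.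
Qed.

Lemma continuous_lip_field (Y : R -> I -> R) i :
  (forall j, continuous (fun s => Y s j)) -> continuous (fun s => f (Y s) i).
Proof.
move=> cY t; apply/continuous_ptP => e e0.
pose q := e / (K * #|I|%:R + 1).
have q0 : 0 < q by rewrite divr_gt0// ltr_wpDl// mulr_ge0.
have hj j : exists d, 0 < d /\ forall y, `|y - t| < d -> `|Y y j - Y t j| <= q.
  by have /continuous_ptP/(_ q q0)[d d0 hd] := cY j t; exists d.
have [dl hdl] := choice hj.
exists (\big[Num.min/1]_j dl j).
  by elim/big_ind: _ => // [a b a0 b0|j _]; [rewrite lt_min a0|have [] := hdl j].
move=> y yt; apply: le_trans (fK _ _ _) _.
have hs : \sum_j `|Y y j - Y t j| <= q *+ #|I|.
  rewrite -sumr_const; apply: ler_sum => j _; have [_ h] := hdl j; apply: h.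
  by apply: lt_le_trans yt _; rewrite (bigD1 j)//= ge_min lexx.
apply: le_trans (ler_wpM2l K0 hs) _.
rewrite -mulr_natr /q mulrA.
have -> : K * (e / (K * #|I|%:R + 1)) * #|I|%:R =
   e * (K * #|I|%:R / (K * #|I|%:R + 1)) by ring.
rewrite ler_piMr ?(ltW e0)// ler_pdivrMr ?mul1r ?lerDl//.
by rewrite ltr_wpDl// mulr_ge0.
Qed.

(** Since [K |I| <= L / 2], Picard iteration contracts by 1/2 in the norm weighted by [e^(- L t)];
    the [+ 1] gives [1 <= L], used for the first iterate. *)
Let L : R := 2 * K * #|I|%:R + 1.
Let L1 : 1 <= L. Proof. by rewrite /L lerDr !mulr_ge0. Qed.
Let expL_ge1 t : 0 <= t -> 1 <= expR (L * t).
Proof. by move=> t0; rewrite -expR0 ler_expR mulr_ge0// (le_trans _ L1). Qed.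

(** The field is frozen outside [[0, T]], so the new iterate is differentiable on both sides of each
    end point. *)
Lemma picard_step (x0 : I -> R) (Y : R -> I -> R) :
  (forall i, continuous (fun s => Y (clamp s) i)) ->
  exists Y' : R -> I -> R, [/\ forall i, Y' 0 i = x0 i,
    forall i (t : R), -1 < t -> is_derive t 1 (Y' ^~ i) (f (Y (clamp t)) i) &
    forall i, continuous (fun s => Y' (clamp s) i)].
Proof.
move=> cY.
have hi i : exists G : R -> R, G 0 = 0 /\
    forall t : R, -1 < t -> is_derive t 1 G (f (Y (clamp t)) i).
  have [G G0 hG] := continuous_antiderivative (@continuous_lip_field
    (fun s => Y (clamp s)) i cY).
  by exists G.
have [G hG] := choice hi.
have hd i (t : R) : -1 < t ->
    is_derive t 1 (fun s => x0 i + G i s) (f (Y (clamp t)) i).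
  move=> t1; rewrite -[f _ _]add0r; have [_ /(_ t t1) hGi] := hG i.
  exact: (is_deriveD' (is_derive_cst' (x0 i) t) hGi).
exists (fun t i => x0 i + G i t); split => //.
  by move=> i; have [-> _] := hG i; rewrite addr0.
move=> i; apply: (@continuous_comp_clamp (fun s => x0 i + G i s)) => t /andP[t0 _].
by apply: is_derive_continuous; apply: hd; apply: lt_le_trans t0.
Qed.

(** The iterates converge geometrically in the weighted norm, and the limit is then recognised as
    its own Picard image. *)
Lemma picard (x0 : I -> R) : exists X : R -> I -> R,
  (forall i, X 0 i = x0 i) /\
  forall i (t : R), 0 <= t <= T -> is_derive t 1 (X ^~ i) (f (X t) i).
Proof.
pose st (Y Y' : R -> I -> R) := (forall i, continuous (fun s => Y (clamp s) i)) ->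
  [/\ forall i, Y' 0 i = x0 i,
    forall i (t : R), -1 < t -> is_derive t 1 (Y' ^~ i) (f (Y (clamp t)) i) &
    forall i, continuous (fun s => Y' (clamp s) i)].
have exst Y : exists Y', st Y Y'.
  have [cY|nY] := pselect (forall i, continuous (fun s => Y (clamp s) i)).
    by have [Y' hY'] := picard_step x0 cY; exists Y'.
  by exists Y => /nY.
have [step hstep] := choice exst.
pose X k := iter k step (fun _ => x0).
have cX k i : continuous (fun s => X k (clamp s) i).
  elim: k i => [|k ih] i; first by move=> t; exact: cvg_cst.
  by have [_ _ h] := hstep _ ih; exact: h.
have X0 k i : X k 0 i = x0 i.
  by case: k => // k; have [h _ _] := hstep _ (cX k); exact: h.
have dX k i (t : R) : 0 <= t <= T -> is_derive t 1 (X k.+1 ^~ i) (f (X k t) i).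
  move=> tT; have [_ h _] := hstep _ (cX k).
  rewrite -{2}(clamp_id tT); apply: h; move/andP: tT => [t0 _].
  by apply: lt_le_trans t0.
pose A := \sum_i `|f x0 i|.
have A0 : 0 <= A by apply: sumr_ge0.
have bound k i t : 0 <= t <= T ->
    `|X k.+1 t i - X k t i| <= A * 2^-1 ^+ k * expR (L * t).
  elim: k i t => [|k ih] i.
    apply: (@exp_comparison _ (fun t => X 1%N t i - X 0%N t i)
      (fun t => f (X 0%N t) i - 0) T L (A * 2^-1 ^+ 0)) => //.
    - by rewrite expr0 mulr1.
    - by rewrite !X0 subrr.
    - by move=> t tT; exact: (is_deriveB' (dX 0%N i t tT) (is_derive_cst' _ _)).
    move=> t /andP[t0 tT]; rewrite subr0 expr0 mulr1.
    apply: (@le_trans _ _ A).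
      by rewrite /A (bigD1 i)//= lerDl sumr_ge0.
    rewrite -mulrA ler_peMr// -[leLHS]mulr1 ler_pM// expL_ge1//.
  apply: (@exp_comparison _ (fun t => X k.+2 t i - X k.+1 t i)
    (fun t => f (X k.+1 t) i - f (X k t) i) T L (A * 2^-1 ^+ k.+1)) => //.
  - by rewrite mulr_ge0// exprn_ge0// invr_ge0.
  - by rewrite !X0 subrr.
  - by move=> t tT; exact: (is_deriveB' (dX _ i t tT) (dX _ i t tT)).
  move=> t tT; apply: le_trans (fK _ _ _) _.
  have : \sum_j `|X k.+1 t j - X k t j| <= (A * 2^-1 ^+ k * expR (L * t)) *+ #|I|.
    by rewrite -sumr_const; apply: ler_sum => j _; exact: ih.
  move/(ler_wpM2l K0)/le_trans; apply.
  rewrite -mulr_natr exprS.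
  have E0 : 0 <= A * 2^-1 ^+ k * expR (L * t).
    by rewrite !mulr_ge0// ?expR_ge0// exprn_ge0// invr_ge0.
  move: E0; set E := A * 2^-1 ^+ k * expR (L * t) => E0.
  have -> : A * (2^-1 * 2^-1 ^+ k) * L * expR (L * t) = L / 2 * E.
    by rewrite /E; ring.
  have -> : K * (E * #|I|%:R) = (K * #|I|%:R) * E by ring.
  by apply: ler_wpM2r => //; rewrite /L; lra.
have lim t i : exists l, 0 <= t <= T ->
    forall k, `|l - X k t i| <= 2 * (A * expR (L * t)) * 2^-1 ^+ k.
  have [tT|nT] := boolP (0 <= t <= T); last by exists 0.
  have [k|l hl] := @geometric_limit _ (fun k => X k t i) (A * expR (L * t)).
    by have := bound k i t tT; rewrite mulrAC.
  by exists l.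
have [Z hZ] : exists Z : R -> I -> R, forall t i, 0 <= t <= T ->
    forall k, `|Z t i - X k t i| <= 2 * (A * expR (L * t)) * 2^-1 ^+ k.
  have h t : exists z : I -> R, forall i, 0 <= t <= T ->
      forall k, `|z i - X k t i| <= 2 * (A * expR (L * t)) * 2^-1 ^+ k.
    by have [z hz] := choice (lim t); exists z.
  by have [Z hZ] := choice h; exists Z.
pose C := 2 * (A * expR (L * T)).
have C0 : 0 <= C by rewrite !mulr_ge0// expR_ge0.
have hZC t i k : 0 <= t <= T -> `|Z t i - X k t i| <= C * 2^-1 ^+ k.
  move=> tT; apply: le_trans (hZ t i tT k) _.
  rewrite ler_wpM2r ?exprn_ge0 ?invr_ge0// !ler_wpM2l// ler_expR ler_wpM2l//.
    by apply: le_trans L1.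
  by move/andP: tT => [].
have cZ i : continuous (fun s => Z (clamp s) i).
  move=> t; apply/continuous_ptP => e e0.
  have e3 : 0 < e / 3 by rewrite divr_gt0.
  have [k hk] := half_pow_small C e3.
  have /continuous_ptP/(_ _ e3)[d d0 hd] := cX k i t.
  exists d => // y /hd h.
  have h1 := le_trans (hZC _ i k (clamp_in y)) hk.
  have h2 := le_trans (hZC _ i k (clamp_in t)) hk.
  move: h h1 h2; rewrite !ler_norml => /andP[? ?] /andP[? ?] /andP[? ?].
  by apply/andP; split; lra.
(* [Z] is only a uniform limit; differentiability comes from one more integration [Y], which stays
   close to the iterates and so equals [Z] on [[0, T]]. *)
have [Y0 dY _] := hstep _ cZ; set Y := step Z in Y0 dY.
have YX i t k : 0 <= t <= T -> `|Y t i - X k.+1 t i| <= C * 2^-1 ^+ k * expR (L * t).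
  move: t; apply: (@exp_comparison _ (fun t => Y t i - X k.+1 t i)
    (fun t => f (Z t) i - f (X k t) i) T L (C * 2^-1 ^+ k)) => //.
  - by rewrite mulr_ge0// exprn_ge0// invr_ge0.
  - by rewrite Y0 X0 subrr.
  - move=> t tT; apply: (is_deriveB' _ (dX _ i t tT)).
    rewrite -{2}(clamp_id tT); apply: dY; move/andP: tT => [t0 _].
    by apply: lt_le_trans t0.
  move=> t tT; apply: le_trans (fK _ _ _) _.
  have : \sum_j `|Z t j - X k t j| <= (C * 2^-1 ^+ k) *+ #|I|.
    by rewrite -sumr_const; apply: ler_sum => j _; exact: hZC.
  move/(ler_wpM2l K0)/le_trans; apply.
  have E0 : 0 <= C * 2^-1 ^+ k by rewrite !mulr_ge0// exprn_ge0// invr_ge0.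
  move: E0; set E := C * 2^-1 ^+ k => E0.
  rewrite -mulr_natr.
  have -> : K * (E * #|I|%:R) = E * (K * #|I|%:R) by ring.
  rewrite -mulrA; apply: ler_wpM2l => //.
  have e1 := expL_ge1 (proj1 (andP tT)).
  apply: (@le_trans _ _ L); last by rewrite ler_peMr// (le_trans _ L1).
  by rewrite /L; have := mulr_ge0 K0 (ler0n R #|I|); lra.
have ZY i t : 0 <= t <= T -> Z t i = Y t i.
  move=> tT; apply/eqP; rewrite -subr_eq0 -normr_eq0 eq_le normr_ge0 andbT.
  apply/ler_addgt0Pr => e e0; rewrite add0r.
  pose B := C + C * expR (L * t).
  have [k hk] := half_pow_small B e0.
  apply: le_trans hk.
  have h1 := hZC t i k.+1 tT; have h2 := YX i t k tT.
  apply: le_trans (ler_distD (X k.+1 t i) _ _) _.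
  rewrite /B mulrDl; apply: lerD.
    apply: le_trans h1 _; rewrite ler_wpM2l// exprS ler_piMl ?exprn_ge0 ?invr_ge0//.
    by rewrite invf_le1// ler1n.
  by rewrite distrC mulrAC; exact: h2.
exists Y; split => // i t tT.
have -> : Y t = Z t by apply/funext => j; rewrite ZY.
rewrite -{2}(clamp_id tT); apply: dY; move/andP: tT => [t0 _].
by apply: lt_le_trans t0.
Qed.

(** The squared distance [D], differentiable unlike the distance itself, satisfies [D' <= c D], so
    [D e^(- c s)] decreases from 0. *)
Lemma ode_uniqueness (X Y : R -> I -> R) :
  (forall i, X 0 i = Y 0 i) ->
  (forall i (t : R), 0 <= t <= T -> is_derive t 1 (X ^~ i) (f (X t) i)) ->
  (forall i (t : R), 0 <= t <= T -> is_derive t 1 (Y ^~ i) (f (Y t) i)) ->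
  forall i t, 0 <= t <= T -> X t i = Y t i.
Proof.
move=> XY0 dX dY i t /andP[t0 tT].
pose D s := \sum_j (X s j - Y s j) * (X s j - Y s j).
pose dD s := \sum_j ((f (X s) j - f (Y s) j) * (X s j - Y s j) +
   (X s j - Y s j) * (f (X s) j - f (Y s) j)).
pose n : R := #|I|%:R.
pose c := 2 * K * n.
have D0 s : 0 <= D s by apply: sumr_ge0 => j _; rewrite -expr2 sqr_ge0.
have dDP (s : R) : 0 <= s <= T -> is_derive s 1 D (dD s).
  move=> sT; apply: is_derive_sum' => j.
  have h := is_deriveB' (dX j s sT) (dY j s sT).
  exact: (is_deriveM' h h).
(* Cauchy-Schwarz, through [|a_j| |a_k| <= (a_j^2 + a_k^2) / 2] summed over all pairs. *)
have csz (a : I -> R) : (\sum_j `|a j|) ^+ 2 <= n * \sum_j (a j * a j).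
  rewrite expr2 mulr_suml.
  have -> : n * \sum_j (a j * a j) = \sum_j \sum_k (a j * a j + a k * a k) / 2.
    rewrite [RHS](eq_bigr (fun j => n * (a j * a j) / 2 + (\sum_k a k * a k) / 2)).
      rewrite big_split/= sumr_const -mulr_natr -mulr_suml -mulr_sumr -/n; by field.
    move=> j _; rewrite -mulr_suml big_split/= sumr_const -mulr_natl -/n; by ring.
  apply: ler_sum => j _; rewrite mulr_sumr; apply: ler_sum => k _.
  have := sqr_ge0 (`|a j| - `|a k|).
  have := real_normK (num_real (a j)); have := real_normK (num_real (a k)).
  rewrite !expr2 => <- <-; lra.
have dDle s : 0 <= s <= T -> dD s <= c * D s.
  move=> sT; pose S := \sum_j `|X s j - Y s j|.
  have S0 : 0 <= S by apply: sumr_ge0.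
  apply: (@le_trans _ _ (\sum_j 2 * (K * S) * `|X s j - Y s j|)).
    apply: ler_sum => j _; rewrite [X in _ + X]mulrC -mulr2n.
    have h := fK (X s) (Y s) j.
    apply: le_trans (ler_norm _) _; rewrite normrMn normrM -mulrA mulr_natl.
    by rewrite lerMn2r /= ler_wpM2r.
  rewrite -mulr_sumr -/S.
  have -> : 2 * (K * S) * S = 2 * K * S ^+ 2 by ring.
  rewrite /c -!mulrA ler_wpM2l// ler_wpM2l//; exact: csz.
pose E s := D s * expR (- c * s).
have dE (s : R) : 0 <= s <= T ->
    is_derive s 1 E (dD s * expR (- c * s) + D s * (expR (- c * s) * (- c * 1))).
  move=> sT; apply: (is_deriveM' (dDP s sT)).
have : E t <= E 0.
  apply: (le0_is_derive_nincr t0 (df := fun s => dD s * expR (- c * s) +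
     D s * (expR (- c * s) * (- c * 1)))) => s /andP[s0 st].
    by apply: dE; rewrite s0 (le_trans st).
  have sT : 0 <= s <= T by rewrite s0 (le_trans st).
  have := dDle _ sT; have := expR_gt0 (- c * s).
  move: (expR _) (dD s) (D s) => e a b e0 ab.
  have -> : a * e + b * (e * (- c * 1)) = (a - c * b) * e by ring.
  by rewrite mulr_le0_ge0 ?(ltW e0)// subr_le0.
rewrite /E {2}/D big1 ?mul0r; last by move=> j _; rewrite XY0 subrr mul0r.
rewrite pmulr_lle0 ?expR_gt0// => Dt.
have Dt0 : D t = 0 by apply/eqP; rewrite eq_le Dt D0.
apply/eqP; rewrite -subr_eq0 -[_ == 0]orbb -mulf_eq0.
move: Dt0 => /eqP; rewrite psumr_eq0; last by move=> j _; rewrite -expr2 sqr_ge0.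
by move=> /allP/(_ i (mem_index_enum i)).
Qed.
End ode.

(** * Smooth functions of one variable and a smooth step *)

Section smooth.
Context {R : realType}.
Implicit Types (f g : R -> R).

Lemma derive1_is f (x l : R) : is_derive x 1 f l -> f^`()%classic x = l.
Proof. by move=> [_ <-]; rewrite derive1E. Qed.

Lemma is_derive_derive1 f (x : R) : derivable f x 1 -> is_derive x 1 f (f^`()%classic x).
Proof. by move=> df; apply: DeriveDef; [exact: df|rewrite derive1E]. Qed.

Fixpoint Cn n f : Prop :=
  if n is n'.+1 then (forall x : R, derivable f x 1) /\ Cn n' (f^`()%classic)
  else continuous f.

Definition smooth f := forall n, Cn n f.

Lemma CnS_is n f g : (forall x : R, is_derive x 1 f (g x)) -> Cn n g -> Cn n.+1 f.
Proof.
move=> fg cg; split; first by move=> x; have [] := fg x.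
by have -> : f^`()%classic = g by apply/funext => x; exact: derive1_is.
Qed.

Lemma Cn_pred n f : Cn n.+1 f -> Cn n f.
Proof.
elim: n f => [|n ih] f /= [df cf].
  by move=> x; apply: is_derive_continuous (is_derive_derive1 (df x)).
by split => //; exact: ih.
Qed.

Lemma Cn_is_derive n f (x : R) : Cn n.+1 f -> is_derive x 1 f (f^`()%classic x).
Proof. by move=> [df _]; exact: is_derive_derive1. Qed.

Lemma Cn_cst n (k : R) : Cn n (fun=> k).
Proof.
elim: n k => [|n ih] k; first by move=> x; exact: cvg_cst.
exact: (CnS_is (g := fun=> 0) (is_derive_cst' k) (ih 0)).
Qed.

Lemma Cn_id n : Cn n (fun x => x).
Proof.
case: n => [|n]; first by move=> x; exact: cvg_id.
exact: (CnS_is (g := fun=> 1) is_derive_id' (Cn_cst n 1)).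
Qed.

Lemma CnD n f g : Cn n f -> Cn n g -> Cn n (fun x => f x + g x).
Proof.
elim: n f g => [|n ih] f g cf cg; first by move=> x; apply: cvgD; [exact: cf|exact: cg].
apply: (CnS_is (g := fun x => f^`()%classic x + g^`()%classic x)).
  by move=> x; exact: (is_deriveD' (Cn_is_derive x cf) (Cn_is_derive x cg)).
by apply: ih; [case: cf|case: cg].
Qed.

Lemma CnM n f g : Cn n f -> Cn n g -> Cn n (fun x => f x * g x).
Proof.
elim: n f g => [|n ih] f g cf cg; first by move=> x; apply: cvgM; [exact: cf|exact: cg].
apply: (CnS_is (g := fun x => f^`()%classic x * g x + f x * g^`()%classic x)).
  by move=> x; exact: (is_deriveM' (Cn_is_derive x cf) (Cn_is_derive x cg)).
apply: CnD; apply: ih; try exact: Cn_pred.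
  by case: cf.
by case: cg.
Qed.

Lemma Cn_affine n f (a b : R) : Cn n f -> Cn n (fun x => f (a * x + b)).
Proof.
elim: n f => [|n ih] f cf.
  move=> x; apply: (@continuous_comp _ _ _ (fun x => a * x + b) f); last exact: cf.
  by apply: cvgD; [apply: cvgM; [exact: cvg_cst|exact: cvg_id]|exact: cvg_cst].
apply: (CnS_is (g := fun x => f^`()%classic (a * x + b) * a)).
  move=> x; apply: (@is_derive_comp' _ f (fun x => a * x + b)); first exact: Cn_is_derive cf.
  rewrite -{2}[a]mulr1 -[_ * 1]addr0.
  exact: (is_deriveD' (is_deriveZ' a (is_derive_id' x)) (is_derive_cst' b x)).
by apply: CnM; [apply: ih; case: cf|exact: Cn_cst].
Qed.

Lemma CnV n f : (forall x, f x != 0) -> Cn n f -> Cn n (fun x => (f x)^-1).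
Proof.
move=> f0; elim: n => [|n ih] cf.
  by move=> x; apply: cvgV; [exact: f0|exact: cf].
have iV := ih (Cn_pred cf).
apply: (CnS_is (g := fun x => (-1 * ((f x)^-1 * (f x)^-1)) * f^`()%classic x)).
  move=> x; have := @is_deriveV _ f x _ 1 (f0 x) (Cn_is_derive x cf).
  have -> : - f x ^- 2 *: f^`()%classic x = -1 * ((f x)^-1 * (f x)^-1) * f^`()%classic x.
    by rewrite /GRing.scale/= -exprVn expr2 mulN1r.
  by [].
apply: CnM; last by case: cf.
by apply: CnM; [exact: Cn_cst|exact: CnM].
Qed.

Lemma is_derive_pow (k : nat) (x : R) :
  is_derive x 1 (fun y => y ^+ k) (k%:R * x ^+ k.-1).
Proof.
elim: k => [|k ih].
  rewrite mul0r; under eq_fun do rewrite expr0; exact: is_derive_cst'.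
under eq_fun do rewrite exprS.
have -> : k.+1%:R * x ^+ k.+1.-1 = 1 * x ^+ k + x * (k%:R * x ^+ k.-1).
  by case: k {ih} => [|k]; rewrite /= ?expr0 ?expr1 ?exprS -?natr1; ring.
exact: (is_deriveM' (is_derive_id' x) ih).
Qed.

Lemma is_derive_near f g (x l d : R) : 0 < d ->
  (forall y, `|y - x| < d -> f y = g y) -> is_derive x 1 g l -> is_derive x 1 f l.
Proof.
move=> d0 fg /is_derive_ptP h; apply/is_derive_ptP => e /h[d' d'0 hd'].
exists (Num.min d d') => [|y]; first by rewrite lt_min d0.
rewrite lt_min => /andP[yd yd']; rewrite !fg//; first exact: hd'.
by rewrite subrr normr0.
Qed.

(** The functions [x^(-k) e^(-1/x)] are treated together because differentiation maps each to a
    combination of later ones; smoothness at 0 is then one induction for all [k]. *)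
Definition flat (k : nat) (x : R) : R :=
  if 0 < x then (x^-1) ^+ k * expR (- x^-1) else 0.

(** From [e^y >= y^(k+2) / (k+2)!] at [y = 1/x]. The order 2 in [x] is what makes the derivative at
    0 vanish. *)
Lemma flat_le (k : nat) (x : R) : `|flat k x| <= (k.+2)`!%:R * x ^+ 2.
Proof.
rewrite /flat; case: ltP => x0; last by rewrite normr0 mulr_ge0// sqr_ge0.
have v0 : 0 < x^-1 by rewrite invr_gt0.
rewrite ger0_norm; last by rewrite mulr_ge0 ?expR_ge0// exprn_ge0// ltW.
have := expR_ge1Dxn k.+1 (ltW v0).
set F : R := (k.+2)`!%:R => h.
have F0 : 0 < F by rewrite ltr0n fact_gt0.
have hE : x^-1 ^+ k.+2 <= F * expR (x^-1).
  rewrite mulrC -ler_pdivrMr//; apply: le_trans h; by rewrite lerDr.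
rewrite expRN ler_pdivrMr ?expR_gt0//.
have -> : x^-1 ^+ k = x ^+ 2 * x^-1 ^+ k.+2.
  rewrite !exprS expr0 mulr1.
  have x1 : x != 0 by rewrite gt_eqF.
  have -> : x * x * (x^-1 * (x^-1 * x^-1 ^+ k)) = (x / x) * (x / x) * x^-1 ^+ k by ring.
  by rewrite divff// !mul1r.
have -> : F * x ^+ 2 * expR x^-1 = x ^+ 2 * (F * expR x^-1) by ring.
by rewrite ler_wpM2l ?sqr_ge0.
Qed.

Lemma is_derive_flat (k : nat) (x : R) :
  is_derive x 1 (flat k) (flat k.+2 x - k%:R * flat k.+1 x).
Proof.
have [x0|x0|x0] := ltgtP x 0.
- have -> : flat k.+2 x - k%:R * flat k.+1 x = 0.
    by rewrite /flat ltNge (ltW x0) /= mulr0 subr0.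
  apply: (is_derive_near (g := fun=> 0) (d := - x) _ _ (is_derive_cst' 0 x)).
    by rewrite oppr_gt0.
  move=> y; rewrite ltr_norml => /andP[_ yx]; rewrite /flat.
  by case: ltP => //; lra.
- apply: (@is_derive_near _ (fun y => (y^-1) ^+ k * expR (- y^-1)) _ _ x x0).
    move=> y; rewrite ltr_norml => /andP[yx _]; rewrite /flat.
    by case: ltP => //; lra.
  have dV : is_derive x 1 (fun y => y^-1) (- (x^-1 * x^-1)).
    have xn : (fun y : R => y) x != 0 by rewrite gt_eqF.
    have := @is_deriveV _ (fun y => y) x 1 1 xn (is_derive_id' x).
    by rewrite /GRing.scale/= mulr1 -exprVn expr2.
  have dp := is_derive_comp' (is_derive_pow k x^-1) dV.
  have dn := is_deriveN' dV.
  have de := @is_derive_comp' _ expR (fun y => - y^-1) _ _ _ (is_derive_expR (- x^-1)) dn.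
  have := is_deriveM' dp de.
  set l := (X in is_derive _ _ _ X -> _) => hl.
  suff -> : flat k.+2 x - k%:R * flat k.+1 x = l by [].
  rewrite /l /flat x0; move: (expR (- x^-1)) => E; clear l hl dp de.
  case: k => [|k]; rewrite /= ?expr0 !exprS; ring.
- rewrite x0; have -> : flat k.+2 0 - k%:R * flat k.+1 0 = 0.
    by rewrite /flat ltxx mulr0 subr0.
  apply/is_derive_ptP => e e0.
  set F : R := (k.+2)`!%:R.
  have F0 : 0 < F by rewrite ltr0n fact_gt0.
  exists (e / F); first by rewrite divr_gt0.
  move=> y; rewrite subr0 mul0r subr0 {2}/flat ltxx subr0 => yd.
  apply: le_trans (flat_le k y) _; rewrite -/F -[y ^+ 2]real_normK ?num_real//.
  rewrite expr2 mulrA ler_wpM2r// mulrC -ler_pdivlMr//; exact: ltW.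
Qed.

Lemma Cn_flat n k : Cn n (flat k).
Proof.
elim: n k => [|n ih] k.
  by move=> x; exact: is_derive_continuous (is_derive_flat k x).
apply: (CnS_is (g := fun x => flat k.+2 x + (- k%:R) * flat k.+1 x)).
  by move=> x; rewrite mulNr; exact: is_derive_flat.
by apply: CnD => //; apply: CnM => //; exact: Cn_cst.
Qed.

Definition sstep (x : R) : R := flat 0 x / (flat 0 x + flat 0 (1 - x)).

Lemma flat_ge0 k x : 0 <= flat k x.
Proof.
rewrite /flat; case: ltP => // x0; rewrite mulr_ge0 ?expR_ge0// exprn_ge0//.
by rewrite invr_ge0 ltW.
Qed.

Lemma flat_gt0 k x : 0 < x -> 0 < flat k x.
Proof. by move=> x0; rewrite /flat x0 mulr_gt0 ?expR_gt0// exprn_gt0// invr_gt0. Qed.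

Lemma sstep_den x : 0 < flat 0 x + flat 0 (1 - x).
Proof.
have [x0|x0] := ltP 0 x; first by rewrite ltr_pwDl ?flat_ge0// flat_gt0.
by rewrite ltr_wpDl ?flat_ge0// flat_gt0//; lra.
Qed.

Lemma smooth_sstep : smooth sstep.
Proof.
move=> n; apply: CnM; first exact: Cn_flat.
apply: CnV => [x|]; first by rewrite gt_eqF// sstep_den.
apply: CnD; first exact: Cn_flat.
have := Cn_affine (-1) 1 (Cn_flat n 0).
by under eq_fun do rewrite mulN1r addrC.
Qed.

Lemma sstep_le0 x : x <= 0 -> sstep x = 0.
Proof. by move=> x0; rewrite /sstep {1}/flat ltNge x0 mul0r. Qed.

Lemma sstep_ge1 x : 1 <= x -> sstep x = 1.
Proof.
move=> x1; rewrite /sstep; have -> : flat 0 (1 - x) = 0.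
  by rewrite /flat ltNge; case: leP => //; lra.
by rewrite addr0 divff// gt_eqF// flat_gt0// (lt_le_trans _ x1).
Qed.

Lemma sstep_ge0 x : 0 <= sstep x.
Proof. by rewrite /sstep divr_ge0 ?flat_ge0// ltW// sstep_den. Qed.

Lemma sstep_le1 x : sstep x <= 1.
Proof. by rewrite /sstep ler_pdivrMr ?sstep_den// mul1r lerDl flat_ge0. Qed.

Lemma smooth_is_derive f (x : R) : smooth f -> is_derive x 1 f (f^`()%classic x).
Proof. by move=> sf; exact: Cn_is_derive (sf 1%N). Qed.

Lemma smooth_derive f : smooth f -> smooth (f^`()%classic).
Proof. by move=> sf n; have [] := sf n.+1. Qed.

Lemma smooth_continuous f : smooth f -> continuous f.
Proof. by move=> sf; exact: sf 0%N. Qed.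

Lemma derive1_locally_cst f (k x d : R) : 0 < d ->
  (forall y, `|y - x| < d -> f y = k) -> f^`()%classic x = 0.
Proof.
move=> d0 h; apply: derive1_is.
exact: (is_derive_near d0 h (is_derive_cst' k x)).
Qed.

Lemma dsstep_le0 x : x < 0 -> sstep^`()%classic x = 0.
Proof.
move=> x0; apply: (@derive1_locally_cst _ 0 x (- x)); first by rewrite oppr_gt0.
move=> y; rewrite ltr_norml => /andP[_ yx]; apply: sstep_le0; lra.
Qed.

Lemma dsstep_ge1 x : 1 < x -> sstep^`()%classic x = 0.
Proof.
move=> x1; apply: (@derive1_locally_cst _ 1 x (x - 1)); first lra.
move=> y; rewrite ltr_norml => /andP[xy _]; apply: sstep_ge1; lra.
Qed.

Lemma dsstep_bound : exists2 K : R, 0 < K & forall x, `|sstep^`()%classic x| <= K.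
Proof.
have cd := smooth_continuous (smooth_derive smooth_sstep).
have cd' : {within `[(0 : R), 1], continuous (fun x => `|sstep^`()%classic x|)}.
  apply: continuous_subspaceT => x; apply: continuous_comp; first exact: cd.
  exact: norm_continuous.
have [c _ hc] := EVT_max ler01 cd'.
exists (`|sstep^`()%classic c| + 1) => [|x]; first by rewrite ltr_wpDl.
have [x0|x0] := ltP x 0; first by rewrite dsstep_le0// normr0 addr_ge0.
have [x1|x1] := ltP 1 x; first by rewrite dsstep_ge1// normr0 addr_ge0.
apply: le_trans (hc x _) _; first by rewrite in_itv/= x0.
by rewrite lerDl.
Qed.

End smooth.

(** * Tensor-product test functions and the chain rule along a trajectory *)

Section test_functions.
Context {R : realType}.

Definition tens (A : 'I_4 -> R -> R) (p : 'rV[R]_4) : R := \prod_(j < 4) A j (p 0 j).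

Lemma updE (p : 'rV[R]_4) k s j : upd p k s 0 j = if j == k then s else p 0 j.
Proof. by rewrite /upd mxE. Qed.

Lemma upd_id (p : 'rV[R]_4) k : upd p k (p 0 k) = p.
Proof. by apply/rowP => j; rewrite updE; case: eqP => [->|]. Qed.

Lemma upd_upd (p : 'rV[R]_4) k s s' : upd (upd p k s) k s' = upd p k s'.
Proof. by apply/rowP => j; rewrite !updE; case: eqP. Qed.

Lemma continuous_tens (A : 'I_4 -> R -> R) : (forall j, continuous (A j)) -> continuous (tens A).
Proof.
move=> cA; rewrite /tens.
elim: (index_enum _) => [|j s ih] p.
  have -> : (fun p0 : 'rV[R]_4 => \prod_(j <- [::]) A j (p0 0 j)) = fun=> 1.
    by apply/funext => ?; rewrite big_nil.
  exact: cst_continuous.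
have -> : (fun p0 : 'rV[R]_4 => \prod_(j0 <- j :: s) A j0 (p0 0 j0)) =
    fun p0 => A j (p0 0 j) * \prod_(j0 <- s) A j0 (p0 0 j0).
  by apply/funext => ?; rewrite big_cons.
have h1 : {for p, continuous (fun p0 : 'rV[R]_4 => A j (p0 0 j))}.
  apply: (@continuous_comp _ _ _ (fun p : 'rV[R]_4 => p 0 j) (A j)); last exact: cA.
  exact: coord_continuous.
exact: continuousM h1 (ih p).
Qed.

Lemma tens_upd A p k s :
  tens A (upd p k s) = A k s * \prod_(j < 4 | j != k) A j (p 0 j).
Proof.
rewrite /tens (bigD1 k)//= updE eqxx; congr (_ * _).
by apply: eq_bigr => j jk; rewrite updE (negbTE jk).
Qed.

Lemma is_derive_tens (A : 'I_4 -> R -> R) (p : 'rV[R]_4) k : (forall j, smooth (A j)) ->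
  is_derive (p 0 k) 1 (fun s => tens A (upd p k s))
    (tens (fun j => if j == k then (A j)^`()%classic else A j) p).
Proof.
move=> sA; under eq_fun do rewrite tens_upd.
have -> : tens (fun j => if j == k then (A j)^`()%classic else A j) p =
    (A k)^`()%classic (p 0 k) * \prod_(j < 4 | j != k) A j (p 0 j).
  rewrite /tens (bigD1 k)//= eqxx; congr (_ * _).
  by apply: eq_bigr => j /negbTE ->.
have := is_deriveM' (smooth_is_derive (p 0 k) (sA k))
  (is_derive_cst' (\prod_(j < 4 | j != k) A j (p 0 j)) (p 0 k)).
by rewrite mulr0 addr0.
Qed.

(** A partial derivative of a tensor product is a tensor product with one factor differentiated, so
    iterated partials stay in the family. *)
Lemma smooth4_tens A : (forall j, smooth (A j)) -> smooth4 (tens A).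
Proof.
move=> sA ks.
have [A' [sA' ->]] : exists A', (forall j, smooth (A' j)) /\ partials4 ks (tens A) = tens A'.
  elim: ks => [|k ks [A' [sA' ih]]]; first by exists A.
  exists (fun j => if j == k then (A' j)^`()%classic else A' j); split.
    by move=> j; case: ifP => // _; exact: smooth_derive.
  rewrite /= -/(partials4 ks _) ih; apply/funext => p.
  exact: (derive1_is (is_derive_tens p k sA')).
split; first by apply: continuous_tens => j; exact: smooth_continuous.
by move=> k p; have [] := is_derive_tens p k sA'.
Qed.

Definition tensor (a1 a2 a3 b : R -> R) (z : vec3 R) (t : R) : R :=
  a1 (c1 z) * a2 (c2 z) * a3 (c3 z) * b t.

Definition compact_supp (f : R -> R) := exists M : R, forall x, M < `|x| -> f x = 0.

Lemma test_tensor a1 a2 a3 b :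
  smooth a1 -> smooth a2 -> smooth a3 -> smooth b ->
  compact_supp a1 -> compact_supp a2 -> compact_supp a3 -> compact_supp b ->
  test_function (tensor a1 a2 a3 b).
Proof.
move=> s1 s2 s3 s4 [M1 h1] [M2 h2] [M3 h3] [M4 h4]; split.
  pose A (j : 'I_4) := nth a1 [:: a1; a2; a3; b] j.
  have -> : to4 (tensor a1 a2 a3 b) = tens A.
    apply/funext => p; rewrite /to4 /tensor /tens /c1 /c2 /c3 /=.
    rewrite !big_ord_recl big_ord0 mulr1 !mulrA.
    have e (k : nat) (j : 'I_4) : (k < 4)%N -> nat_of_ord j = k -> inord k = j.
      by move=> k4 jk; apply/val_inj; rewrite /= inordK.
    rewrite (e 0%N ord0)// (e 1%N (lift ord0 ord0))//.
    rewrite (e 2%N (lift ord0 (lift ord0 ord0)))//.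
    by rewrite (e 3%N (lift ord0 (lift ord0 (lift ord0 ord0)))).
  apply: smooth4_tens => -[[|[|[|[|//]]]] ?]; rewrite /A //=.
exists (`|M1| + `|M2| + `|M3| + `|M4|) => z t.
have le (k : R) : k <= `|k| by exact: ler_norm.
move=> [|[|[|]]] h; rewrite /tensor.
- by rewrite h1 ?mul0r//; apply: le_lt_trans h; rewrite -!addrA (le_trans (le _))// lerDl !addr_ge0.
- rewrite h2 ?mulr0 ?mul0r//; apply: le_lt_trans h.
  rewrite [`|M1| + _]addrC -!addrA (le_trans (le _))// lerDl !addr_ge0//.
- rewrite h3 ?mulr0 ?mul0r//; apply: le_lt_trans h.
  by rewrite -addrA [_ + (`|M3| + _)]addrC -!addrA (le_trans (le _))// lerDl !addr_ge0.
- rewrite h4 ?mulr0//; apply: le_lt_trans h.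
  by rewrite (le_trans (le _))// lerDr !addr_ge0.
Qed.

Lemma d1_tensor a1 a2 a3 b z t : smooth a1 ->
  d1_ (tensor a1 a2 a3 b) z t = tensor (a1^`()%classic) a2 a3 b z t.
Proof.
move=> s1; apply: derive1_is; rewrite /tensor /c1 /c2 /c3 /=.
have h := smooth_is_derive z.1.1 s1.
have k y := is_derive_cst' y z.1.1.
have := is_deriveM' (is_deriveM' (is_deriveM' h (k (a2 z.1.2))) (k (a3 z.2))) (k (b t)).
by rewrite !mulr0 !addr0.
Qed.

Lemma d2_tensor a1 a2 a3 b z t : smooth a2 ->
  d2_ (tensor a1 a2 a3 b) z t = tensor a1 (a2^`()%classic) a3 b z t.
Proof.
move=> s2; apply: derive1_is; rewrite /tensor /c1 /c2 /c3 /=.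
have h := smooth_is_derive z.1.2 s2.
have k y := is_derive_cst' y z.1.2.
have := is_deriveM' (is_deriveM' (is_deriveM' (k (a1 z.1.1)) h) (k (a3 z.2))) (k (b t)).
by rewrite !mulr0 !addr0 mul0r add0r.
Qed.

Lemma dt_tensor a1 a2 a3 b z t : smooth b ->
  dt_ (tensor a1 a2 a3 b) z t = tensor a1 a2 a3 (b^`()%classic) z t.
Proof.
move=> sb; apply: derive1_is; rewrite /tensor.
have := is_deriveM' (is_derive_cst' (a1 (c1 z) * a2 (c2 z) * a3 (c3 z)) t) (smooth_is_derive t sb).
by rewrite mul0r add0r.
Qed.

Lemma mvt_between (f df : R -> R) (a b : R) :
  (forall x : R, is_derive x 1 f (df x)) ->
  exists2 c, `|c - a| <= `|b - a| & f b - f a = df c * (b - a).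
Proof.
move=> fd.
have cw (i : interval R) : {within [set` i], continuous f}.
  by apply: derivable_within_continuous => x _; have [] := fd x.
have [ab|ba] := leP a b.
  have [c] := MVT_segment ab (fun x _ => fd x) (cw `[a, b]).
  rewrite in_itv/= => /andP[ac cb] e; exists c => //.
  by rewrite !ger0_norm; lra.
have [c] := MVT_segment (ltW ba) (fun x _ => fd x) (cw `[b, a]).
rewrite in_itv/= => /andP[bc ca] e; exists c.
  by rewrite !ler0_norm; lra.
by rewrite -opprB e; ring.
Qed.

Lemma continuous_row_ptP (F : 'rV[R]_4 -> R) (p : 'rV[R]_4) : continuous F ->
  forall e : R, 0 < e -> exists2 d : R, 0 < d &
    forall q : 'rV[R]_4, (forall j, `|q 0 j - p 0 j| < d) -> `|F q - F p| <= e.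
Proof.
move=> cF e e0; have /cvgrPdist_le/(_ e e0) := cF p.
move=> /nbhs_ballP[d /= d0 hd]; exists d => // q hq.
rewrite distrC; apply: hd; split=> // i j; rewrite ord1.
by rewrite -ball_normE /= distrC; exact: hq.
Qed.

(** Continuous partial derivatives give a differential: pass from [p] to [q] one coordinate at a
    time, through the points [Q n], with the mean value theorem on each leg. *)
Lemma smooth4_differentiable (F : 'rV[R]_4 -> R) (p : 'rV[R]_4) : smooth4 F ->
  forall e : R, 0 < e -> exists2 d : R, 0 < d &
    forall q : 'rV[R]_4, (forall j, `|q 0 j - p 0 j| < d) ->
      `|F q - F p - \sum_k partial4 k F p * (q 0 k - p 0 k)| <=
      e * \sum_k `|q 0 k - p 0 k|.
Proof.
move=> sF e e0.
have hk k : exists d, 0 < d /\ forall q : 'rV[R]_4, (forall j, `|q 0 j - p 0 j| < d) ->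
    `|partial4 k F q - partial4 k F p| <= e.
  have [ck _] := sF [:: k].
  by have [d d0 hd] := continuous_row_ptP p ck e0; exists d.
have [dl hdl] := choice hk.
exists (\big[Num.min/1]_j dl j).
  by elim/big_ind: _ => // [a b a0 b0|j _]; [rewrite lt_min a0|have [] := hdl j].
move=> q hq.
pose Q (n : nat) : 'rV[R]_4 := \row_j (if (j < n)%N then q 0 j else p 0 j).
have QE n j : Q n 0 j = if (j < n)%N then q 0 j else p 0 j by rewrite mxE.
have Q4 : Q 4 = q by apply/rowP => j; rewrite QE ltn_ord.
have Q0 : Q 0%N = p by apply/rowP => j; rewrite QE.
have dF q' k (s : R) : is_derive s 1 (fun s => F (upd q' k s)) (partial4 k F (upd q' k s)).
  have [_ /(_ k (upd q' k s))] := sF [::].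
  rewrite /= updE eqxx; under eq_fun do rewrite upd_upd.
  move/is_derive_derive1; rewrite /partial4 updE eqxx.
  by under [X in is_derive _ _ _ (derive1 X _) -> _]eq_fun do rewrite -(upd_upd _ _ s).
have step (k : 'I_4) : `|F (Q k.+1) - F (Q k) - partial4 k F p * (q 0 k - p 0 k)| <=
    e * `|q 0 k - p 0 k|.
  have e1 : Q k.+1 = upd (Q k) k (q 0 k).
    apply/rowP => j; rewrite updE !QE ltnS leq_eqVlt.
    have -> : (nat_of_ord j == nat_of_ord k) = (j == k) by [].
    by case: eqP => [->|].
  have e2 : Q k = upd (Q k) k (p 0 k).
    by rewrite -{1}(upd_id (Q k) k) QE ltnn.
  have [c cb] := mvt_between (p 0 k) (q 0 k) (dF (Q k) k).
  rewrite -e1 -e2 => ->; rewrite -mulrBl normrM ler_wpM2r//.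
  have [_] := hdl k; apply=> j; rewrite updE QE.
  have hm j' : `|q 0 j' - p 0 j'| < dl k.
    by apply: lt_le_trans (hq j') _; rewrite (bigD1 k)//= ge_min lexx.
  case: eqP => [->|_]; first exact: le_lt_trans cb (hm k).
  by case: ifP => _; [exact: hm|rewrite subrr normr0; have [] := hdl k].
have tel : F q - F p = \sum_(k < 4) (F (Q k.+1) - F (Q k)).
  rewrite -{1}Q4 -{1}Q0 -(big_mkord xpredT (fun k => F (Q k.+1) - F (Q k))).
  by rewrite telescope_sumr.
rewrite tel -sumrB; apply: le_trans (ler_norm_sum _ _ _) _.
by rewrite mulr_sumr; apply: ler_sum => k _; exact: step.
Qed.

Lemma smooth4_chain (F : 'rV[R]_4 -> R) (g : R -> 'rV[R]_4) (l : 'I_4 -> R) (t : R) :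
  smooth4 F -> (forall j, is_derive t 1 (fun s => g s 0 j) (l j)) ->
  is_derive t 1 (fun s => F (g s)) (\sum_k partial4 k F (g t) * l k).
Proof.
move=> sF dg; apply/is_derive_ptP => e e0.
(* The two sums match the two errors: that of the differential, proportional to the increments of
   the curve, and the linearisation error of the curve weighted by the partials of [F]. *)
pose B : R := \sum_k (`|l k| + 1) + \sum_k `|partial4 k F (g t)| + 1.
have B0 : 0 < B.
  by rewrite ltr_wpDl// addr_ge0// sumr_ge0// => k _; rewrite addr_ge0.
pose e1 := Num.min 1 (e / B).
have e10 : 0 < e1 by rewrite lt_min ltr01 divr_gt0.
have [d d0 hd] := smooth4_differentiable (g t) sF e10.
have hj j : exists d', 0 < d' /\ forall s, `|s - t| < d' ->
    `|g s 0 j - g t 0 j - l j * (s - t)| <= e1 * `|s - t| /\ `|g s 0 j - g t 0 j| < d.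
  have /is_derive_ptP/(_ e1 e10)[d1 d10 h1] := dg j.
  have /continuous_ptP/(_ (d / 2))[|d2 d20 h2] := is_derive_continuous (dg j).
    by rewrite divr_gt0.
  exists (Num.min d1 d2); split => [|s]; first by rewrite lt_min d10.
  rewrite lt_min => /andP[s1 s2]; split; first exact: h1.
  by apply: le_lt_trans (h2 _ s2) _; lra.
have [dl hdl] := choice hj.
exists (\big[Num.min/1]_j dl j).
  by elim/big_ind: _ => // [a b a0 b0|j _]; [rewrite lt_min a0|have [] := hdl j].
move=> s hs.
have hs' j : `|s - t| < dl j by apply: lt_le_trans hs _; rewrite (bigD1 j)//= ge_min lexx.
have h1 j : `|g s 0 j - g t 0 j - l j * (s - t)| <= e1 * `|s - t|.
  by have [_ /(_ _ (hs' j))[]] := hdl j.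
have h2 j : `|g s 0 j - g t 0 j| <= (`|l j| + 1) * `|s - t|.
  have := h1 j; set a := g s 0 j - g t 0 j => ha.
  have -> : a = (a - l j * (s - t)) + l j * (s - t) by rewrite subrK.
  apply: le_trans (ler_normD _ _) _; rewrite normrM mulrDl mul1r addrC lerD2l.
  by apply: le_trans ha _; rewrite ler_piMl// /e1 ge_min lexx.
have h3 := hd (g s) (fun j => let: conj _ h := hdl j in (h _ (hs' j)).2).
set P := partial4 ^~ F in h3 *.
have -> : F (g s) - F (g t) - (\sum_k P k (g t) * l k) * (s - t) =
  (F (g s) - F (g t) - \sum_k P k (g t) * (g s 0 k - g t 0 k)) +
  \sum_k P k (g t) * (g s 0 k - g t 0 k - l k * (s - t)).
  have -> : \sum_k P k (g t) * (g s 0 k - g t 0 k - l k * (s - t)) =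
      \sum_k P k (g t) * (g s 0 k - g t 0 k) - (\sum_k P k (g t) * l k) * (s - t).
    by rewrite mulr_suml -sumrB; apply: eq_bigr => k _; ring.
  by ring.
apply: le_trans (ler_normD _ _) _.
apply: (@le_trans _ _ (e1 * B * `|s - t|)); last first.
  by rewrite ler_wpM2r// -ler_pdivlMr// /e1 ge_min lexx orbT.
have h4 : e1 * \sum_k `|g s 0 k - g t 0 k| <= e1 * (\sum_k (`|l k| + 1)) * `|s - t|.
  by rewrite -mulrA ler_wpM2l ?(ltW e10)// mulr_suml; apply: ler_sum => k _; exact: h2.
have h5 : `|\sum_k P k (g t) * (g s 0 k - g t 0 k - l k * (s - t))| <=
    e1 * (\sum_k `|P k (g t)|) * `|s - t|.
  apply: le_trans (ler_norm_sum _ _ _) _.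
  rewrite mulr_sumr mulr_suml; apply: ler_sum => k _; rewrite normrM.
  by rewrite mulrAC mulrC ler_wpM2r.
apply: le_trans (lerD (le_trans h3 h4) h5) _.
rewrite -mulrDl -mulrDr ler_wpM2r// ler_wpM2l ?(ltW e10)//.
by rewrite /B lerDl.
Qed.

Definition row4 (z : vec3 R) (t : R) : 'rV[R]_4 :=
  \row_(j < 4) nth 0 [:: c1 z; c2 z; c3 z; t] j.

Lemma row4E z t (k : nat) : (k < 4)%N ->
  row4 z t 0 (inord k) = nth 0 [:: c1 z; c2 z; c3 z; t] k.
Proof. by move=> k4; rewrite mxE inordK. Qed.

Lemma to4_row4 (phi : vec3 R -> R -> R) z t : to4 phi (row4 z t) = phi z t.
Proof. by rewrite /to4 !row4E//=; case: z => [[]]. Qed.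

Lemma upd_row4 z t (k : nat) s (z' : vec3 R) t' : (k < 4)%N ->
  [:: c1 z'; c2 z'; c3 z'; t'] = set_nth 0 [:: c1 z; c2 z; c3 z; t] k s ->
  upd (row4 z t) (inord k) s = row4 z' t'.
Proof.
move=> k4 h; apply/rowP => j; rewrite updE !mxE h nth_set_nth /=.
by rewrite -(inj_eq val_inj) /= inordK.
Qed.

Lemma partial4_d1 phi z t : partial4 (inord 0) (to4 phi) (row4 z t) = d1_ phi z t.
Proof.
rewrite /partial4 /d1_ row4E//=; congr (derive1 _ _); apply/funext => s.
by rewrite (@upd_row4 _ _ _ _ ((s, c2 z), c3 z) t)// to4_row4.
Qed.
Lemma partial4_d2 phi z t : partial4 (inord 1) (to4 phi) (row4 z t) = d2_ phi z t.
Proof.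
rewrite /partial4 /d2_ row4E//=; congr (derive1 _ _); apply/funext => s.
by rewrite (@upd_row4 _ _ _ _ ((c1 z, s), c3 z) t)// to4_row4.
Qed.
Lemma partial4_d3 phi z t : partial4 (inord 2) (to4 phi) (row4 z t) = d3_ phi z t.
Proof.
rewrite /partial4 /d3_ row4E//=; congr (derive1 _ _); apply/funext => s.
by rewrite (@upd_row4 _ _ _ _ ((c1 z, c2 z), s) t)// to4_row4.
Qed.
Lemma partial4_dt phi z t : partial4 (inord 3) (to4 phi) (row4 z t) = dt_ phi z t.
Proof.
rewrite /partial4 /dt_ row4E//=; congr (derive1 _ _); apply/funext => s.
by rewrite (@upd_row4 _ _ _ _ z s)// to4_row4.
Qed.

Lemma sum_ord4 (f : 'I_4 -> R) :
  \sum_k f k = f (inord 0) + f (inord 1) + f (inord 2) + f (inord 3).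
Proof.
rewrite !big_ord_recl big_ord0 addr0 !addrA.
have e (k : nat) (j : 'I_4) : (k < 4)%N -> nat_of_ord j = k -> j = inord k.
  by move=> k4 jk; apply/val_inj; rewrite /= inordK.
rewrite (e 3%N (lift ord0 (lift ord0 (lift ord0 ord0))))//.
rewrite (e 2%N (lift ord0 (lift ord0 ord0)))//.
by rewrite (e 1%N (lift ord0 ord0))// (e 0%N ord0).
Qed.

Lemma test_chain (phi : vec3 R -> R -> R) (z : R -> vec3 R) (l1 l2 l3 t : R) :
  smooth4 (to4 phi) ->
  is_derive t 1 (fun s => c1 (z s)) l1 -> is_derive t 1 (fun s => c2 (z s)) l2 ->
  is_derive t 1 (fun s => c3 (z s)) l3 ->
  is_derive t 1 (fun s => phi (z s) s)
    (dt_ phi (z t) t + (d1_ phi (z t) t * l1 + d2_ phi (z t) t * l2 + d3_ phi (z t) t * l3)).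
Proof.
move=> sphi h1 h2 h3.
pose l (j : 'I_4) := nth 0 [:: l1; l2; l3; 1] j.
have H j : is_derive t 1 (fun s => row4 (z s) s 0 j) (l j).
  under eq_fun do rewrite mxE.
  case: j => -[|[|[|[|//]]]] ? //=.
  exact: is_derive_id'.
have := @smooth4_chain _ (fun s => row4 (z s) s) l t sphi H.
under eq_fun do rewrite to4_row4.
rewrite sum_ord4 partial4_d1 partial4_d2 partial4_d3 partial4_dt.
by rewrite /l !inordK//= mulr1 addrC.
Qed.

Lemma test_partial_continuous (phi : vec3 R -> R -> R) (k : nat) :
  smooth4 (to4 phi) -> forall z t (e : R), 0 < e -> exists2 d : R, 0 < d &
    forall z' t', `|c1 z' - c1 z| < d -> `|c2 z' - c2 z| < d -> `|c3 z' - c3 z| < d ->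
      `|t' - t| < d ->
      `|partial4 (inord k) (to4 phi) (row4 z' t') - partial4 (inord k) (to4 phi) (row4 z t)| <= e.
Proof.
move=> sphi z t e e0; have [ck _] := sphi [:: inord k].
have [d d0 hd] := continuous_row_ptP (row4 z t) ck e0.
exists d => // z' t' h1 h2 h3 h4; apply: hd => j; rewrite !mxE.
by case: j => -[|[|[|[|//]]]] ?.
Qed.

Lemma test_partial_continuous_path (phi : vec3 R -> R -> R) (k : nat)
  (z : R -> vec3 R) (u : R -> R) :
  smooth4 (to4 phi) -> continuous (fun s => c1 (z s)) ->
  continuous (fun s => c2 (z s)) -> continuous (fun s => c3 (z s)) -> continuous u ->
  continuous (fun s => partial4 (inord k) (to4 phi) (row4 (z s) (u s))).
Proof.
move=> sphi h1 h2 h3 h4 t; apply/continuous_ptP => e e0.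
have [d d0 hd] := test_partial_continuous k sphi (z t) (u t) e0.
have d2 : 0 < d / 2 by rewrite divr_gt0.
have dd : d / 2 < d by lra.
have /continuous_ptP/(_ _ d2)[d1 d10 k1] := h1 t.
have /continuous_ptP/(_ _ d2)[d3 d30 k2] := h2 t.
have /continuous_ptP/(_ _ d2)[d4 d40 k3] := h3 t.
have /continuous_ptP/(_ _ d2)[d5 d50 k4] := h4 t.
exists (Num.min (Num.min d1 d3) (Num.min d4 d5)).
  by rewrite !lt_min d10 d30 d40.
move=> y; rewrite !lt_min => /andP[/andP[y1 y2] /andP[y3 y4]].
by apply: hd; [apply: le_lt_trans (k1 _ y1) _|apply: le_lt_trans (k2 _ y2) _|
  apply: le_lt_trans (k3 _ y3) _|apply: le_lt_trans (k4 _ y4) _].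
Qed.

Lemma test_partial_continuous_space (phi : vec3 R -> R -> R) (k : nat) (t : R) :
  smooth4 (to4 phi) ->
  continuous (fun z : vec3 R => partial4 (inord k) (to4 phi) (row4 z t)).
Proof.
move=> sphi z; apply/cvgrPdist_le => e e0.
have [d d0 hd] := test_partial_continuous k sphi z t e0.
apply: filterS (nbhsx_ballx (z : vec3 R) d d0) => z' [[b1 b2] b3].
rewrite distrC; apply: hd; rewrite ?subrr ?normr0//.
- by rewrite distrC; exact: b1.
- by rewrite distrC; exact: b2.
- by rewrite distrC; exact: b3.
Qed.

End test_functions.

(** * Calculus on the time interval *)

Section interval_calculus.
Context {R : realType} (T : R).
Hypothesis T0 : 0 < T.
Local Notation clamp := (clamp T).

Lemma continuous_clamp : continuous clamp.
Proof.
apply: (@continuous_comp_clamp R T T0 (fun t => t)) => t _; exact: cvg_id.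
Qed.

Lemma integral_clamp (f : R -> R) :
  (\int[@lebesgue_measure R]_(t in `[0%R, T]%classic) (f t)%:E =
   \int[@lebesgue_measure R]_(t in `[0%R, T]%classic) (f (clamp t))%:E)%E.
Proof.
apply: eq_integral => t /set_mem /=; rewrite in_itv/= => tT.
by rewrite clamp_id.
Qed.

Lemma integrable_clamp (f : R -> R) : continuous (fun s => f (clamp s)) ->
  (@lebesgue_measure R).-integrable `[0%R, T]%classic (EFin \o (fun s => f (clamp s))).
Proof.
move=> cf; apply: continuous_compact_integrable; first exact: segment_compact.
by apply: continuous_subspaceT => x; exact: cf.
Qed.

Lemma FTC_clamp (F f : R -> R) :
  (forall t : R, 0 <= t <= T -> is_derive t 1 F (f t)) ->
  continuous (fun s => f (clamp s)) ->
  (\int[@lebesgue_measure R]_(t in `[0%R, T]%classic) (f t)%:E = (F T - F 0)%:E)%E.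
Proof.
move=> dF cf; rewrite integral_clamp.
have cF (t : R) : 0 <= t <= T -> {for t, continuous F}.
  by move=> /dF; exact: is_derive_continuous.
rewrite EFinB; apply: (continuous_FTC2 T0 (f := fun s => f (clamp s)) (F := F)).
- by apply: continuous_subspaceT => x; exact: cf.
- split.
  + move=> x; rewrite in_itv/= => /andP[/ltW x0 /ltW xT].
    by have [] : is_derive x 1 F (f x) by apply: dF; rewrite x0.
  + by apply: cvg_at_right_filter; apply: cF; rewrite lexx ltW.
  + by apply: cvg_at_left_filter; apply: cF; rewrite lexx ltW.
- move=> x; rewrite in_itv/= => /andP[/ltW x0 /ltW xT].
  have xx : 0 <= x <= T by rewrite x0.
  by rewrite clamp_id//; apply: derive1_is; exact: dF.
Qed.

Lemma is_derive0_constant (F : R -> R) :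
  (forall t : R, 0 <= t <= T -> is_derive t 1 F 0) ->
  forall s t, 0 <= s <= T -> 0 <= t <= T -> F s = F t.
Proof.
move=> dF s t sT tT.
wlog st : s t sT tT / s <= t => [wl|].
  by have [/wl->//|/ltW/wl->] := leP s t.
have inT x : s <= x <= t -> 0 <= x <= T.
  move: sT tT => /andP[s0 _] /andP[_ tT] /andP[sx xt].
  by rewrite (le_trans s0 sx) (le_trans xt tT).
apply/eqP; rewrite eq_le; apply/andP; split.
  rewrite -lerN2; apply: (@le0_is_derive_nincr _ (fun s => - F s) (fun=> - 0) s t st).
    by move=> x /inT xT; exact: (is_deriveN' (dF x xT)).
  by move=> x _; rewrite oppr0.
apply: (@le0_is_derive_nincr _ F (fun=> 0) s t st) => // x /inT xT; exact: dF.
Qed.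

Lemma C1_of_derive (f g : R -> R) :
  (forall t : R, 0 <= t <= T -> is_derive t 1 f (g t)) ->
  continuous (fun s => g (clamp s)) -> C1_on T f.
Proof.
move=> df cg; exists (fun s => g (clamp s)); split.
  by apply: continuous_subspaceT => x; exact: cg.
move=> t tT; rewrite clamp_id//; apply/cvgrPdist_le => e e0.
have /is_derive_ptP/(_ e e0)[d d0 hd] := df t tT.
apply: filterS (nbhsx_ballx (t : R) d d0) => s; rewrite -ball_normE /= distrC => st [_ sn].
have sn' : s - t != 0 by rewrite subr_eq0.
have -> : g t - (f s - f t) / (s - t) = - ((f s - f t - g t * (s - t)) / (s - t)).
  by field.
by rewrite normrN normrM normfV ler_pdivrMr ?normr_gt0//; exact: hd.
Qed.

Lemma continuous_sum_fun (I : finType) (F : I -> R -> R) :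
  (forall i, continuous (F i)) -> continuous (fun s => \sum_i F i s).
Proof.
move=> cF; elim: (index_enum I) => [|i s ih] x.
  have -> : (fun s => \sum_(i <- [::]) F i s) = fun=> 0.
    by apply/funext => ?; rewrite big_nil.
  exact: cst_continuous.
have -> : (fun y => \sum_(j <- i :: s) F j y) = fun y => F i y + \sum_(j <- s) F j y.
  by apply/funext => ?; rewrite big_cons.
exact: continuousD (cF i x) (ih x).
Qed.

(** Serves the envelope argument, where the remainder is squeezed by a quadratic in the
    displacement. *)
Lemma is_derive_dominated (F q : R -> R) (t : R) : q t = 0 -> F t = 0 ->
  (forall s, `|F s| <= q s) -> is_derive t 1 q 0 -> is_derive t 1 F 0.
Proof.
move=> q0 F0 Fq /is_derive_ptP dq; apply/is_derive_ptP => e /dq[d d0 hd].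
exists d => // y /hd; rewrite q0 F0 mul0r !subr0 => h.
by apply: le_trans (Fq y) _; apply: le_trans (ler_norm _) h.
Qed.

Lemma sum_sqr_le (I : finType) (a : I -> R) :
  \sum_i a i ^+ 2 <= (\sum_i `|a i|) ^+ 2.
Proof.
rewrite expr2 mulr_sumr; apply: ler_sum => i _.
rewrite -[a i ^+ 2]real_normK ?num_real// expr2 ler_wpM2r//.
by rewrite (bigD1 i)//= lerDl sumr_ge0.
Qed.

End interval_calculus.

(** With [h1], [h2] the moments of a cell, the contribution of one particle to the weak integrand is
    its mass times the total derivative of the test function along the ODE. *)
Lemma drift_algebra (R : fieldType) (m dt d1 d2 d3 x1 x2 h1 h2 : R) : m != 0 ->
  m * (dt + (- x2 * d1 + x1 * d2 + 0 * d3)) - (h1 * d2 - h2 * d1) =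
  m * (dt + (d1 * (h2 / m - x2) + d2 * (x1 - h1 / m) + d3 * 0)).
Proof. by move=> ?; field. Qed.

(** The derivative of the quadratic part and that of the reward both equal [x1 h2 - x2 h1]. *)
Lemma energy_algebra (R : realType) (m x1 x2 h1 h2 : R) : m != 0 ->
  2^-1 * (m * (((h2 / m - x2) * x1 + x1 * (h2 / m - x2)) +
               ((x1 - h1 / m) * x2 + x2 * (x1 - h1 / m)))) -
  (h1 * (h2 / m - x2) + h2 * (x1 - h1 / m)) = 0.
Proof. by move=> ?; field. Qed.

(** * The flow of well-prepared seeds: weak formulation and energy *)

Section flow.
Context {R : realType} (Om : set (vec3 R)) (M : R).
Hypothesis mOm : measurable Om.
Hypothesis OmM : forall x, Om x -> `|c1 x| <= M /\ `|c2 x| <= M /\ `|c3 x| <= M.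
Hypothesis Om1 : @leb3 R Om = 1%E.
Context (N : nat) (m : 'I_N -> R) (i0 : 'I_N).
Hypothesis m_gt0 : forall i, 0 < m i.
Hypothesis m_sum : \sum_i m i = 1.
Context (h : 'I_N -> R) (r : R).
Hypothesis r0 : 0 < r.
Hypothesis hr : forall i j, i != j -> r <= `|h i - h j|.
Context (T : R).
Hypothesis T0 : 0 < T.
Local Notation clamp := (clamp T).
Local Notation pos := (pos h).
Local Notation hmom := (fun X => hmoment Om (opt Om m i0 h X)).

(* The first two components of J (z_i - c_i), c_i being the centroid. *)
Definition velocity (X : 'I_N * bool -> R) (k : 'I_N * bool) : R :=
  if k.2 then X (k.1, false) - hmom X (k.1, false) / m k.1
  else hmom X (k.1, true) / m k.1 - X (k.1, true).

Let C := Kquad M N r.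
Let C0 : 0 < C. Proof. exact: (Kquad_gt0 mOm OmM Om1 N r0). Qed.

Lemma hmom_lip X Y k : `|hmom X k - hmom Y k| <= 2 * C * \sum_j `|X j - Y j|.
Proof.
have S0 : 0 <= \sum_j `|X j - Y j| by apply: sumr_ge0.
have C0' := C0.
have h2 : 0 <= 2 * C * \sum_j `|X j - Y j| by rewrite !mulr_ge0// ltW.
rewrite -(@ler_pXn2r _ 2)// ?nnegrE// real_normK ?num_real//.
apply: (@le_trans _ _ (\sum_j (hmom X j - hmom Y j) ^+ 2)).
  by rewrite (bigD1 k)//= lerDl sumr_ge0// => j _; exact: sqr_ge0.
apply: le_trans (hmoment_lip mOm OmM Om1 i0 m_gt0 m_sum r0 hr X Y) _.
by rewrite [leRHS]exprMn ler_wpM2l ?sqr_ge0//; exact: sum_sqr_le.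
Qed.

(** The 1 accounts for the rotation of the seed, the rest for the moments; the sum of inverse masses
    dominates each [1 / m i]. *)
Definition Kvel : R := 1 + 2 * C * \sum_i (m i)^-1.

Lemma Kvel_ge0 : 0 <= Kvel.
Proof.
have C0' := C0.
rewrite addr_ge0// !mulr_ge0 ?(ltW C0)// sumr_ge0// => i _.
by rewrite invr_ge0 ltW.
Qed.

Lemma velocity_lip X Y k :
  `|velocity X k - velocity Y k| <= Kvel * \sum_j `|X j - Y j|.
Proof.
have S0 : 0 <= \sum_j `|X j - Y j| by apply: sumr_ge0.
have C0' := C0.
have key (k' : 'I_N * bool) i :
    `|X k' - Y k'| + `|hmom X k' - hmom Y k'| / m i <= Kvel * \sum_j `|X j - Y j|.
  rewrite /Kvel mulrDl mul1r; apply: lerD.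
    by rewrite (bigD1 k')//= lerDl sumr_ge0.
  have -> : 2 * C * (\sum_i (m i)^-1) * (\sum_j `|X j - Y j|) =
      2 * C * (\sum_j `|X j - Y j|) * \sum_i (m i)^-1 by ring.
  apply: ler_pM => //; first by rewrite invr_ge0 ltW.
    exact: hmom_lip.
  by rewrite (bigD1 i)//= lerDl sumr_ge0// => j _; rewrite invr_ge0 ltW.
have mi : 0 < m k.1 by [].
rewrite /velocity; case: ifP => _.
  apply: le_trans (key (k.1, false) k.1).
  have alg (x y a b c : R) : x - a / c - (y - b / c) = (x - y) - (a - b) / c by ring.
  rewrite alg; apply: le_trans (ler_normB _ _) _; rewrite lerD2l normrM normfV.
  by rewrite (gtr0_norm mi).
apply: le_trans (key (k.1, true) k.1).
have alg (x y a b c : R) : a / c - x - (b / c - y) = - ((x - y) - (a - b) / c) by ring.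
rewrite alg normrN; apply: le_trans (ler_normB _ _) _; rewrite lerD2l normrM normfV.
by rewrite (gtr0_norm mi).
Qed.

Context (X : R -> 'I_N * bool -> R).
Hypothesis Xc : forall k, continuous (fun s => X (clamp s) k).

Lemma continuous_hmom k : continuous (fun s => hmom (X (clamp s)) k).
Proof.
have C0' := C0.
apply: (continuous_lip_field (K := 2 * C) (f := hmom)) => //.
  by rewrite mulr_ge0// ltW.
by move=> Y Z i; exact: hmom_lip.
Qed.

Lemma continuous_velocity k : continuous (fun s => velocity (X (clamp s)) k).
Proof.
apply: (continuous_lip_field Kvel_ge0) => //; exact: velocity_lip.
Qed.

Lemma gap_posX t : gap r (pos (X t)).
Proof. exact: gap_pos. Qed.

Definition drift (phi : vec3 R -> R -> R) (t : R) : R :=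
  \sum_i (hmom (X t) (i, false) * d2_ phi (pos (X t) i) t
          - hmom (X t) (i, true) * d1_ phi (pos (X t) i) t).

(** The gradient of [phi] is evaluated at one seed per cell, so it comes out of the cell integral
    and leaves the horizontal moments. *)
Lemma integral_gradB_drift phi t : smooth4 (to4 phi) ->
  (\int[@leb3 R]_(x in Om)
      (dot3 (Jmul x) (grad_ phi (gradB Om (disc m (pos (X t))) x) t))%:E
   = (drift phi t)%:E)%E.
Proof.
move=> sphi.
have dE (x y : vec3 R) : dot3 (Jmul x) (grad_ phi y t) =
    d2_ phi y t * c1 x - d1_ phi y t * c2 x.
  by rewrite /dot3 /Jmul /grad_ /c1 /c2 /c3 /=; ring.
have b1 := bmeas_c1 OmM; have b2 := bmeas_c2 OmM.
rewrite (integral_gradB mOm OmM Om1 i0 m_gt0 m_sum r0 (@gap_posX t)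
  (Psi := fun x y => dot3 (Jmul x) (grad_ phi y t))).
- congr EFin; rewrite -/(opt Om m i0 h (X t)); set s := opt _ _ _ _ _.
  have ms : label_measurable Om s.
    exact: plan_label_measurable (opt_plan mOm OmM Om1 i0 m_gt0 m_sum r0 hr (X t)).
  have bl i := bmeas_lab i ms.
  rewrite (@IOm_ext _ _ _ (fun x => \sum_i (d2_ phi (pos (X t) i) t * (lab s i x * c1 x)
      - d1_ phi (pos (X t) i) t * (lab s i x * c2 x)))); last first.
    move=> x _; rewrite (label_sum s (fun i x => dot3 (Jmul x) (grad_ phi (pos (X t) i) t))).
    by apply: eq_bigr => i _; rewrite dE; ring.
  rewrite IOm_sum//; last first.
    by move=> i; apply: bmeasB; apply: bmeasZ; exact: bmeasM.
  apply: eq_bigr => i _; rewrite IOmB// ?IOmZ//; try (by apply: bmeasZ; exact: bmeasM);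
    try exact: bmeasM.
  by rewrite /hmoment /= /moment /c1 /c2 /=; ring.
- move=> S mS.
  apply: (@eq_measurable_fun _ _ _ _ _ (fun x => d2_ phi (S x) t * c1 x - d1_ phi (S x) t * c2 x)).
    by move=> x _; rewrite dE.
  have m1 : measurable_fun setT (fun y => d1_ phi y t).
    apply: continuous_vec3_measurable.
    under eq_fun do rewrite -partial4_d1; exact: test_partial_continuous_space.
  have m2 : measurable_fun setT (fun y => d2_ phi y t).
    apply: continuous_vec3_measurable.
    under eq_fun do rewrite -partial4_d2; exact: test_partial_continuous_space.
  apply: measurable_funB; apply: measurable_funM.
  + exact: (measurableT_comp m2 mS).
  + exact: measurable_c1.
  + exact: (measurableT_comp m1 mS).
  + exact: measurable_c2.
- move=> i; apply: (@eq_bmeas _ _ (fun x => d2_ phi (pos (X t) i) t * c1 x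
     - d1_ phi (pos (X t) i) t * c2 x)) => [x _|]; first by rewrite dE.
  by apply: bmeasB; exact: bmeasZ.
Qed.

Lemma continuous_partial_path (phi : vec3 R -> R -> R) (k : nat) i : smooth4 (to4 phi) ->
  continuous (fun s => partial4 (inord k) (to4 phi)
     (row4 (pos (X (clamp s)) i) (clamp s))).
Proof.
move=> sphi; apply: test_partial_continuous_path => //.
- exact: Xc (i, false).
- exact: Xc (i, true).
- by move=> s; exact: cst_continuous.
- exact: continuous_clamp.
Qed.

Lemma continuous_drift phi : smooth4 (to4 phi) -> continuous (fun s => drift phi (clamp s)).
Proof.
move=> sphi; apply: continuous_sum_fun => i s; rewrite /continuous_at.
have p1 := continuous_partial_path (k := 0%N) (i := i) sphi; have p2 := continuous_partial_path (k := 1%N) (i := i) sphi.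
under eq_fun do rewrite -partial4_d1 -partial4_d2.
rewrite -partial4_d1 -partial4_d2.
by apply: cvgB; apply: cvgM; [exact: continuous_hmom|exact: p2|exact: continuous_hmom|exact: p1].
Qed.

Definition advection (phi : vec3 R -> R -> R) (t : R) : R :=
  \sum_i m i * (dt_ phi (pos (X t) i) t
     + dot3 (Jmul (pos (X t) i)) (grad_ phi (pos (X t) i) t)).

Lemma continuous_advection phi : smooth4 (to4 phi) ->
  continuous (fun s => advection phi (clamp s)).
Proof.
move=> sphi; apply: continuous_sum_fun => i s.
have p0 := continuous_partial_path (k := 0%N) (i := i) sphi; have p1 := continuous_partial_path (k := 1%N) (i := i) sphi.
have p3 := continuous_partial_path (k := 3%N) (i := i) sphi.
have -> : (fun s => m i * (dt_ phi (pos (X (clamp s)) i) (clamp s)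
     + dot3 (Jmul (pos (X (clamp s)) i)) (grad_ phi (pos (X (clamp s)) i) (clamp s)))) =
  (fun s => m i * (partial4 (inord 3) (to4 phi) (row4 (pos (X (clamp s)) i) (clamp s)) +
    (X (clamp s) (i, false) * partial4 (inord 1) (to4 phi) (row4 (pos (X (clamp s)) i) (clamp s))
    - X (clamp s) (i, true) * partial4 (inord 0) (to4 phi) (row4 (pos (X (clamp s)) i) (clamp s))))).
  apply/funext => s'; rewrite partial4_d1 partial4_d2 partial4_dt.
  by rewrite /dot3 /Jmul /grad_ /pos /c1 /c2 /c3 /=; ring.
apply: cvgM; first exact: cvg_cst.
by apply: cvgD; [exact: p3|apply: cvgB; apply: cvgM;
  [exact: Xc|exact: p1|exact: Xc|exact: p0]].
Qed.

Hypothesis dX : forall k (t : R), 0 <= t <= T -> is_derive t 1 (X ^~ k) (velocity (X t) k).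

(** By [drift_algebra] the two time integrands differ by the derivative of
    [\sum_i m i * phi (z_i t) t], so the identity is the fundamental theorem of calculus. *)
Lemma weak_solution : weak_geostrophic Om T m (pos (X 0)) m (fun i t => pos (X t) i).
Proof.
move=> phi [sphi _].
have -> : (\int[@lebesgue_measure R]_(t in `[0%R, T]%classic)
    (\int[@leb3 R]_(x in Om)
     (dot3 (Jmul x) (grad_ phi (gradB Om (disc m ((pos (X t)))) x) t))%:E) =
   \int[@lebesgue_measure R]_(t in `[0%R, T]%classic) (drift phi (clamp t))%:E)%E.
  rewrite -integral_clamp; apply: eq_integral => t _; exact: integral_gradB_drift.
have -> : (\int[@lebesgue_measure R]_(t in `[0%R, T]%classic)
     (\sum_(i < N) m i * (dt_ phi (pos (X t) i) t
        + dot3 (Jmul (pos (X t) i)) (grad_ phi (pos (X t) i) t)))%:E =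
   \int[@lebesgue_measure R]_(t in `[0%R, T]%classic) (advection phi (clamp t))%:E)%E.
  by rewrite -integral_clamp.
rewrite -integralB_EFin//=; first last.
- exact: integrable_clamp (continuous_drift sphi).
- exact: integrable_clamp (continuous_advection sphi).
under eq_integral do rewrite -EFinB.
rewrite -(integral_clamp T (fun t => advection phi t - drift phi t)).
have hd (t : R) : 0 <= t <= T -> is_derive t 1 (fun t => \sum_i m i * phi (pos (X t) i) t)
    (advection phi t - drift phi t).
  move=> tT.
  have -> : advection phi t - drift phi t = \sum_i m i * (dt_ phi (pos (X t) i) t +
     (d1_ phi (pos (X t) i) t * velocity (X t) (i, false) +
      d2_ phi (pos (X t) i) t * velocity (X t) (i, true) + d3_ phi (pos (X t) i) t * 0)).
    rewrite /advection /drift -sumrB; apply: eq_bigr => i _.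
    have mi : m i != 0 by rewrite gt_eqF.
    exact: drift_algebra.
  apply: is_derive_sum' => i; apply: is_deriveZ'.
  exact: (@test_chain _ phi (fun s => pos (X s) i) _ _ _ t sphi
    (dX (i, false) tT) (dX (i, true) tT) (is_derive_cst' (h i) t)).
have hc : continuous (fun s => advection phi (clamp s) - drift phi (clamp s)).
  by move=> s; apply: cvgB; [exact: continuous_advection|exact: continuous_drift].
exact: (FTC_clamp T0 hd hc).
Qed.

Definition energyX (Y : 'I_N * bool -> R) : R :=
  2^-1 * @IOm R Om (fun x => c1 x ^+ 2 + c2 x ^+ 2)
  + 2^-1 * \sum_i m i * (Y (i, false) ^+ 2 + Y (i, true) ^+ 2)
  - reward Om (opt Om m i0 h Y) (pos Y).

Lemma energyE Y : energy Om (disc m (pos Y)) = (energyX Y)%:E.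
Proof.
pose Psi (x y : vec3 R) : R :=
  2^-1 * ((c1 y - c1 x) ^+ 2 + (c2 y - c2 x) ^+ 2) - c3 x * c3 y.
have b1 := bmeas_c1 OmM; have b2 := bmeas_c2 OmM; have b3 := bmeas_c3 OmM.
(* The cross terms of the horizontal square join the vertical product in a full dot product, which
   integrates to the reward. *)
have PsiE x y : Psi x y = 2^-1 * (c1 x ^+ 2 + c2 x ^+ 2) +
    2^-1 * (c1 y ^+ 2 + c2 y ^+ 2) - dot3 x y.
  by rewrite /Psi /dot3; field.
have bq : bmeas Om (fun x => 2^-1 * (c1 x ^+ 2 + c2 x ^+ 2)).
  by apply: bmeasZ; apply: bmeasD; exact: bmeasM.
rewrite /energy (integral_gradB mOm OmM Om1 i0 m_gt0 m_sum r0 (gap_pos hr Y) (Psi := Psi)).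
- congr EFin; rewrite -/(opt Om m i0 h Y).
  have ps := opt_plan mOm OmM Om1 i0 m_gt0 m_sum r0 hr Y.
  have ms := plan_label_measurable ps; set s := opt _ _ _ _ _ in ps ms *.
  rewrite (@IOm_ext _ _ _ (fun x => 2^-1 * (c1 x ^+ 2 + c2 x ^+ 2) +
    2^-1 * (c1 (pos Y (s x)) ^+ 2 + c2 (pos Y (s x)) ^+ 2) - dot3 x (pos Y (s x)))); last first.
    by move=> x _; rewrite PsiE.
  have bk : bmeas Om (fun x => 2^-1 * (c1 (pos Y (s x)) ^+ 2 + c2 (pos Y (s x)) ^+ 2)).
    by apply: (bmeas_label (f := fun i _ => 2^-1 * (c1 (pos Y i) ^+ 2 + c2 (pos Y i) ^+ 2)) ms)
      => i; exact: bmeas_cst.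
  have bd : bmeas Om (fun x => dot3 x (pos Y (s x))).
    by apply: (bmeas_label (f := fun i x => dot3 x (pos Y i)) ms) => i; exact: (bmeas_dot OmM).
  rewrite IOmB//; last exact: bmeasD.
  rewrite IOmD// IOmZ//; last by apply: bmeasD; exact: bmeasM.
  rewrite (IOm_label_cst mOm Om1 (fun i => 2^-1 * (c1 (pos Y i) ^+ 2 + c2 (pos Y i) ^+ 2)) ps).
  rewrite /energyX /reward; congr (_ + _ - _); rewrite mulr_sumr; apply: eq_bigr => i _.
  by rewrite /pos /c1 /c2 /=; ring.
- move=> S mS; rewrite /Psi.
  have mc (c : vec3 R -> R) : (forall D, measurable_fun D c) -> measurable_fun Om (fun x => c (S x)).
    by move=> mc; apply: measurableT_comp => //; exact: mc.
  apply: measurable_funB; last first.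
    by apply: measurable_funM; [exact: measurable_c3|apply: mc; exact: measurable_c3].
  apply: measurable_funM; first exact: measurable_cst.
  apply: measurable_funD; apply: measurable_funX; apply: measurable_funB.
  + by apply: mc; exact: measurable_c1.
  + exact: measurable_c1.
  + by apply: mc; exact: measurable_c2.
  + exact: measurable_c2.
- move=> i; apply: (@eq_bmeas _ _ (fun x => 2^-1 * (c1 x ^+ 2 + c2 x ^+ 2) +
    2^-1 * (c1 (pos Y i) ^+ 2 + c2 (pos Y i) ^+ 2) - dot3 x (pos Y i))) => [x _|].
    by rewrite PsiE.
  by apply: bmeasB; [apply: bmeasD => //; exact: bmeas_cst|exact: (bmeas_dot OmM)].
Qed.

(* Envelope theorem: the optimal reward is differentiable along the path and
   only the explicit dependence on the seeds contributes. *)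
Lemma is_derive_reward (t : R) : 0 <= t <= T ->
  is_derive t 1 (fun s => reward Om (opt Om m i0 h (X s)) (pos (X s)))
    (\sum_k hmom (X t) k * velocity (X t) k).
Proof.
move=> tT; have C0' := C0.
have op Y := opt_plan mOm OmM Om1 i0 m_gt0 m_sum r0 hr Y.
(* [lin s] is the reward at time [s] of the plan optimal at time [t]. Optimality makes the remainder
   nonnegative, and [reward_opt_quad] keeps it below [q]. *)
pose lin s := reward Om (opt Om m i0 h (X t)) (pos (X t)) + \sum_k hmom (X t) k * (X s k - X t k).
pose rem s := reward Om (opt Om m i0 h (X s)) (pos (X s)) - lin s.
pose q s := C * \sum_k (X s k - X t k) * (X s k - X t k).
have dk k : is_derive t 1 (fun s => X s k - X t k) (velocity (X t) k - 0).
  exact: (is_deriveB' (dX k tT) (is_derive_cst' _ _)).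
have dlin : is_derive t 1 lin (0 + \sum_k hmom (X t) k * (velocity (X t) k - 0)).
  apply: (is_deriveD' (is_derive_cst' _ _)).
  by apply: is_derive_sum' => k; exact: (is_deriveZ' _ (dk k)).
have dq : is_derive t 1 q 0.
  have -> : (0 : R) = C * \sum_k ((velocity (X t) k - 0) * (X t k - X t k)
     + (X t k - X t k) * (velocity (X t) k - 0)).
    by rewrite big1 ?mulr0// => k _; rewrite subrr mulr0 mul0r addr0.
  by apply: is_deriveZ'; apply: is_derive_sum' => k; exact: (is_deriveM' (dk k) (dk k)).
have drem : is_derive t 1 rem 0.
  apply: (is_derive_dominated (q := q)) => //.
  - by rewrite /q big1 ?mulr0// => k _; rewrite subrr mulr0.
  - rewrite /rem /lin big1 ?addr0 ?subrr// => k _; by rewrite subrr mulr0.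
  - move=> s; rewrite /rem /lin.
    have e := reward_diff mOm OmM Om1 h (X t) (X s) (op (X t)).
    have l1 := reward_opt_max mOm OmM Om1 i0 m_gt0 m_sum r0 hr (X s) (op (X t)).
    have l2 := reward_opt_quad mOm OmM Om1 i0 m_gt0 m_sum r0 hr (X t) (X s) (op (X s)).
    have e2 : \sum_k (X s k - X t k) ^+ 2 = \sum_k (X s k - X t k) * (X s k - X t k) by [].
    rewrite e2 -/C -/(q s) in l2.
    have sq (a b c d : R) : b = c -> b <= a -> a <= b + d -> `|a - c| <= d.
      by move=> <- ? ?; rewrite ger0_norm ?subr_ge0// lerBlDl.
    exact: (sq _ _ _ _ e l1 l2).
have := is_deriveD' dlin drem.
have -> : (fun s => lin s + rem s) =
    (fun s => reward Om (opt Om m i0 h (X s)) (pos (X s))).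
  by apply/funext => s; rewrite /rem addrC subrK.
rewrite add0r addr0; under eq_bigr do rewrite subr0.
by [].
Qed.

Lemma energy_constant s t : 0 <= s <= T -> 0 <= t <= T ->
  energyX (X s) = energyX (X t).
Proof.
apply: (@is_derive0_constant _ _ (fun s => energyX (X s))) => {}t tT.
have dr := is_derive_reward tT.
have dsq i b : is_derive t 1 (fun s => X s (i, b) ^+ 2)
    (velocity (X t) (i, b) * X t (i, b) + X t (i, b) * velocity (X t) (i, b)).
  exact: (is_deriveM' (dX (i, b) tT) (dX (i, b) tT)).
have ds : is_derive t 1 (fun s => \sum_i m i * (X s (i, false) ^+ 2 + X s (i, true) ^+ 2))
    (\sum_i m i * ((velocity (X t) (i, false) * X t (i, false) + X t (i, false) * velocity (X t) (i, false)) + (velocity (X t) (i, true) * X t (i, true) + X t (i, true) * velocity (X t) (i, true)))).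
  apply: is_derive_sum' => i; exact: (is_deriveZ' _ (is_deriveD' (dsq i false) (dsq i true))).
have := is_deriveB' (is_deriveD' (is_derive_cst'
  (2^-1 * @IOm R Om (fun x => c1 x ^+ 2 + c2 x ^+ 2)) t) (is_deriveZ' 2^-1 ds)) dr.
set l := (X in is_derive _ _ _ X -> _).
suff -> : l = 0 by [].
rewrite /l add0r (sum_pair_bool (fun k => hmom (X t) k * velocity (X t) k)) mulr_sumr -sumrB.
apply: big1 => i _.
have mi : m i != 0 by rewrite gt_eqF.
exact: energy_algebra.
Qed.
End flow.

(** The bound by a variable majorant, for the time integral of a competitor, again without
    measurability of [f]. *)
Lemma integral_dominated_nomeas d (T : measurableType d) (R : realType)
  (mu : {measure set T -> \bar R}) (D : set T) (f : T -> \bar R) (g : T -> R) (b : R) :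
  (\int[mu]_(x in D) (g x)%:E = b%:E)%E ->
  (forall x, D x -> (`|f x| <= (g x)%:E)%E) ->
  (`|\int[mu]_(x in D) f x| <= b%:E)%E.
Proof.
move=> ib fg.
have g0 x : D x -> (0 <= (g x)%:E)%E by move=> /fg; apply: le_trans; exact: abse_ge0.
have hp : (\int[mu]_(x in D) (f^\+ x) <= b%:E)%E.
  rewrite -ib; apply: ge0_le_integral_nomeas => x Dx //.
  by rewrite funeposE ge_max g0// andbT (le_trans _ (fg _ Dx))// lee_abs.
have hn : (\int[mu]_(x in D) (f^\- x) <= b%:E)%E.
  rewrite -ib; apply: ge0_le_integral_nomeas => x Dx //.
  by rewrite funenegE ge_max g0// andbT (le_trans _ (fg _ Dx))// -abseN lee_abs.
have hp0 : (0 <= \int[mu]_(x in D) (f^\+ x))%E by exact: integral_ge0.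
have hn0 : (0 <= \int[mu]_(x in D) (f^\- x))%E by exact: integral_ge0.
rewrite integralE; move: hp hn hp0 hn0.
case: (\int[mu]_(x in D) (f^\+ x))%E => //= a.
case: (\int[mu]_(x in D) (f^\- x))%E => //= a'.
rewrite !lee_fin => ? ? ? ?; rewrite ler_norml; apply/andP; split; lra.
Qed.

(** * Cut-offs in space and time *)

Section cutoffs.
Context {R : realType}.

(** The sign makes minus the derivative of [tcut] a nonnegative mollifying kernel on the time
    interval. *)
Lemma dsstep_ge0 (x : R) : 0 <= sstep^`()%classic x.
Proof.
have d0 (y : R) : is_derive y 1 (flat 0) (flat 2 y).
  by have := is_derive_flat 0 y; rewrite mul0r subr0.
have d1 : is_derive x 1 (fun y : R => flat 0 (1 - y)) (- flat 2 (1 - x)).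
  have hb := is_deriveB' (is_derive_cst' 1 x) (is_derive_id' x).
  have := @is_derive_comp' _ (flat 0) (fun y => 1 - y) x _ _ (d0 (1 - x)) hb.
  by rewrite sub0r mulrN1.
have dn := is_deriveD' (d0 x) d1.
have den := sstep_den x.
have dnz : (fun y => flat 0 y + flat 0 (1 - y)) x != 0 by rewrite gt_eqF.
have dV := @is_deriveV _ (fun y => flat 0 y + flat 0 (1 - y)) x _ 1 dnz dn.
have := is_deriveM' (d0 x) dV => /derive1_is ->.
rewrite /GRing.scale /=; move: den dnz => /=.
have := flat_ge0 0 x; have := flat_ge0 2 x.
have := flat_ge0 0 (1 - x); have := flat_ge0 2 (1 - x).
move: (flat 0 x) (flat 2 x) (flat 0 (1 - x)) (flat 2 (1 - x)) => a a' b b' b'0 b0 a'0 a0 ab abn.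
have -> : a' / (a + b) + a * (- (a + b) ^- 2 * (a' - b')) =
  (a' * b + a * b') / (a + b) ^+ 2 by field.
by rewrite divr_ge0 ?sqr_ge0// addr_ge0// mulr_ge0.
Qed.

(** The offset 2 puts the plateau at distance at most [rho] from [p] and the support within
    [2 * rho]. *)
Definition cut (p rho x : R) : R := sstep (2 + (x - p) / rho) * sstep (2 - (x - p) / rho).

Lemma smooth_affine (f : R -> R) (a b : R) : smooth f -> smooth (fun x => f (a * x + b)).
Proof. by move=> sf n; exact: Cn_affine. Qed.

Lemma smoothM (f g : R -> R) : smooth f -> smooth g -> smooth (fun x => f x * g x).
Proof. by move=> sf sg n; exact: CnM. Qed.

Lemma smooth_cut p rho : smooth (cut p rho).
Proof.
have := smoothM (smooth_affine rho^-1 (2 - p / rho) smooth_sstep)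
  (smooth_affine (- rho^-1) (2 + p / rho) smooth_sstep).
congr smooth; apply/funext => x; rewrite /cut; congr (sstep _ * sstep _); ring.
Qed.

Lemma cut1 p rho x : 0 < rho -> `|x - p| <= rho -> cut p rho x = 1.
Proof.
move=> r0; rewrite ler_norml => /andP[h1 h2].
have a1 : (x - p) / rho <= 1 by rewrite ler_pdivrMr// mul1r.
have a2 : -1 <= (x - p) / rho by rewrite ler_pdivlMr// mulN1r.
by rewrite /cut !sstep_ge1 ?mulr1//; lra.
Qed.

Lemma cut0 p rho x : 0 < rho -> 2 * rho <= `|x - p| -> cut p rho x = 0.
Proof.
move=> r0; rewrite ler_normr => /orP[h|h].
  have a1 : 2 <= (x - p) / rho by rewrite ler_pdivlMr.
  by rewrite /cut [X in _ * X]sstep_le0 ?mulr0//; lra.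
have a1 : 2 <= - ((x - p) / rho) by rewrite -mulNr ler_pdivlMr.
by rewrite /cut [X in X * _]sstep_le0 ?mul0r//; lra.
Qed.

Lemma cut_ge0 p rho x : 0 <= cut p rho x.
Proof. by rewrite mulr_ge0// sstep_ge0. Qed.

Lemma cut_le1 p rho x : cut p rho x <= 1.
Proof. by rewrite -[leRHS]mulr1 ler_pM ?sstep_ge0// sstep_le1. Qed.

Lemma dcut0 p rho x : 0 < rho -> `|x - p| < rho -> (cut p rho)^`()%classic x = 0.
Proof.
move=> r0 xp; apply: (@derive1_locally_cst _ _ 1 x (rho - `|x - p|)).
  by rewrite subr_gt0.
move=> y yx; apply: cut1 => //.
have := ler_distD x y p; lra.
Qed.

Lemma compact_cut p rho : 0 < rho -> compact_supp (cut p rho).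
Proof.
move=> r0; exists (2 * rho + `|p|) => x h; apply: cut0 => //.
have := lerB_dist x p; lra.
Qed.

(** The decay in [rho], uniform in [p], is what lets wide horizontal cut-offs suppress horizontal
    transport. *)
Lemma dcut_bound : exists2 K : R, 0 < K & forall p rho x, 0 < rho ->
  `|(cut p rho)^`()%classic x| <= K / rho.
Proof.
have [K K0 hK] := @dsstep_bound R; exists (2 * K); first by rewrite mulr_gt0.
move=> p rho x r0.
have da : is_derive x 1 (fun y => 2 + (y - p) / rho) rho^-1.
  have := is_deriveD' (is_derive_cst' 2 x) (is_deriveM'
    (is_deriveB' (is_derive_id' x) (is_derive_cst' p x)) (is_derive_cst' rho^-1 x)).
  by rewrite mulr0 addr0 add0r subr0 mul1r.
have db : is_derive x 1 (fun y => 2 - (y - p) / rho) (- rho^-1).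
  have := is_deriveB' (is_derive_cst' 2 x) (is_deriveM'
    (is_deriveB' (is_derive_id' x) (is_derive_cst' p x)) (is_derive_cst' rho^-1 x)).
  by rewrite mulr0 addr0 sub0r subr0 mul1r.
have ds y := smooth_is_derive y (@smooth_sstep R).
have h1 := @is_derive_comp' _ sstep (fun y => 2 + (y - p) / rho) x _ _ (ds _) da.
have h2 := @is_derive_comp' _ sstep (fun y => 2 - (y - p) / rho) x _ _ (ds _) db.
have := is_deriveM' h1 h2 => /derive1_is; rewrite -/(cut p rho) => ->.
have hb (a b c : R) : `|a| <= K -> 0 <= b -> b <= 1 -> `|c| = rho^-1 ->
    `|a * c * b| <= K / rho.
  move=> ha b0 b1 hc; rewrite !normrM hc (ger0_norm b0).
  rewrite -[leRHS]mulr1 ler_pM ?mulr_ge0 ?invr_ge0 ?(ltW r0)// ler_wpM2r// invr_ge0 ltW//.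
have rn : `|rho^-1| = rho^-1 by rewrite ger0_norm// invr_ge0 ltW.
have -> : 2 * K / rho = K / rho + K / rho by ring.
apply: le_trans (ler_normD _ _) _; apply: lerD.
  by apply: hb => //; [exact: sstep_ge0|exact: sstep_le1].
by rewrite mulrC; apply: hb => //; [exact: sstep_ge0|exact: sstep_le1|rewrite normrN].
Qed.

(** Compactly supported substitute for the coordinate function. *)
Definition xcut (rho x : R) : R := x * cut 0 rho x.

Lemma smooth_xcut rho : smooth (xcut rho).
Proof. by move=> n; apply: CnM; [exact: Cn_id|exact: smooth_cut]. Qed.

Lemma xcutE rho x : 0 < rho -> `|x| <= rho -> xcut rho x = x.
Proof. by move=> r0 h; rewrite /xcut cut1 ?mulr1// subr0. Qed.

Lemma dxcut rho x : 0 < rho -> `|x| < rho -> (xcut rho)^`()%classic x = 1.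
Proof.
move=> r0 xr; apply: derive1_is.
apply: (is_derive_near (g := fun y => y) (d := rho - `|x|) _ _ (is_derive_id' x)).
  by rewrite subr_gt0.
move=> y yx; apply: xcutE => //.
by have := ler_distD x y 0; rewrite !subr0; lra.
Qed.

Lemma compact_xcut rho : 0 < rho -> compact_supp (xcut rho).
Proof.
move=> r0; have [K hK] := compact_cut 0 r0; exists K => x /hK h.
by rewrite /xcut h mulr0.
Qed.

(* The factor [sstep (t + 2)] only makes the support compact; it is 1 for t >= -1. *)
Definition tcut (s eps t : R) : R := sstep (t + 2) * (1 - sstep ((t - s) / eps)).

Lemma smooth_tcut s eps : smooth (tcut s eps).
Proof.
move=> n; apply: CnM.
  have := Cn_affine 1 2 (@smooth_sstep R n).
  by under eq_fun do rewrite mul1r.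
apply: CnD; first exact: Cn_cst.
have := CnM (Cn_cst n (-1)) (Cn_affine eps^-1 (- (s / eps)) (@smooth_sstep R n)).
congr Cn; apply/funext => t; rewrite mulN1r; congr (- sstep _); ring.
Qed.

Lemma compact_tcut s eps : 0 < eps -> compact_supp (tcut s eps).
Proof.
move=> e0; exists (2 + `|s| + eps) => t; rewrite lter_normr => /orP[h|h].
  rewrite /tcut [X in 1 - X]sstep_ge1 ?subrr ?mulr0//.
  by rewrite ler_pdivlMr// mul1r; have := ler_norm s; lra.
rewrite /tcut sstep_le0 ?mul0r//.
by have := normr_ge0 s; lra.
Qed.

Lemma tcutE s eps t : 0 <= t -> tcut s eps t = 1 - sstep ((t - s) / eps).
Proof. by move=> t0; rewrite /tcut sstep_ge1 ?mul1r//; lra. Qed.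

Lemma dtcutE s eps t : 0 <= t ->
  (tcut s eps)^`()%classic t = - (sstep^`()%classic ((t - s) / eps) / eps).
Proof.
move=> t0; apply: derive1_is.
have da : is_derive t 1 (fun y => (y - s) / eps) eps^-1.
  have := is_deriveM' (is_deriveB' (is_derive_id' t) (is_derive_cst' s t)) (is_derive_cst' eps^-1 t).
  by rewrite mulr0 addr0 subr0 mul1r.
have h := @is_derive_comp' _ sstep (fun y => (y - s) / eps) t _ _
  (smooth_is_derive _ (@smooth_sstep R)) da.
have := is_deriveB' (is_derive_cst' 1 t) h; rewrite sub0r => hd.
apply: (is_derive_near (d := 1) _ _ hd) => // y.
rewrite ltr_norml => /andP[yt _]; rewrite /tcut sstep_ge1 ?mul1r//; lra.
Qed.

Lemma tcut_ge0 s eps t : 0 <= tcut s eps t.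
Proof. by rewrite mulr_ge0 ?sstep_ge0// subr_ge0 sstep_le1. Qed.

End cutoffs.

(** * Integrals over the time interval and mollification in time *)

Section interval_integral.
Context {R : realType} (T : R).
Hypothesis T0 : 0 < T.
Local Notation clamp := (clamp T).

(* Continuity on [0, T], stated for the extension of [f] by constants. *)
Definition ccl (f : R -> R) := continuous (fun s => f (clamp s)).

(** Composing with [clamp] leaves the integrand unchanged on the interval and makes integrability a
    consequence of [ccl]. *)
Definition Jint (f : R -> R) : R :=
  \int[@lebesgue_measure R]_(t in `[0%R, T]%classic) f (clamp t).

Lemma JintE f : ccl f ->
  (\int[@lebesgue_measure R]_(t in `[0%R, T]%classic) (f t)%:E = (Jint f)%:E)%E.
Proof.
move=> cf; rewrite integral_clamp /Jint /Rintegral fineK//.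
by apply: integrable_fin_num => //; exact: integrable_clamp.
Qed.

Lemma Jint_ext f g : (forall t, 0 <= t <= T -> f t = g t) -> Jint f = Jint g.
Proof. by move=> fg; apply: eq_Rintegral => t _; apply: fg; exact: clamp_in. Qed.

Lemma ccl_continuous f : continuous f -> ccl f.
Proof. by move=> cf; apply: continuous_comp_clamp => // t _; exact: cf. Qed.

Lemma cclD f g : ccl f -> ccl g -> ccl (fun t => f t + g t).
Proof. by move=> cf cg s; apply: cvgD; [exact: cf|exact: cg]. Qed.

Lemma cclB f g : ccl f -> ccl g -> ccl (fun t => f t - g t).
Proof. by move=> cf cg s; apply: cvgB; [exact: cf|exact: cg]. Qed.

Lemma cclM f g : ccl f -> ccl g -> ccl (fun t => f t * g t).
Proof. by move=> cf cg s; apply: cvgM; [exact: cf|exact: cg]. Qed.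

Lemma ccl_cst k : ccl (fun=> k). Proof. by move=> s; exact: cvg_cst. Qed.

Lemma JintD f g : ccl f -> ccl g -> Jint (fun t => f t + g t) = Jint f + Jint g.
Proof. by move=> cf cg; rewrite /Jint RintegralD//; exact: integrable_clamp. Qed.

Lemma JintB f g : ccl f -> ccl g -> Jint (fun t => f t - g t) = Jint f - Jint g.
Proof. by move=> cf cg; rewrite /Jint RintegralB//; exact: integrable_clamp. Qed.

Lemma JintZ k f : ccl f -> Jint (fun t => k * f t) = k * Jint f.
Proof. by move=> cf; rewrite /Jint RintegralZl//; exact: integrable_clamp. Qed.

Lemma Jint_le f g : ccl f -> ccl g -> (forall t, 0 <= t <= T -> f t <= g t) ->
  Jint f <= Jint g.
Proof.
move=> cf cg fg; apply: le_Rintegral => //; try exact: integrable_clamp.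
by move=> t _; apply: fg; exact: clamp_in.
Qed.

Lemma Jint_norm f g : ccl f -> ccl g -> (forall t, 0 <= t <= T -> `|f t| <= g t) ->
  `|Jint f| <= Jint g.
Proof.
move=> cf cg fg; rewrite ler_norml; apply/andP; split.
  rewrite -mulN1r -JintZ//; apply: Jint_le => //.
    by apply: cclM => //; exact: ccl_cst.
  by move=> t /fg; rewrite ler_norml mulN1r => /andP[].
by apply: Jint_le => // t /fg; rewrite ler_norml => /andP[].
Qed.

Lemma Jint_FTC (F f : R -> R) :
  (forall t : R, 0 <= t <= T -> is_derive t 1 F (f t)) -> ccl f ->
  Jint f = F T - F 0.
Proof.
by move=> dF cf; apply: EFin_inj; rewrite -(JintE cf) (FTC_clamp T0 dF cf).
Qed.

Lemma ccl_bounded f : ccl f -> exists2 B : R, 0 < B & forall t, 0 <= t <= T -> `|f t| <= B.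
Proof.
move=> cf.
have cf' : {within `[(0 : R), T], continuous (fun x => `|f (clamp x)|)}.
  apply: continuous_subspaceT => x; apply: (@continuous_comp _ _ _ (fun s => f (clamp s)) (@Num.norm R R)).
    exact: cf.
  exact: norm_continuous.
have [c _ hc] := EVT_max (ltW T0) cf'.
exists (`|f (clamp c)| + 1) => [|t tT]; first by rewrite ltr_wpDl.
have := hc t; rewrite in_itv/= tT clamp_id// => /(_ isT).
by move/le_trans; apply; rewrite lerDl.
Qed.

Lemma ccl_tcut s eps : ccl (tcut s eps).
Proof. apply: ccl_continuous; exact: smooth_continuous (smooth_tcut _ _). Qed.

Lemma ccl_dtcut s eps : ccl (tcut s eps)^`()%classic.
Proof. apply: ccl_continuous; exact: smooth_continuous (smooth_derive (smooth_tcut _ _)). Qed.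

Lemma tcut_at0 (s eps : R) : 0 <= s -> 0 < eps -> tcut s eps 0 = 1.
Proof.
move=> s0 e0; rewrite tcutE// sub0r sstep_le0 ?subr0//.
by rewrite mulNr oppr_le0 divr_ge0// ltW.
Qed.

Lemma tcut_atT (s eps : R) : 0 < eps -> s + eps <= T -> tcut s eps T = 0.
Proof.
move=> e0 sT; rewrite tcutE ?(ltW T0)// sstep_ge1 ?subrr//.
by rewrite ler_pdivlMr// mul1r; lra.
Qed.

Lemma Jint_dtcut (s eps : R) : 0 <= s -> 0 < eps -> s + eps <= T ->
  Jint (tcut s eps)^`()%classic = -1.
Proof.
move=> s0 e0 sT.
have dF (t : R) : 0 <= t <= T -> is_derive t 1 (tcut s eps) ((tcut s eps)^`()%classic t).
  by move=> _; exact: smooth_is_derive (smooth_tcut _ _).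
by rewrite (Jint_FTC dF (@ccl_dtcut s eps)) tcut_at0// tcut_atT// sub0r.
Qed.

Lemma mollify (q : R -> R) (s : R) : ccl q -> 0 <= s -> s < T ->
  forall e : R, 0 < e -> exists2 d : R, 0 < d & forall eps, 0 < eps -> eps <= d ->
    s + eps <= T /\
    `|Jint (fun t => (tcut s eps)^`()%classic t * q t) + q s| <= e.
Proof.
move=> cq s0 sT e e0.
have sI : 0 <= s <= T by rewrite s0 ltW.
have /continuous_ptP/(_ e e0)[d d0 hd] := cq s.
exists (Num.min (d / 2) (T - s)).
  by rewrite lt_min divr_gt0// subr_gt0.
move=> eps eps0; rewrite le_min => /andP[e1 e2].
have se : s + eps <= T by lra.
split=> //; have cd := @ccl_dtcut s eps.
have cD k := cclM cd (@ccl_cst k).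
have -> : q s = - Jint (fun t => (tcut s eps)^`()%classic t * q s).
  rewrite (_ : (fun t => _) = fun t => q s * (tcut s eps)^`()%classic t); last first.
    by apply/funext => t; rewrite mulrC.
  by rewrite JintZ// Jint_dtcut// mulrN1 opprK.
rewrite -JintB//; last exact: cclM.
(* Like [q s] above, [e] is written as an integral against the kernel, which reduces the estimate to
   a pointwise one. *)
have -> : e = Jint (fun t => - e * (tcut s eps)^`()%classic t).
  by rewrite JintZ// Jint_dtcut// mulrN1 opprK.
apply: Jint_norm.
- by apply: cclB => //; exact: cclM.
- by apply: cclM => //; exact: ccl_cst.
move=> t tT; have /andP[t0 _] := tT.
rewrite -mulrBr normrM dtcutE// normrN mulrNN.
have dn : 0 <= sstep^`()%classic ((t - s) / eps) / eps.
  by rewrite divr_ge0 ?dsstep_ge0// ltW.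
rewrite (ger0_norm dn) mulrC.
have [lt|ge] := ltP t s.
  rewrite dsstep_le0 ?mul0r ?mulr0//.
  by rewrite pmulr_llt0 ?invr_gt0// subr_lt0.
have [gt|le] := ltP (s + eps) t.
  rewrite dsstep_ge1 ?mul0r ?mulr0//.
  by rewrite ltr_pdivlMr// mul1r; lra.
apply: ler_wpM2r => //.
have := hd t; rewrite !clamp_id//; apply.
by rewrite ger0_norm; lra.
Qed.

(** Integrating by parts, the integral of [tcut] is minus that of [t] times its derivative, and
    [mollify] with [q t = t] at [s = 0] makes this small. *)
Lemma Jint_tcut_small : forall e : R, 0 < e -> exists2 d : R, 0 < d &
  forall eps, 0 < eps -> eps <= d -> Jint (tcut 0 eps) <= e.
Proof.
move=> e e0.
have cid : ccl (fun t => t) by exact: continuous_clamp.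
have [d d0 hd] := mollify cid (lexx 0) T0 e0.
exists d => // eps eps0 epsd; have [sT h] := hd _ eps0 epsd.
have ct := @ccl_tcut 0 eps; have cd := @ccl_dtcut 0 eps.
have : Jint (fun t => tcut 0 eps t + (tcut 0 eps)^`()%classic t * t) = 0.
  have dF (t : R) : 0 <= t <= T -> is_derive t 1 (fun t => t * tcut 0 eps t)
      (tcut 0 eps t + (tcut 0 eps)^`()%classic t * t).
    move=> _; have := is_deriveM' (is_derive_id' t) (smooth_is_derive t (smooth_tcut 0 eps)).
    by rewrite mul1r (mulrC t).
  have cf : ccl (fun t => tcut 0 eps t + (tcut 0 eps)^`()%classic t * t).
    by apply: cclD => //; exact: cclM.
  by rewrite (Jint_FTC dF cf) tcut_atT// mulr0 mul0r subrr.
rewrite JintD//; last exact: cclM.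
move: h; rewrite addr0 ler_norml => /andP[h _].
by move: (Jint _) (Jint _) h => a b; lra.
Qed.

(** Near a point [u] of [[0, T]] the difference quotients within the interval are bounded by
    [|g u| + 1]; [clamp_lip] carries the resulting continuity to the extension. *)
Lemma C1_ccl f : C1_on T f -> ccl f.
Proof.
move=> [g [_ hg]]; rewrite /ccl => t; apply/continuous_ptP => e e0.
have tT := clamp_in T0 t.
have := hg _ tT; set u := clamp t in tT *.
move=> /cvgrPdist_le/(_ 1 ltr01)/nbhs_ballP[d /= d0 hd].
pose K := `|g u| + 1.
have K0 : 0 < K by rewrite ltr_wpDl.
exists (Num.min d (e / K)); first by rewrite lt_min d0 divr_gt0.
move=> y; rewrite lt_min => /andP[y1 y2].
have l := clamp_lip T0 y t; rewrite -/u in l *.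
set v := clamp y in l *; have vT : 0 <= v <= T by exact: clamp_in.
have [->|vu] := eqVneq v u; first by rewrite subrr normr0 ltW.
have vu0 : v - u != 0 by rewrite subr_eq0.
have := hd v; rewrite -ball_normE /= distrC => /(_ (le_lt_trans l y1) (conj vT vu)) hq.
have : `|(f v - f u) / (v - u)| <= K.
  have := ler_distD (g u) ((f v - f u) / (v - u)) 0; rewrite !subr0.
  by rewrite (distrC _ (g u)) /K; lra.
rewrite normrM normfV ler_pdivrMr ?normr_gt0// => /le_trans; apply.
by rewrite mulrC -ler_pdivlMr//; apply: le_trans l (ltW y2).
Qed.

End interval_integral.

(** * Passage to the limit and a vanishing criterion by time tests *)

Section finite_minimum.
Context {R : realType}.

Lemma finite_positive_lb (I : finType) (d : I -> R) : (forall i, 0 < d i) ->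
  exists2 e : R, 0 < e & forall i, e <= d i.
Proof.
move=> d0; exists (\big[Num.min/1]_i d i).
  by elim/big_ind: _ => // x y x0 y0; rewrite lt_min x0.
by move=> i; rewrite (bigD1 i)//= ge_min lexx.
Qed.

Lemma small_mul_eq0 (C x : R) : (forall e : R, 0 < e -> `|x| <= C * e) -> x = 0.
Proof.
move=> h; apply/normr0_eq0/eqP; rewrite eq_le normr_ge0 andbT; apply/ler_addgt0Pr => e e0.
pose C' := `|C| + 1; have C0 : 0 < C' by rewrite ltr_wpDl.
rewrite add0r; apply: le_trans (h (e / C') _) _; first by rewrite divr_gt0.
rewrite mulrCA -[leRHS]mulr1 ler_wpM2l ?(ltW e0)// ler_pdivrMr// mul1r /C'.
by have := ler_norm C; lra.
Qed.

(** Extracts from the weak identity the value of a time integral not known beforehand to be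
    finite. *)
Lemma sube_EFin_eq (a x : R) (g : \bar R) : (a%:E - g = x%:E)%E -> g = (a - x)%:E.
Proof. by case: g => //= g [<-]; congr EFin; ring. Qed.

Lemma sube_congr (a a' b b' : \bar R) : a = a' -> b = b' -> (a - b = a' - b')%E.
Proof. by move=> -> ->. Qed.

End finite_minimum.

Section ccl_closure.
Context {R : realType} (T : R).
Hypothesis T0 : 0 < T.

Lemma ccl_comp (a f : R -> R) : continuous a -> ccl T f -> ccl T (fun t => a (f t)).
Proof.
move=> ca cf t; apply: (@continuous_comp _ _ _ (fun s => f (clamp T s)) a).
  exact: cf.
exact: ca.
Qed.

Lemma ccl_sum (I : finType) (F : I -> R -> R) :
  (forall i, ccl T (F i)) -> ccl T (fun t => \sum_i F i t).
Proof. by move=> h; exact: continuous_sum_fun. Qed.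

Lemma Jint_ge0 (f : R -> R) : ccl T f -> (forall t, 0 <= f t) -> 0 <= Jint T f.
Proof.
move=> cf f0; rewrite -[X in X <= _](mul0r (Jint T f)) -JintZ//.
apply: Jint_le => //; first by apply: cclM => //; exact: ccl_cst.
by move=> t _; rewrite mul0r.
Qed.

(** The requirement [s + eps <= T] keeps the time tests away from [T], where the value is recovered
    by continuity. *)
Lemma ccl_endpoint (f : R -> R) (k : R) : ccl T f ->
  (forall t : R, 0 <= t -> t < T -> f t = k) -> forall t : R, 0 <= t <= T -> f t = k.
Proof.
move=> cf fk t /andP[t0]; rewrite le_eqVlt => /orP[/eqP->|]; last exact: fk.
have T0' := T0.
have TI : 0 <= T <= T by rewrite lexx ltW.
apply/eqP; rewrite -subr_eq0; apply/eqP; apply: (@small_mul_eq0 _ 1) => e e0.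
have /continuous_ptP/(_ e e0)[d d0 hd] := cf T.
pose s := T - Num.min (d / 2) T.
have mn : 0 < Num.min (d / 2) T by rewrite lt_min divr_gt0.
have m1 : Num.min (d / 2) T <= d / 2 by rewrite ge_min lexx.
have m2 : Num.min (d / 2) T <= T by rewrite ge_min lexx orbT.
have s0 : 0 <= s by rewrite /s; lra.
have sT : s < T by rewrite /s; lra.
have cs : clamp T s = s by rewrite clamp_id// s0 ltW.
have := hd s; rewrite cs (clamp_id TI) (fk s s0 sT) => h.
rewrite distrC mul1r; apply: h.
by rewrite /s addrC addKr normrN gtr0_norm//; lra.
Qed.

(** The fundamental lemma of the calculus of variations for this family of time tests. *)
Lemma tcut_test_eq0 (q : R -> R) : ccl T q ->
  (forall s eps : R, 0 <= s -> 0 < eps -> s + eps <= T ->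
     Jint T (fun t => (tcut s eps)^`()%classic t * q t) = 0) ->
  forall t : R, 0 <= t <= T -> q t = 0.
Proof.
move=> cq h; apply: ccl_endpoint => // t t0 tT.
apply: (@small_mul_eq0 _ 1) => e e0.
have [d d0 hd] := mollify T0 cq t0 tT e0.
have [te] := hd d d0 (lexx d).
by rewrite h// add0r mul1r.
Qed.

End ccl_closure.

(** * Consequences of the weak formulation for an arbitrary solution *)

Section competitor.
Context {R : realType} (Om : set (vec3 R)) (M : R).
Hypothesis mOm : measurable Om.
Hypothesis OmM : forall x, Om x -> `|c1 x| <= M /\ `|c2 x| <= M /\ `|c3 x| <= M.
Hypothesis Om1 : @leb3 R Om = 1%E.
Context (T : R).
Hypothesis T0 : 0 < T.
Context (Nb : nat) (mb : 'I_Nb -> R) (zb : 'I_Nb -> vec3 R).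
Context (N : nat) (m : 'I_N -> R) (z : 'I_N -> R -> vec3 R).
Hypothesis z1 : forall i, ccl T (fun t => c1 (z i t)).
Hypothesis z2 : forall i, ccl T (fun t => c2 (z i t)).
Hypothesis z3 : forall i, ccl T (fun t => c3 (z i t)).
Hypothesis zw : weak_geostrophic Om T mb zb m z.
Local Notation J := (Jint T).

Definition spat (a1 a2 a3 : R -> R) (y : vec3 R) : R := a1 (c1 y) * a2 (c2 y) * a3 (c3 y).

Definition spatm a1 a2 a3 t : R := \sum_i m i * spat a1 a2 a3 (z i t).

Definition spatg a1 a2 a3 t : R := \sum_i m i *
  (c1 (z i t) * spat a1 a2^`()%classic a3 (z i t) -
   c2 (z i t) * spat a1^`()%classic a2 a3 (z i t)).

Lemma ccl_spat a1 a2 a3 i : continuous a1 -> continuous a2 -> continuous a3 ->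
  ccl T (fun t => spat a1 a2 a3 (z i t)).
Proof.
by move=> k1 k2 k3; apply: cclM; [apply: cclM|]; apply: ccl_comp.
Qed.

Lemma ccl_spatm a1 a2 a3 : smooth a1 -> smooth a2 -> smooth a3 -> ccl T (spatm a1 a2 a3).
Proof.
move=> s1 s2 s3; apply: ccl_sum => i; apply: cclM; first exact: ccl_cst.
by apply: ccl_spat; exact: smooth_continuous.
Qed.

Lemma ccl_spatg a1 a2 a3 : smooth a1 -> smooth a2 -> smooth a3 -> ccl T (spatg a1 a2 a3).
Proof.
move=> s1 s2 s3; apply: ccl_sum => i; apply: cclM; first exact: ccl_cst.
have d1 := smooth_derive s1; have d2 := smooth_derive s2.
by apply: cclB; apply: cclM => //; apply: ccl_spat; exact: smooth_continuous.
Qed.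

Lemma dot3_grad_tensor a1 a2 a3 b (x y : vec3 R) t : smooth a1 -> smooth a2 ->
  dot3 (Jmul x) (grad_ (tensor a1 a2 a3 b) y t) =
  b t * (c1 x * spat a1 a2^`()%classic a3 y - c2 x * spat a1^`()%classic a2 a3 y).
Proof.
move=> s1 s2; rewrite /dot3 /Jmul /grad_ /c1 /c2 /c3 /= d1_tensor// d2_tensor//.
by rewrite /tensor /spat /c1 /c2 /c3; ring.
Qed.

(** The identity is solved for the [gradB] term, the only one without known regularity. The time
    cut-off is 1 at 0 and 0 at [T], so only the initial measure contributes at the boundary. *)
Lemma weak_tensor a1 a2 a3 (s eps : R) : smooth a1 -> smooth a2 -> smooth a3 ->
  compact_supp a1 -> compact_supp a2 -> compact_supp a3 ->
  0 <= s -> 0 < eps -> s + eps <= T ->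
  (\int[@lebesgue_measure R]_(t in `[0%R, T]%classic)
     (\int[@leb3 R]_(x in Om)
       (dot3 (Jmul x) (grad_ (tensor a1 a2 a3 (tcut s eps))
         (gradB Om (disc m (fun i => z i t)) x) t))%:E) =
   (J (fun t => (tcut s eps)^`()%classic t * spatm a1 a2 a3 t) +
    J (fun t => tcut s eps t * spatg a1 a2 a3 t) +
    \sum_j mb j * spat a1 a2 a3 (zb j))%:E)%E.
Proof.
move=> s1 s2 s3 k1 k2 k3 s0 e0 sT.
have sb := @smooth_tcut R s eps.
have ct := @ccl_tcut R T T0 s eps; have cd := @ccl_dtcut R T T0 s eps.
have cf := ccl_spatm s1 s2 s3; have cg := ccl_spatg s1 s2 s3.
have := zw (test_tensor s1 s2 s3 sb k1 k2 k3 (compact_tcut s e0)).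
have -> : (\int[@lebesgue_measure R]_(t in `[0%R, T]%classic)
   (\sum_(i < N) m i * (dt_ (tensor a1 a2 a3 (tcut s eps)) (z i t) t +
     dot3 (Jmul (z i t)) (grad_ (tensor a1 a2 a3 (tcut s eps)) (z i t) t)))%:E =
   (J (fun t => (tcut s eps)^`()%classic t * spatm a1 a2 a3 t) +
    J (fun t => tcut s eps t * spatg a1 a2 a3 t))%:E)%E.
  rewrite -JintD; [|exact: cclM|exact: cclM].
  rewrite -JintE; last by apply: cclD; exact: cclM.
  apply: eq_integral => t _; congr EFin; rewrite !mulr_sumr -big_split; apply: eq_bigr => i _ /=.
  rewrite dt_tensor// dot3_grad_tensor// /tensor -/(spat a1 a2 a3 (z i t)); ring.
have -> : \sum_(i < N) m i * tensor a1 a2 a3 (tcut s eps) (z i T) T = 0.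
  by apply: big1 => i _; rewrite /tensor (tcut_atT T0)// !mulr0.
have -> : \sum_(j < Nb) mb j * tensor a1 a2 a3 (tcut s eps) (zb j) 0 =
    \sum_j mb j * spat a1 a2 a3 (zb j).
  by apply: eq_bigr => j _; rewrite /tensor tcut_at0// mulr1.
move: (\sum_j _) (J _) (J _) => A B C.
move=> /sube_EFin_eq; rewrite sub0r opprK; exact.
Qed.

Lemma spat_bound1 a1 a2 a3 (D : R) y : (forall x, `|a1 x| <= D) ->
  (forall x, 0 <= a2 x <= 1) -> (forall x, 0 <= a3 x <= 1) -> `|spat a1 a2 a3 y| <= D.
Proof.
move=> h1 h2 h3; rewrite /spat !normrM.
have /andP[? ?] := h2 (c2 y); have /andP[? ?] := h3 (c3 y).
rewrite (ger0_norm (x := a2 _))// (ger0_norm (x := a3 _))//.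
have D0 : 0 <= D := le_trans (normr_ge0 _) (h1 0).
rewrite -[leRHS]mulr1 ler_pM ?mulr_ge0// -[leRHS]mulr1 ler_pM//.
Qed.

Lemma spat_bound2 a1 a2 a3 (D : R) y : (forall x, 0 <= a1 x <= 1) ->
  (forall x, `|a2 x| <= D) -> (forall x, 0 <= a3 x <= 1) -> `|spat a1 a2 a3 y| <= D.
Proof.
move=> h1 h2 h3; rewrite /spat (mulrC (a1 _)).
exact: (@spat_bound1 a2 a1 a3 D ((c2 y, c1 y), c3 y)).
Qed.

(** The third row of [J] is zero, so the vertical cut-off is never differentiated and [delta] does
    not enter the bound, while each horizontal derivative brings [1 / rho]. *)
Lemma weak_cut_bound : exists2 K : R, 0 < K &
  forall (p1 p2 p3 rho delta s eps : R), 0 < rho -> 0 < delta ->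
  0 <= s -> 0 < eps -> s + eps <= T ->
  `|J (fun t => (tcut s eps)^`()%classic t * spatm (cut p1 rho) (cut p2 rho) (cut p3 delta) t) +
    J (fun t => tcut s eps t * spatg (cut p1 rho) (cut p2 rho) (cut p3 delta) t) +
    \sum_j mb j * spat (cut p1 rho) (cut p2 rho) (cut p3 delta) (zb j)| <=
  K / rho * J (tcut s eps).
Proof.
have [K K0 hK] := @dcut_bound R.
pose M' := `|M| + 1.
have M0 : 0 < M' by rewrite ltr_wpDl.
exists (2 * M' * K); first by rewrite !mulr_gt0.
move=> p1 p2 p3 rho delta s eps r0 d0 s0 e0 sT.
have sc p q := @smooth_cut R p q; have kc p q q0 := @compact_cut R p q q0.
have := weak_tensor (sc p1 rho) (sc p2 rho) (sc p3 delta)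
  (kc p1 rho r0) (kc p2 rho r0) (kc p3 delta d0) s0 e0 sT.
move: (J (fun t => _ * spatm _ _ _ t) + _ + _) => X hX.
have ct := @ccl_tcut R T T0 s eps.
rewrite -lee_fin -abse_EFin -hX.
have cst01 (p q : R) x : 0 <= cut p q x <= 1 by rewrite cut_ge0 cut_le1.
apply: (@integral_dominated_nomeas _ _ R (@lebesgue_measure R) _ _
  (fun t : R => 2 * M' * K / rho * tcut s eps t)).
  by rewrite JintE ?JintZ//; apply: cclM => //; exact: ccl_cst.
move=> t _.
have -> : ((2 * M' * K / rho * tcut s eps t)%:E = (2 * M' * K / rho * tcut s eps t * 1)%:E)%E.
  by rewrite mulr1.
have b0 := tcut_ge0 s eps t.
apply: integral_bound_nomeas => //.
  apply: mulr_ge0 => //; rewrite divr_ge0 ?(ltW r0)// mulr_ge0 ?(ltW K0)//.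
  by rewrite mulr_ge0// ltW.
move=> x Ox; rewrite lee_fin dot3_grad_tensor//.
have [x1 [x2 _]] := OmM Ox.
have mM : M <= M' by rewrite /M'; have := ler_norm M; lra.
rewrite normrM (ger0_norm b0) mulrC ler_wpM2r//.
apply: le_trans (ler_normB _ _) _.
have -> : 2 * M' * K / rho = M' * (K / rho) + M' * (K / rho) by ring.
rewrite (normrM (c1 x)) (normrM (c2 x)); apply: lerD; apply: ler_pM => //.
- exact: le_trans x1 mM.
- by apply: spat_bound2 => // x'; exact: hK.
- exact: le_trans x2 mM.
- by apply: spat_bound1 => // x'; exact: hK.
Qed.

(** Take [s = 0] and let [eps] tend to 0: the first term tends to minus the initial value of
    [spatm], while the [spatg] term and the error bound are controlled by the integral of [tcut],
    which tends to 0. *)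
Lemma initial_spat (p1 p2 p3 delta : R) : 0 < delta ->
  spatm (cut p1 delta) (cut p2 delta) (cut p3 delta) 0 =
  \sum_j mb j * spat (cut p1 delta) (cut p2 delta) (cut p3 delta) (zb j).
Proof.
move=> d0; have [K K0 hK] := weak_cut_bound.
have sc p q := @smooth_cut R p q.
have cf := ccl_spatm (sc p1 delta) (sc p2 delta) (sc p3 delta).
have cg := ccl_spatg (sc p1 delta) (sc p2 delta) (sc p3 delta).
move: hK => /(_ p1 p2 p3 delta delta) hK.
move: (spatm _ _ _) (spatg _ _ _) (\sum_j _) cf cg hK => f g fb cf cg hK.
have [B B0 hB] := ccl_bounded T0 cg.
apply/eqP; rewrite -subr_eq0; apply/eqP.
apply: (@small_mul_eq0 _ (1 + (K / delta + B))) => e e0.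
have T0' := T0.
have [d1 d10 h1] := mollify T0 cf (lexx 0) T0 e0.
have [d2 d20 h2] := Jint_tcut_small T0 e0.
pose eps := Num.min d1 d2.
have eps0 : 0 < eps by rewrite lt_min d10.
have [eT hf] := h1 eps eps0 ltac:(by rewrite ge_min lexx).
have hb := h2 eps eps0 ltac:(by rewrite ge_min lexx orbT).
have ct := @ccl_tcut R T T0 0 eps.
have := hK 0 eps d0 d0 (lexx 0) eps0 eT.
have hg : `|J (fun t => tcut 0 eps t * g t)| <= B * J (tcut 0 eps).
  rewrite -JintZ//; apply: Jint_norm => //; first exact: cclM.
    by apply: cclM => //; exact: ccl_cst.
  move=> t tT; rewrite normrM (ger0_norm (tcut_ge0 _ _ _)) mulrC.
  by rewrite ler_wpM2r ?tcut_ge0// hB.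
have Jb0 : 0 <= J (tcut 0 eps).
  by apply: Jint_ge0 => // t; exact: tcut_ge0.
have hKb : (K / delta + B) * J (tcut 0 eps) <= (K / delta + B) * e.
  by rewrite ler_wpM2l// addr_ge0// ?divr_ge0 ?ltW.
move: hf hg hKb.
move: (J (fun t => _ * f t)) (J (fun t => _ * g t)) (J (tcut 0 eps)) (K / delta) (f 0).
move=> A C b kd f0 hf hg hKb hw.
have -> : f0 - fb = (A + f0) + C - (A + C + fb) by ring.
apply: le_trans (ler_normB _ _) _.
apply: le_trans (lerD (ler_normD _ _) (lexx _)) _.
rewrite mulrDl mul1r -addrA; apply: lerD => //.
apply: le_trans hKb; rewrite mulrDl addrC; exact: lerD.
Qed.

Lemma trajectory_bounded : exists2 Z : R, 0 < Z & (forall i (t : R), 0 <= t <= T ->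
  `|c1 (z i t)| < Z /\ `|c2 (z i t)| < Z) /\
  (forall j, `|c1 (zb j)| < Z /\ `|c2 (zb j)| < Z).
Proof.
have h i : exists B : R, 0 < B /\ forall t : R, 0 <= t <= T ->
    `|c1 (z i t)| <= B /\ `|c2 (z i t)| <= B.
  have [B1 B10 h1] := ccl_bounded T0 (@z1 i); have [B2 B20 h2] := ccl_bounded T0 (@z2 i).
  exists (B1 + B2); split=> [|t tT]; first by rewrite addr_gt0.
  by have := h1 t tT; have := h2 t tT; split; lra.
have [B hB] := choice h.
pose Zb := \sum_j (`|c1 (zb j)| + `|c2 (zb j)|).
have Zb0 : 0 <= Zb by apply: sumr_ge0 => j _; exact: addr_ge0.
have S0 : 0 <= \sum_i B i by apply: sumr_ge0 => i _; rewrite ltW//; case: (hB i).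
exists (\sum_i B i + Zb + 1); first by rewrite ltr_wpDl// addr_ge0.
split=> [i t tT|j].
  have [_ /(_ t tT)[h1 h2]] := hB i.
  have le : B i <= \sum_i B i.
    by rewrite (bigD1 i)//= lerDl sumr_ge0// => k _; rewrite ltW//; case: (hB k).
  by split; lra.
have le : `|c1 (zb j)| + `|c2 (zb j)| <= Zb.
  by rewrite /Zb (bigD1 j)//= lerDl sumr_ge0// => k _; rewrite addr_ge0.
by have := normr_ge0 (c1 (zb j)); have := normr_ge0 (c2 (zb j)); split; lra.
Qed.

(* Letting the horizontal cut-off radius tend to infinity removes the horizontal
   transport, so the distribution of the heights is conserved. *)
Lemma height_moment (p delta t : R) : 0 < delta -> 0 <= t <= T ->
  \sum_i m i * cut p delta (c3 (z i t)) = \sum_j mb j * cut p delta (c3 (zb j)).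
Proof.
move=> d0; have [K K0 hK] := weak_cut_bound.
have [Z Z0 [hZ hZb]] := trajectory_bounded.
have sc p q := @smooth_cut R p q.
pose q t := \sum_i m i * cut p delta (c3 (z i t)) - \sum_j mb j * cut p delta (c3 (zb j)).
have cF : ccl T (fun t => \sum_i m i * cut p delta (c3 (z i t))).
  apply: ccl_sum => i; apply: cclM; first exact: ccl_cst.
  by apply: ccl_comp => //; exact: smooth_continuous.
have cq : ccl T q by apply: cclB => //; exact: ccl_cst.
move=> tT; suff : q t = 0 by move/eqP; rewrite subr_eq0 => /eqP.
apply: (tcut_test_eq0 T0 cq _ tT) => {t tT} s eps s0 eps0 sT.
have cd := @ccl_dtcut R T T0 s eps; have ct := @ccl_tcut R T T0 s eps.
apply: (@small_mul_eq0 _ (K * J (tcut s eps))) => e e0.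
(* At least [Z], so that the horizontal cut-offs are 1 and locally constant along the trajectories;
   at least [1 / e], so that [K / rho <= K * e]. *)
pose rho := Num.max Z e^-1.
have r0 : 0 < rho by rewrite lt_max Z0.
have cut1' x : `|x| < Z -> cut 0 rho x = 1.
  by move=> xZ; apply: cut1 => //; rewrite subr0 ltW// (lt_le_trans xZ)// le_max lexx.
have dcut0' x : `|x| < Z -> (cut 0 rho)^`()%classic x = 0.
  by move=> xZ; apply: dcut0 => //; rewrite subr0 (lt_le_trans xZ)// le_max lexx.
have := hK 0 0 p rho delta s eps r0 d0 s0 eps0 sT.
rewrite (@Jint_ext _ _ T0 (fun t => tcut s eps t * spatg (cut 0 rho) (cut 0 rho) (cut p delta) t)
  (fun t => 0 * tcut s eps t)); last first.
  move=> t tT; rewrite mul0r /spatg big1 ?mulr0// => i _.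
  have [h1 h2] := hZ i t tT.
  by rewrite /spat !dcut0'// !(mulr0, mul0r) subrr mulr0.
rewrite JintZ// mul0r addr0.
rewrite (@Jint_ext _ _ T0 _ (fun t => (tcut s eps)^`()%classic t *
    \sum_i m i * cut p delta (c3 (z i t)))); last first.
  move=> t tT; congr (_ * _); apply: eq_bigr => i _; have [h1 h2] := hZ i t tT.
  by rewrite /spat !cut1'// !mul1r.
under eq_bigr => j _ do rewrite /spat (cut1' _ (hZb j).1) (cut1' _ (hZb j).2) !mul1r.
have -> : J (fun t => (tcut s eps)^`()%classic t * q t) =
  J (fun t => (tcut s eps)^`()%classic t * \sum_i m i * cut p delta (c3 (z i t))) +
  \sum_j mb j * cut p delta (c3 (zb j)).
  rewrite (@Jint_ext _ _ T0 _ (fun t => (tcut s eps)^`()%classic t *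
    (\sum_i m i * cut p delta (c3 (z i t))) -
    (\sum_j mb j * cut p delta (c3 (zb j))) * (tcut s eps)^`()%classic t)); last first.
    by move=> t _; rewrite mulrBr [X in _ - X]mulrC.
  rewrite JintB ?JintZ ?Jint_dtcut ?mulrN1 ?opprK//; first exact: cclM.
  by apply: cclM => //; exact: ccl_cst.
move/le_trans; apply; rewrite mulrAC ler_wpM2l//.
  by rewrite mulr_ge0 ?(ltW K0)// Jint_ge0// => t; exact: tcut_ge0.
by rewrite invf_ple ?posrE// le_max lexx orbT.
Qed.

Hypothesis m_gt0 : forall i, 0 < m i.
Hypothesis mb_gt0 : forall j, 0 < mb j.

(** Otherwise a narrow cut-off around this height would see the positive mass [m i] at time [t] and
    none of the initial mass. *)
Lemma height_in i (t : R) : 0 <= t <= T -> exists j, c3 (z i t) = c3 (zb j).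
Proof.
move=> tT; apply: contrapT => no.
pose d j := `|c3 (zb j) - c3 (z i t)| / 2.
have d0 j : 0 < d j.
  by rewrite divr_gt0// normr_gt0 subr_eq0; apply/eqP => e; apply: no; exists j.
have [e e0 he] := finite_positive_lb d0.
have := height_moment (c3 (z i t)) e0 tT.
rewrite [RHS]big1; last first.
  move=> j _; rewrite cut0 ?mulr0//.
  by have := he j; rewrite /d ler_pdivlMr// mulrC.
rewrite (bigD1 i)//= cut1 ?subrr ?normr0 ?(ltW e0)// mulr1 => h.
have s0 : 0 <= \sum_(k < N | k != i) m k * cut (c3 (z i t)) e (c3 (z k t)).
  by apply: sumr_ge0 => k _; rewrite mulr_ge0 ?cut_ge0// ltW.
by have := m_gt0 i; lra.
Qed.

Context (r : R).
Hypothesis r0 : 0 < r.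
Hypothesis gzb : gap r zb.

(** Heights vary continuously within a finite set whose points are at least [r] apart. *)
Lemma height_constant i (t : R) : 0 <= t <= T -> c3 (z i t) = c3 (z i 0).
Proof.
move=> tT; apply: contrapT => ne; have /andP[t0 tT'] := tT.
have I0 : 0 <= (0 : R) <= T by rewrite lexx ltW.
have [j hj] := height_in i tT; have [k hk] := height_in i I0.
have jk : j != k by apply/eqP => jk; apply: ne; rewrite hj hk jk.
have := gzb jk; rewrite -hj -hk => g; have r0' := r0.
pose f s := c3 (z i (clamp T s)).
have cf : {within `[0, t], continuous f}.
  by apply: continuous_subspaceT => x; exact: z3.
have f0 : f 0 = c3 (z i 0) by rewrite /f clamp_id.
have ft : f t = c3 (z i t) by rewrite /f clamp_id.
(* A moving height would cross [v], at distance [r / 2] from an initial height and hence itself not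
   an initial height. *)
pose v := if c3 (z i 0) <= c3 (z i t) then c3 (z i 0) + r / 2 else c3 (z i 0) - r / 2.
have hv : Num.min (f 0) (f t) <= v <= Num.max (f 0) (f t).
  rewrite f0 ft ge_min le_max /v; move: g; case: ifP => [le|/negbT]; last rewrite -ltNge => lt.
    rewrite ger0_norm ?subr_ge0// => g.
    by apply/andP; split; apply/orP; [left|right]; lra.
  rewrite ltr0_norm ?subr_lt0// => g.
  by apply/andP; split; apply/orP; [right|left]; lra.
have [c] := IVT t0 cf hv; rewrite in_itv/= => /andP[c0 ct] fc.
have cI : 0 <= c <= T by rewrite c0 (le_trans ct).
have [l hl] := height_in i cI.
have vl : v = c3 (zb l) by rewrite -hl -fc /f clamp_id.
have dv : `|c3 (zb l) - c3 (zb k)| = r / 2.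
  rewrite -vl -hk /v; case: ifP => _; rewrite addrC addKr ?normrN gtr0_norm//; lra.
have [lk|lk] := eqVneq l k.
  by move: dv; rewrite lk subrr normr0; lra.
by have := gzb lk; rewrite dv; lra.
Qed.

(** A cut-off around [p] narrower than half the distance to every other atom acts on both measures
    as the indicator of [p]. *)
Lemma initial_mass (p : vec3 R) :
  \sum_i m i * (z i 0 == p)%:R = \sum_j mb j * (zb j == p)%:R.
Proof.
pose dist (x : vec3 R) := Num.max (Num.max `|c1 x - c1 p| `|c2 x - c2 p|) `|c3 x - c3 p|.
pose d (x : vec3 R) := if x == p then 1 else dist x / 2.
have d0 x : 0 < d x.
  rewrite /d; case: eqP => // ne; rewrite divr_gt0// /dist !lt_max !normr_gt0 !subr_eq0.
  rewrite -!negb_and; apply/negP => /andP[/andP[/eqP e1 /eqP e2] /eqP e3]; apply: ne.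
  move: e1 e2 e3; rewrite /c1 /c2 /c3; case: (x) (p) => [[x1 x2] x3] [[q1 q2] q3] /=.
  by move=> -> -> ->.
have [e1 e10 h1] := finite_positive_lb (fun i => d0 (z i 0)).
have [e2 e20 h2] := finite_positive_lb (fun j => d0 (zb j)).
pose e := Num.min e1 e2.
have e0 : 0 < e by rewrite lt_min e10.
have key x : e <= d x -> spat (cut (c1 p) e) (cut (c2 p) e) (cut (c3 p) e) x = (x == p)%:R.
  rewrite /d /spat; case: eqP => [-> _|_].
    by rewrite !cut1 ?subrr ?normr0 ?(ltW e0)// !mulr1.
  rewrite ler_pdivlMr// mulrC /dist !le_max -orbA => /or3P[] h.
  - by rewrite cut0// !mul0r.
  - by rewrite (cut0 (p := c2 p))// mulr0 mul0r.
  - by rewrite (cut0 (p := c3 p))// mulr0.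
have := initial_spat (c1 p) (c2 p) (c3 p) e0; rewrite /spatm.
under eq_bigr => i _ do rewrite key ?(le_trans _ (h1 i)) ?ge_min ?lexx//.
move=> ->; apply: eq_bigr => j _.
by rewrite key// (le_trans _ (h2 j))// ge_min lexx orbT.
Qed.

Hypothesis z_inj : forall i j, i != j -> z i 0 != z j 0.
Hypothesis zb_inj : forall i j, i != j -> zb i != zb j.

(** Positive masses and distinct atoms on both sides let equality of the initial measures determine
    the labels in each direction. *)
Lemma initial_matching : exists sg : 'I_Nb -> 'I_N,
  [/\ bijective sg, forall j, m (sg j) = mb j & forall j, z (sg j) 0 = zb j].
Proof.
have single (n : nat) (w : 'I_n -> R) (y : 'I_n -> vec3 R) i :
    (forall i j, i != j -> y i != y j) -> \sum_k w k * (y k == y i)%:R = w i.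
  move=> yi; rewrite (bigD1 i)//= eqxx mulr1 big1 ?addr0// => k ki.
  by rewrite (negbTE (yi _ _ ki)) mulr0.
have ex (n n' : nat) (w : 'I_n -> R) (y : 'I_n -> vec3 R) (w' : 'I_n' -> R) (y' : 'I_n' -> vec3 R) :
    (forall p, \sum_k w k * (y k == p)%:R = \sum_k w' k * (y' k == p)%:R) ->
    (forall i, 0 < w' i) -> (forall i j, i != j -> y' i != y' j) ->
    forall j, exists i, y i = y' j.
  move=> h w0 yi j; apply: contrapT => no.
  have := h (y' j); rewrite single// big1 => [e|k _].
    by have := w0 j; rewrite -e ltxx.
  by case: eqP => [e|]; rewrite ?mulr0//; case: no; exists k.
have [sg hs] := choice (ex _ _ _ _ _ _ initial_mass mb_gt0 zb_inj).
have [tau ht] := choice (ex _ _ _ _ _ _ (fun p => esym (initial_mass p)) m_gt0 z_inj).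
exists sg; split=> //.
  exists tau => [j|i]; apply: contrapT => /eqP ne.
    by have := zb_inj ne; rewrite ht hs eqxx.
  by have := z_inj ne; rewrite hs ht eqxx.
move=> j; have := initial_mass (zb j); rewrite (single _ mb zb)// => <-.
by rewrite -(hs j) single.
Qed.

(** Labels enter the weak formulation only through sums over atoms and through [disc], on which
    [gradB] depends. *)
Lemma weak_reindex (sg : 'I_Nb -> 'I_N) (y : 'I_Nb -> R -> vec3 R) : bijective sg ->
  (forall j, m (sg j) = mb j) ->
  (forall j (t : R), 0 <= t <= T -> z (sg j) t = y j t) ->
  weak_geostrophic Om T mb zb mb y /\
  (forall t : R, 0 <= t <= T -> disc m (fun i => z i t) = disc mb (fun j => y j t)).
Proof.
move=> bsg msg zy.
have sumE (F : 'I_N -> R) : \sum_i F i = \sum_j F (sg j) by exact: reindex (onW_bij _ bsg).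
have dE (t : R) : 0 <= t <= T -> disc m (fun i => z i t) = disc mb (fun j => y j t).
  by move=> tT; apply/funext => A; rewrite /disc sumE; apply: eq_bigr => j _; rewrite msg zy.
split=> // phi tphi.
have TT : 0 <= T <= T by rewrite lexx ltW.
rewrite (_ : \sum_(i < Nb) mb i * phi (y i T) T = \sum_(i < N) m i * phi (z i T) T); last first.
  by rewrite [RHS]sumE; apply: eq_bigr => j _; rewrite msg zy.
rewrite -(zw tphi).
have -> : (\int[@lebesgue_measure R]_(t in `[0%R, T]%classic) (\sum_(i < Nb) mb i *
    (dt_ phi (y i t) t + dot3 (Jmul (y i t)) (grad_ phi (y i t) t)))%:E =
  \int[@lebesgue_measure R]_(t in `[0%R, T]%classic) (\sum_(i < N) m i *
    (dt_ phi (z i t) t + dot3 (Jmul (z i t)) (grad_ phi (z i t) t)))%:E)%E.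
  apply: eq_integral => t /set_mem/=; rewrite in_itv/= => tT; congr EFin.
  by rewrite [RHS]sumE; apply: eq_bigr => j _; rewrite msg zy.
apply: sube_congr; first by [].
apply: eq_integral => t /set_mem/=; rewrite in_itv/= => tT.
by rewrite (dE _ tT).
Qed.

End competitor.

Lemma ode_test_algebra (R : fieldType) (m b u v x1 x2 h1 h2 : R) : m != 0 ->
  b * (m * (v * x1 - u * x2)) - b * (v * h1 - u * h2) =
  m * (b * (u * (h2 / m - x2) + v * (x1 - h1 / m))).
Proof. by move=> ?; field. Qed.

(** * A competitor with frozen heights solves the ODE *)

Section competitor_ode.
Context {R : realType} (Om : set (vec3 R)) (M : R).
Hypothesis mOm : measurable Om.
Hypothesis OmM : forall x, Om x -> `|c1 x| <= M /\ `|c2 x| <= M /\ `|c3 x| <= M.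
Hypothesis Om1 : @leb3 R Om = 1%E.
Context (N : nat) (m : 'I_N -> R) (i0 : 'I_N).
Hypothesis m_gt0 : forall i, 0 < m i.
Hypothesis m_sum : \sum_i m i = 1.
Context (h : 'I_N -> R) (r : R).
Hypothesis r0 : 0 < r.
Hypothesis hr : forall i j, i != j -> r <= `|h i - h j|.
Context (T : R).
Hypothesis T0 : 0 < T.
Context (Y : R -> 'I_N * bool -> R).
Hypothesis Yc : forall k, ccl T (fun t => Y t k).
Hypothesis Yw : weak_geostrophic Om T m (pos h (Y 0)) m (fun i t => pos h (Y t) i).
Local Notation J := (Jint T).
Local Notation z := (fun i t => pos h (Y t) i).
Local Notation hmom t k := (hmoment Om (opt Om m i0 h (Y t)) k).
Local Notation vel t k := (velocity Om m i0 h (Y t) k).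

(** The support has half-width [2 r / 3], below the gap [r], so each height is isolated. *)
Lemma cut_height i j : cut (h j) (r / 3) (h i) = (i == j)%:R.
Proof.
have r0' := r0; have r3 : 0 < r / 3 by rewrite divr_gt0.
have [->|ij] := eqVneq i j; first by rewrite cut1// subrr normr0 ltW.
by rewrite cut0//; have := hr ij; lra.
Qed.

Lemma ccl_vel k : ccl T (fun t => vel t k).
Proof. exact: (continuous_velocity mOm OmM Om1 m_gt0 m_sum r0 hr Yc). Qed.

Lemma velocityE t k : vel t k =
  (~~ k.2)%:R * (hmom t (k.1, true) / m k.1 - Y t (k.1, true)) +
  (k.2)%:R * (Y t (k.1, false) - hmom t (k.1, false) / m k.1).
Proof.
by rewrite /velocity; case: k.2; rewrite ?mul1r ?mul0r ?add0r ?addr0.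
Qed.

(* [u] and [v] are the gradient, constant on the range of the trajectories, of the
   truncated horizontal coordinate function [a1 (c1 y) * a2 (c2 y)]. *)
Lemma integrated_ode_test (a1 a2 : R -> R) (Z u v : R) (k : 'I_N * bool) :
  smooth a1 -> smooth a2 -> compact_supp a1 -> compact_supp a2 ->
  (forall x y : R, `|x| < Z -> `|y| < Z -> [/\ a1 x * a2 y = (if k.2 then y else x),
     a1^`()%classic x * a2 y = u & a1 x * a2^`()%classic y = v]) ->
  (u = (~~ k.2)%:R) -> (v = (k.2)%:R) ->
  (forall i t, 0 <= t <= T -> `|Y t (i, false)| < Z /\ `|Y t (i, true)| < Z) ->
  forall s eps : R, 0 <= s -> 0 < eps -> s + eps <= T ->
  J (fun t => (tcut s eps)^`()%classic t * Y t k) + J (fun t => tcut s eps t * vel t k)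
  + Y 0 k = 0.
Proof.
move=> s1 s2 k1 k2 ha eu ev hZ s eps s0 e0 sT.
(* The vertical factor selects the particle [j], so every sum over particles collapses to one
   term. *)
set j := k.1; pose a3 := cut (h j) (r / 3).
have r3 : 0 < r / 3 by rewrite divr_gt0.
have s3 : smooth a3 by exact: smooth_cut.
have k3 : compact_supp a3 by exact: compact_cut.
have z1 i : ccl T (fun t => c1 (z i t)) by exact: Yc.
have z2 i : ccl T (fun t => c2 (z i t)) by exact: Yc.
have z3 i : ccl T (fun t => c3 (z i t)) by exact: ccl_cst.
have tt := test_tensor s1 s2 s3 (smooth_tcut s eps) k1 k2 k3 (compact_tcut s e0).
set b := tcut s eps in tt *.
have cb : ccl T b by exact: ccl_tcut.
have cdb : ccl T b^`()%classic by exact: ccl_dtcut.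
pose H1 t := hmom t (j, false); pose H2 t := hmom t (j, true).
have cH1 : ccl T H1 by exact: (continuous_hmom mOm OmM Om1 m_gt0 m_sum r0 hr Yc).
have cH2 : ccl T H2 by exact: (continuous_hmom mOm OmM Om1 m_gt0 m_sum r0 hr Yc).
have mj : m j != 0 by rewrite gt_eqF.
have sp b1 b2 t i : spat b1 b2 a3 (z i t) =
    b1 (Y t (i, false)) * b2 (Y t (i, true)) * (i == j)%:R.
  by rewrite /spat /pos /c1 /c2 /c3 /= /a3 cut_height.
have pick (F : 'I_N -> R) : \sum_i F i * (i == j)%:R = F j.
  rewrite (bigD1 j)//= eqxx mulr1 big1 ?addr0// => i /negbTE ->; by rewrite mulr0.
have hj t : 0 <= t <= T -> [/\ a1 (Y t (j, false)) * a2 (Y t (j, true)) = Y t k,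
    a1^`()%classic (Y t (j, false)) * a2 (Y t (j, true)) = u &
    a1 (Y t (j, false)) * a2^`()%classic (Y t (j, true)) = v].
  move=> tT; have [y1 y2] := hZ j t tT; have [-> -> ->] := ha _ _ y1 y2.
  by split=> //; rewrite /j; case: (k) => i [].
have I0 : 0 <= (0 : R) <= T by rewrite lexx ltW.
have := weak_tensor T0 z1 z2 z3 Yw s1 s2 s3 k1 k2 k3 s0 e0 sT; rewrite -/b.
have cdr : ccl T (drift Om m i0 h Y (tensor a1 a2 a3 b)).
  exact: (continuous_drift mOm OmM Om1 m_gt0 m_sum r0 hr T0 Yc tt.1).
have -> : (\int[@lebesgue_measure R]_(t in `[0%R, T]%classic)
     (\int[@leb3 R]_(x in Om) (dot3 (Jmul x) (grad_ (tensor a1 a2 a3 b)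
         (gradB Om (disc m (fun i => z i t)) x) t))%:E) =
     (J (drift Om m i0 h Y (tensor a1 a2 a3 b)))%:E)%E.
  rewrite -(JintE cdr); apply: eq_integral => t _.
  exact: (integral_gradB_drift mOm OmM Om1 i0 m_gt0 m_sum r0 hr Y t tt.1).
have -> : J (drift Om m i0 h Y (tensor a1 a2 a3 b)) = J (fun t => b t * (v * H1 t - u * H2 t)).
  apply: Jint_ext => // t tT; rewrite /drift.
  have [_ hu hv] := hj t tT.
  rewrite (eq_bigr (fun i => b t * (hmom t (i, false) *
      (a1 (Y t (i, false)) * a2^`()%classic (Y t (i, true))) -
    hmom t (i, true) * (a1^`()%classic (Y t (i, false)) * a2 (Y t (i, true)))) * (i == j)%:R)).
    by rewrite pick hu hv /H1 /H2 (mulrC v) (mulrC u).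
  move=> i _; rewrite d1_tensor// d2_tensor// /tensor -!/(spat _ _ a3 (z i t)) !sp.
  move: (hmom t (i, false)) (hmom t (i, true)) => A B; ring.
have -> : J (fun t => b^`()%classic t * spatm m z a1 a2 a3 t) =
    m j * J (fun t => b^`()%classic t * Y t k).
  rewrite -JintZ; last exact: cclM.
  apply: Jint_ext => // t tT; have [hF _ _] := hj t tT; rewrite /spatm.
  under eq_bigr => i _ do rewrite sp mulrA.
  by rewrite pick hF mulrCA.
have -> : J (fun t => b t * spatg m z a1 a2 a3 t) =
    J (fun t => b t * (m j * (v * Y t (j, false) - u * Y t (j, true)))).
  apply: Jint_ext => // t tT; have [_ hu hv] := hj t tT; rewrite /spatg; congr (_ * _).
  rewrite (eq_bigr (fun i => m i * ((a1 (Y t (i, false)) * a2^`()%classic (Y t (i, true)))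
     * Y t (i, false) - (a1^`()%classic (Y t (i, false)) * a2 (Y t (i, true))) * Y t (i, true))
     * (i == j)%:R)); first by rewrite pick hu hv.
  by move=> i _; rewrite !sp /pos /c1 /c2 /=; ring.
have -> : \sum_i m i * spat a1 a2 a3 (pos h (Y 0) i) = m j * Y 0 k.
  have [hF _ _] := hj 0 I0.
  under eq_bigr => i _ do rewrite (sp a1 a2 0 i) mulrA.
  by rewrite pick hF.
have e : m j * J (fun t => b t * vel t k) =
    J (fun t => b t * (m j * (v * Y t (j, false) - u * Y t (j, true)))) -
    J (fun t => b t * (v * H1 t - u * H2 t)).
  rewrite -JintB.
  - rewrite -JintZ; last by apply: cclM => //; exact: ccl_vel.
    apply: Jint_ext => // t _.
    by rewrite velocityE -eu -ev ode_test_algebra.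
  - apply: cclM => //; apply: cclM; first exact: ccl_cst.
    by apply: cclB; apply: cclM => //; exact: ccl_cst.
  - apply: cclM => //.
    by apply: cclB; apply: cclM => //; exact: ccl_cst.
move=> [hw]; apply: (mulfI mj); rewrite mulr0 !mulrDr e hw; ring.
Qed.

(** The test function is the truncated coordinate named by [k], times a plateau in the other
    horizontal variable, both wide enough to contain the trajectories. *)
Lemma integrated_ode k (s eps : R) : 0 <= s -> 0 < eps -> s + eps <= T ->
  J (fun t => (tcut s eps)^`()%classic t * Y t k) + J (fun t => tcut s eps t * vel t k)
  + Y 0 k = 0.
Proof.
have [Z Z0 [hZ _]] := @trajectory_bounded _ _ T0 _ (fun _ : 'I_N => (0, 0, 0) : vec3 R) _ z
  (fun i => @Yc (i, false)) (fun i => @Yc (i, true)).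
have hxy (x y : R) : `|x| < Z -> `|y| < Z -> xcut Z x * cut 0 Z y = x /\
    (xcut Z)^`()%classic x * cut 0 Z y = 1 /\ xcut Z x * (cut 0 Z)^`()%classic y = 0.
  move=> xZ yZ; rewrite xcutE ?(ltW xZ)// cut1 ?subr0 ?(ltW yZ)//.
  by rewrite dxcut// dcut0 ?subr0// !mulr1 mulr0.
have sx := smooth_xcut Z; have sc := smooth_cut 0 Z.
have kx := compact_xcut Z0; have kc := compact_cut 0 Z0.
have [k2|k2] := boolP k.2.
  apply: (integrated_ode_test (a1 := cut 0 Z) (a2 := xcut Z) (Z := Z) (u := 0) (v := 1)) => //;
    rewrite ?k2// => x y xZ yZ.
  by have [h1 [h2 h3]] := hxy y x yZ xZ; split; rewrite mulrC.
apply: (integrated_ode_test (a1 := xcut Z) (a2 := cut 0 Z) (Z := Z) (u := 1) (v := 0)) => //;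
  rewrite ?(negbTE k2)// => x y xZ yZ.
by have [h1 [h2 h3]] := hxy x y xZ yZ.
Qed.

(** [Y] may be arbitrary outside [[0, T]], so two-sided derivatives are obtained for the primitive
    of the velocity along [Y]. Both satisfy the same integrated identity, so their difference
    vanishes on [[0, T]] by [tcut_test_eq0]. *)
Lemma competitor_solves_ode : exists X : R -> 'I_N * bool -> R,
  (forall k (t : R), 0 <= t <= T -> X t k = Y t k) /\
  (forall k (t : R), 0 <= t <= T -> is_derive t 1 (X ^~ k) (velocity Om m i0 h (X t) k)).
Proof.
have hk k : exists P : R -> R, P 0 = Y 0 k /\
    forall t : R, 0 <= t <= T -> is_derive t 1 P (vel t k).
  have [G G0 dG] := continuous_antiderivative (@ccl_vel k).
  exists (fun t => Y 0 k + G t); split; first by rewrite G0 addr0.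
  move=> t tT; have /andP[t0 _] := tT.
  have := is_deriveD' (is_derive_cst' (Y 0 k) t) (dG t _).
  rewrite add0r clamp_id//; apply; lra.
have [P hP] := choice hk; exists (fun t k => P k t).
have PY k (t : R) : 0 <= t <= T -> P k t = Y t k.
  have [P0 dP] := hP k.
  have cP : ccl T (P k).
    apply: continuous_comp_clamp => // t' /dP; exact: is_derive_continuous.
  have cq : ccl T (fun t => P k t - Y t k) by apply: cclB.
  move=> tT; apply/eqP; rewrite -subr_eq0; apply/eqP; move: t tT.
  apply: (tcut_test_eq0 T0 cq) => s eps s0 e0 sT.
  have cd := @ccl_dtcut R T T0 s eps; have ct := @ccl_tcut R T T0 s eps.
  have cv := @ccl_vel k.
  have dF (t : R) : 0 <= t <= T -> is_derive t 1 (fun t => tcut s eps t * P k t)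
      ((tcut s eps)^`()%classic t * P k t + tcut s eps t * vel t k).
    by move=> /dP; exact: is_deriveM' (smooth_is_derive t (smooth_tcut s eps)).
  have cf : ccl T (fun t => (tcut s eps)^`()%classic t * P k t + tcut s eps t * vel t k).
    by apply: cclD; exact: cclM.
  have := Jint_FTC T0 dF cf; rewrite JintD; [|exact: cclM|exact: cclM].
  rewrite (tcut_atT T0)// tcut_at0// mul0r mul1r P0.
  have := integrated_ode k s0 e0 sT.
  rewrite (@Jint_ext _ _ T0 (fun t => _ * (P k t - Y t k))
    (fun t => (tcut s eps)^`()%classic t * P k t - (tcut s eps)^`()%classic t * Y t k)); last first.
    by move=> t _; rewrite mulrBr.
  rewrite JintB; [|exact: cclM|exact: cclM].
  move: (J _) (J (fun t => _ * Y t k)) (J (fun t => _ * P k t)) => A B C hA hB.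
  lra.
split=> // k t tT; have [_ /(_ t tT)] := hP k.
rewrite (_ : (fun k => P k t) = Y t)//; apply/funext => k'; exact: PY.
Qed.

End competitor_ode.

(** * Wasserstein continuity, and assembly of existence, uniqueness and energy conservation *)

(** The diagonal coupling is admissible. *)
Lemma W2disc_le (R : realType) (N : nat) (m : 'I_N -> R) (x y : 'I_N -> vec3 R) :
  (forall i, 0 < m i) ->
  W2disc m x m y <= Num.sqrt (\sum_i m i * dist2 (x i) (y i)).
Proof.
move=> m0; rewrite /W2disc ler_wsqrtr//; apply: ge_inf.
  exists 0 => _ [pi [[pi0 _] ->]].
  apply: sumr_ge0 => i _; apply: sumr_ge0 => j _; rewrite mulr_ge0//.
  by rewrite /dist2 !addr_ge0// sqr_ge0.
exists (fun i j => m i * (i == j)%:R); split; [split; last split|].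
- by move=> i j; rewrite mulr_ge0// ltW.
- by move=> i; rewrite -mulr_sumr (bigD1 i)//= eqxx big1 ?addr0 ?mulr1// => j /negbTE;
    rewrite eq_sym => ->.
- move=> j; rewrite (bigD1 j)//= eqxx big1 ?addr0 ?mulr1// => i /negbTE ->.
  by rewrite mulr0.
- apply: eq_bigr => i _; rewrite (bigD1 i)//= eqxx mulr1 big1 ?addr0// => j /negbTE.
  by rewrite eq_sym => ->; rewrite mulr0 mul0r.
Qed.

Theorem theorem3p5 (R : realType) (Omega : set (vec3 R)) (Nb : nat)
  (T : R) (mb : 'I_Nb -> R) (zb : 'I_Nb -> vec3 R) :
  open Omega -> bounded3 Omega -> convex3 Omega -> @leb3 R Omega = 1%E ->
  (2 <= Nb)%N -> 0 < T ->
  inQN mb zb -> well_prepared zb ->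
  exists (N : nat) (m : 'I_N -> R) (z : 'I_N -> R -> vec3 R),
    discrete_geostrophic_solution Omega T mb zb m z /\
    (forall (N' : nat) (m' : 'I_N' -> R) (z' : 'I_N' -> R -> vec3 R),
       discrete_geostrophic_solution Omega T mb zb m' z' ->
       forall t, 0 <= t <= T ->
         disc m' (fun i => z' i t) = disc m (fun i => z i t)) /\
    energy_conserving Omega T m z.
Proof.
move=> oOm [M OmM] _ Om1 Nb2 T0 [mb0 [mbs zbi]] [r [r0 gzb]].
have mOm := open_vec3_measurable oOm.
have i0 : 'I_Nb by exact: (Ordinal (ltnW Nb2)).
pose h j := c3 (zb j).
have hr i j : i != j -> r <= `|h i - h j| by exact: gzb.
have K0 := Kvel_ge0 mOm OmM Om1 mb0 r0.
have lipV := velocity_lip mOm OmM Om1 i0 mb0 mbs r0 hr.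
pose x0 (k : 'I_Nb * bool) := if k.2 then c2 (zb k.1) else c1 (zb k.1).
have [X [X0 dX]] := picard K0 T0 lipV x0.
have Xc k : continuous (fun s => X (clamp T s) k).
  apply: (continuous_comp_clamp T0 (Y := X ^~ k)) => t tT.
  exact: is_derive_continuous (dX k t tT).
have posX0 : pos h (X 0) = zb.
  apply/funext => j; rewrite /pos !X0 /x0 /h /c1 /c2 /c3 /=.
  by case: (zb j) => [[]].
have I0 : 0 <= (0 : R) <= T by rewrite lexx ltW.
exists Nb, mb, (fun i t => pos h (X t) i); split; last split.
- split; last split; last split.
  + move=> t _; split=> //; split=> // i j ij; apply/eqP => /(congr1 c3).
    rewrite /pos /c3 /= => e; have := hr _ _ ij; rewrite e subrr normr0.
    by rewrite leNgt r0.
  + have cv k := continuous_velocity mOm OmM Om1 mb0 mbs r0 hr Xc (k := k).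
    move=> i; split; last split.
    * exact: (C1_of_derive (dX (i, false)) (cv i0 (i, false))).
    * exact: (C1_of_derive (dX (i, true)) (cv i0 (i, true))).
    * apply: (C1_of_derive (g := fun=> 0)) => [t _|s]; first exact: is_derive_cst'.
      exact: cst_continuous.
  + move=> t tT e e0.
    (* This is the cost of the diagonal coupling between times [s] and [t]; the heights do not move,
       so only horizontal increments appear. *)
    have cD : continuous (fun s => \sum_i mb i *
        ((X (clamp T s) (i, false) - X t (i, false)) * (X (clamp T s) (i, false) - X t (i, false)) +
         (X (clamp T s) (i, true) - X t (i, true)) * (X (clamp T s) (i, true) - X t (i, true)))).
      apply: continuous_sum_fun => i s; apply: cvgM; first exact: cvg_cst.
      by apply: cvgD; apply: cvgM; apply: cvgB; (exact: Xc || exact: cvg_cst).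
    have e2 : 0 < e ^+ 2 / 2 by rewrite divr_gt0// exprn_gt0.
    have /continuous_ptP/(_ _ e2)[d d0 hd] := cD t.
    exists d; split=> // s sT st; have := hd s st.
    rewrite !clamp_id// [X in `|_ - X|]big1 ?subr0; last first.
      by move=> i _; rewrite !subrr mulr0 addr0 mulr0.
    move=> hs; apply: le_lt_trans (W2disc_le _ _ mb0) _.
    rewrite -[ltRHS](ger0_norm (ltW e0)) -sqrtr_sqr ltr_sqrt ?exprn_gt0//.
    apply: le_lt_trans (ler_norm _) _.
    apply: (@le_lt_trans _ _ (e ^+ 2 / 2)); last by rewrite ltr_pdivrMr// ltr_pMr ?ltr1n// exprn_gt0.
    apply: le_trans hs; rewrite le_eqVlt; apply/orP; left; apply/eqP; congr `|_|.
    apply: eq_bigr => i _; rewrite /dist2 /pos /c1 /c2 /c3 /= subrr; ring.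
  + by have := weak_solution mOm OmM Om1 mb0 mbs r0 hr T0 Xc dX; rewrite posX0.
- move=> N' m' z' [Q' [C1' [_ w']]] t tT.
  have z1 i : ccl T (fun t => c1 (z' i t)) by apply: C1_ccl => //; case: (C1' i).
  have z2 i : ccl T (fun t => c2 (z' i t)) by apply: C1_ccl => //; case: (C1' i) => _ [].
  have z3 i : ccl T (fun t => c3 (z' i t)) by apply: C1_ccl => //; case: (C1' i) => _ [].
  have [m'0 [_ z'i]] := Q' 0 I0.
  (* The competitor comes with its own number of atoms, masses and order; they are matched with
     those of the initial measure. *)
  have [sg [bsg msg zsg]] := initial_matching mOm OmM Om1 T0 z1 z2 z3 w' m'0 mb0 z'i zbi.
  have hc i := height_constant mOm OmM Om1 T0 z1 z2 z3 w' m'0 r0 gzb i.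
  (* After relabelling, the heights agree with those of the constructed solution, and only the
     horizontal coordinates remain to be identified. *)
  pose Y t (k : 'I_Nb * bool) := if k.2 then c2 (z' (sg k.1) t) else c1 (z' (sg k.1) t).
  have zY j (s : R) : 0 <= s <= T -> z' (sg j) s = pos h (Y s) j.
    move=> sT; rewrite /pos /Y /= /h -zsg -(hc _ _ sT) /c1 /c2 /c3.
    by case: (z' _ _) => [[]].
  have [wY ->//] := weak_reindex T0 w' bsg msg zY.
  have Yc k : ccl T (fun t => Y t k) by rewrite /Y; case: k.2; [exact: z2|exact: z1].
  have zb0 : zb = pos h (Y 0) by apply/funext => j; rewrite -zY.
  have wY' : weak_geostrophic Omega T mb (pos h (Y 0)) mb (fun i t => pos h (Y t) i).
    by rewrite -zb0.
  have [Z [ZY dZ]] := competitor_solves_ode mOm OmM Om1 i0 mb0 mbs r0 hr T0 Yc wY'.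
  have Z0 k : Z 0 k = X 0 k.
    by rewrite ZY// X0 /Y /x0 !zsg.
  have ZX k := ode_uniqueness K0 lipV Z0 dZ dX k tT.
  congr (disc mb _); apply/funext => j.
  by rewrite /pos -!ZY// !ZX.
- move=> s t sT tT; have eE := energyE mOm OmM Om1 i0 mb0 mbs r0 hr.
  apply: (etrans (eE (X s))); apply: (etrans _ (esym (eE (X t)))).
  exact: (congr1 EFin (energy_constant mOm OmM Om1 mb0 mbs r0 hr dX sT tT)).
Qed.
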